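(* Let $\mathcal S$ be any one of the following seven subsets of $\{-1,0,1\}^2\setminus\{(0,0)\}$: 1. $\{(1,0),(0,1),(1,1),(-1,-1)\}$; 2. $\{(-1,0),(0,-1),(1,1),(-1,-1)\}$; 3. $\{(-1,0),(0,-1),(0,1),(1,0),(-1,-1)\}$; 4. $\{(-1,1),(1,-1),(0,1),(1,0),(-1,-1)\}$; 5. $\{(-1,1),(1,-1),(0,1),(1,0),(-1,-1),(1,1)\}$; 6. $\{(-1,1),(1,-1),(0,-1),(-1,0),(-1,-1),(1,1)\}$; 7. $\{(-1,1),(1,-1),(0,-1),(-1,0),(-1,-1),(0,1),(1,0)\}$. Let $M_{\mathcal S}\subset\mathbb C^2$ (with coordinates $(z,w)$) be the real algebraic set defined by $$w\overline w-z\sum_{(a,b)\in\mathcal S}w^{a+1}\,\overline w^{\,b+1}=0 .$$ Then $(M_{\mathcal S},0)$ is the germ of an elliptic Bishop surface, and $(M_{\mathcal S},0)$ does not have the Nash-Artin approximation Property.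
   Context: Nash-Artin approximation Property. Let $(M,0)\subset(\mathbb C^N,0)$ be the germ of a real algebraic manifold (a germ at $0$ of a real algebraic set that is smooth at $0$). One says that $(M,0)$ has the Nash-Artin approximation Property if the following holds: for every $N'$, every real algebraic set $\Gamma\subset\mathbb C^N\times\mathbb C^{N'}$, every germ of holomorphic map $h:(\mathbb C^N,0)\to\mathbb C^{N'}$ such that $$\operatorname{Graph}(h)\cap(M\times\mathbb C^{N'})\subset\Gamma,$$ and every $c\in\mathbb N$, there is a holomorphic algebraic map germ $h_c:(\mathbb C^N,0)\to\mathbb C^{N'}$ such that $$\operatorname{Graph}(h_c)\cap(M\times\mathbb C^{N'})\subset\Gamma$$ and $h_c$ agrees with $h$ up to order $c$ (their Taylor expansions at $0$ agree up to order $c$). Here the inclusions are inclusions of germs, i.e. they are required to hold for points of $M$ sufficiently close to $0$. A holomorphic map germ is algebraic if its components are algebraic power series, i.e. convergent power series in $z=(z_1,\dots,z_N)$ that are algebraic over the polynomial ring $\mathbb C[z]$. Real algebraic sets in $\mathbb C^m\cong\mathbb R^{2m}$ are zero sets of finitely many real polynomials in the real and imaginary parts of the coordinates (equivalently, real-valued polynomials in the coordinates and their conjugates). Bishop surfaces. A germ at $0$ of a real analytic surface in $\mathbb C^2$ (coordinates $(z,w)$) given by an equation $z=w\overline w+\lambda(w^2+\overline w^2)+E(w,\overline w)$, with $0\le\lambda<\infty$ and $E$ a (complex-valued) real analytic germ vanishing to order at least three at the origin, is a germ of a Bishop surface with Bishop invariant $\lambda$. It is called elliptic if $0\le\lambda<1/2$.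 *)

(* Defs.v *)
From HB Require Import structures.
From mathcomp Require Import all_boot all_order all_algebra.
(* mpoly has to be imported before the analysis files: in the other order     *)
(* their notations are rejected.                                              *)
From mathcomp Require Import complex mpoly.
From mathcomp Require Import boolp classical_sets reals topology normedtype.

Set Implicit Arguments.
Unset Strict Implicit.
Unset Printing Implicit Defensive.

Import Order.TTheory GRing.Theory Num.Theory.
Import numFieldNormedType.Exports.
Local Open Scope classical_set_scope.
Local Open Scope ring_scope.

(* R[i] packed as a numClosedFieldType: in this form it inherits the norm     *)
(* topology that every numFieldType carries, and 'rV[CC R]_n the product one. *)
Definition CC (R : realType) : numClosedFieldType := R[i].

Section Germs.
Variables (R : realType) (n : nat).
Implicit Types (a : 'X_{1..n} -> CC R) (z : 'rV[CC R]_n).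
Implicit Types (f g : 'rV[CC R]_n -> CC R).

(* A map germ at 0 is represented by a total function; only its values near 0 *)
(* matter.  A function germ is holomorphic when it is near 0 the sum of a     *)
(* convergent power series.                                                   *)

Definition monomial_at z (m : 'X_{1..n}) : CC R := \prod_(i < n) z 0 i ^+ m i.

Definition partial_sum a z (d : nat) : CC R :=
  \sum_(m : 'X_{1..n < d}) a m * monomial_at z m.

(* \sum_m |a m| r ^ |m| < +oo for some radius r > 0.                          *)
Definition convergent_series a : Prop :=
  exists r B : CC R, 0 < r /\
    forall d : nat, \sum_(m : 'X_{1..n < d}) `|a m| * r ^+ mdeg m <= B.

Definition taylor_series f a : Prop :=
  convergent_series a /\
  \forall z \near (0 : 'rV[CC R]_n), partial_sum a z @ \oo --> f z.

Definition holomorphic_germ f : Prop := exists a, taylor_series f a.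

Definition eval_poly_at (P : {poly {mpoly (CC R)[n]}}) z (t : CC R) : CC R :=
  (map_poly (meval (fun i => z 0 i)) P).[t].

(* A convergent power series that is algebraic over CC[z_1, .., z_n].         *)
Definition algebraic_germ f : Prop :=
  holomorphic_germ f /\
  exists2 P : {poly {mpoly (CC R)[n]}}, P != 0 &
    \forall z \near (0 : 'rV[CC R]_n), eval_poly_at P z (f z) = 0.

Definition agree_up_to (c : nat) f g : Prop :=
  exists a b, [/\ taylor_series f a, taylor_series g b &
    forall m : 'X_{1..n}, (mdeg m <= c)%N -> a m = b m].

End Germs.

Section RealAlgebraicSets.
Variables (R : realType) (n : nat).

(* (Re x_1, .., Re x_n, Im x_1, .., Im x_n)                                   *)
Definition real_coords (x : 'rV[CC R]_n) (k : 'I_(n + n)) : R :=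
  row_mx (map_mx (@complex.Re R) x) (map_mx (@complex.Im R) x) 0 k.

Definition real_algebraic_set (A : set 'rV[CC R]_n) : Prop :=
  exists ps : seq {mpoly R[n + n]},
    A = [set x | all (fun p => p.@[real_coords x] == 0) ps].

End RealAlgebraicSets.

(* Graph(h) `&` (M x CC^n') is contained in G, as germs at M x CC^n' over 0;  *)
(* CC^n x CC^n' is identified with CC^(n + n').                               *)
Definition graph_over_sub (R : realType) (n n' : nat) (M : set 'rV[CC R]_n)
    (h : 'rV[CC R]_n -> 'rV[CC R]_n') (G : set 'rV[CC R]_(n + n')) : Prop :=
  \forall z \near (0 : 'rV[CC R]_n), M z -> G (row_mx z (h z)).

(* The property is only meant for sets M whose germ at 0 is that of a real    *)
(* algebraic manifold.                                                        *)
Definition nash_artin_property (R : realType) (n : nat)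
    (M : set 'rV[CC R]_n) : Prop :=
  forall (n' : nat) (G : set 'rV[CC R]_(n + n'))
         (h : 'rV[CC R]_n -> 'rV[CC R]_n'),
    real_algebraic_set G ->
    (forall j, holomorphic_germ (fun z => h z 0 j)) ->
    graph_over_sub M h G ->
    forall c : nat, exists hc : 'rV[CC R]_n -> 'rV[CC R]_n',
      [/\ forall j, algebraic_germ (fun z => hc z 0 j),
          graph_over_sub M hc G
        & forall j, agree_up_to c (fun z => h z 0 j) (fun z => hc z 0 j)].

Section Surfaces.
Variable R : realType.

(* Points of CC^2 are p = (z, w) with z = p 0 0 and w = p 0 1.                *)
Definition pair_row (u v : CC R) : 'rV[CC R]_2 :=
  \row_(j < 2) (if j == 0 then u else v).

(* A complex-valued real analytic germ E(w, w^* ) is the restriction to       *)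
(* v = w^* of the sum F(w, v) of a convergent power series in two variables.  *)
Definition bishop_surface (lambda : R) (M : set 'rV[CC R]_2) : Prop :=
  0 <= lambda /\
  exists (F : 'rV[CC R]_2 -> CC R) (e : 'X_{1..2} -> CC R),
    [/\ taylor_series F e,
        forall m : 'X_{1..2}, (mdeg m < 3)%N -> e m = 0
      & \forall p \near (0 : 'rV[CC R]_2),
          let z := (p : 'rV[CC R]_2) 0 0 in let w := (p : 'rV[CC R]_2) 0 1 in
          M p <-> z = w * w^* + (lambda%:C)%C * (w ^+ 2 + w^* ^+ 2)
                      + F (pair_row w w^*)].

Definition elliptic_bishop_surface (M : set 'rV[CC R]_2) : Prop :=
  exists2 lambda : R, lambda < 2^-1 & bishop_surface lambda M.

(* All exponents are nonnegative for S in step_sets below.                    *)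
Definition M_ (S : seq (int * int)) : set 'rV[CC R]_2 :=
  [set p | let z := p 0 0 in let w := p 0 1 in
    w * w^* - z * \sum_(s <- S) w ^ (s.1 + 1) * w^* ^ (s.2 + 1) = 0].

End Surfaces.

Definition step_sets : seq (seq (int * int)) := [::
  [:: (1, 0); (0, 1); (1, 1); (-1, -1)];
  [:: (-1, 0); (0, -1); (1, 1); (-1, -1)];
  [:: (-1, 0); (0, -1); (0, 1); (1, 0); (-1, -1)];
  [:: (-1, 1); (1, -1); (0, 1); (1, 0); (-1, -1)];
  [:: (-1, 1); (1, -1); (0, 1); (1, 0); (-1, -1); (1, 1)];
  [:: (-1, 1); (1, -1); (0, -1); (-1, 0); (-1, -1); (1, 1)];
  [:: (-1, 1); (1, -1); (0, -1); (-1, 0); (-1, -1); (0, 1); (1, 0)] ].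

Section RealAlgebraicM.
Variable R : realType.

Let real_poly (n : nat) (f : 'rV[CC R]_n -> CC R) :=
  exists p q : {mpoly R[n + n]}, forall x,
    f x = (p.@[real_coords x] +i* q.@[real_coords x])%C.

Lemma real_polyD n f g : @real_poly n f -> real_poly g ->
  real_poly (fun x => f x + g x).
Proof.
move=> [p [q fE]] [p' [q' gE]]; exists (p + p'), (q + q') => x.
by rewrite fE gE !mevalD.
Qed.

Lemma real_polyM n f g : @real_poly n f -> real_poly g ->
  real_poly (fun x => f x * g x).
Proof.
move=> [p [q fE]] [p' [q' gE]].
exists (p * p' - q * q'), (p * q' + q * p') => x.
by rewrite fE gE mevalB mevalD !mevalM.
Qed.

Lemma real_polyC n (c : CC R) : real_poly (fun _ : 'rV[CC R]_n => c).
Proof.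
exists (complex.Re c)%:MP, (complex.Im c)%:MP => x.
by rewrite !mevalC; case: c.
Qed.

Lemma real_polyJ n f : @real_poly n f -> real_poly (fun x => (f x)^*).
Proof.
by move=> [p [q fE]]; exists p, (- q) => x; rewrite fE mevalN.
Qed.

Lemma real_polyX n (i : 'I_n) : real_poly (fun x : 'rV[CC R]_n => x 0 i).
Proof.
exists 'X_(lshift n i), 'X_(rshift n i) => x.
rewrite !mevalXU /real_coords row_mxEl row_mxEr !mxE.
by case: (x 0 i).
Qed.

Lemma real_polyXn n f k : @real_poly n f -> real_poly (fun x => f x ^+ k).
Proof.
move=> fP; elim: k => [|k IH]; first exact: real_polyC.
have [p [q E]] := real_polyM fP IH.
by exists p, q => x; rewrite exprS E.
Qed.

Lemma real_algebraic_M_ (S : seq (int * int)) :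
  S \in step_sets -> real_algebraic_set (@M_ R S).
Proof.
move=> SP.
have Spos s : s \in S -> (0 <= s.1 + 1) && (0 <= s.2 + 1).
  move: s; apply/allP; move: S SP.
  by apply/(@allP _ (fun S : seq (int * int) => all _ S)).
suff [p [q E]] : real_poly (fun x : 'rV[CC R]_2 => x 0 1 * (x 0 1)^*
    + (- 1) * (x 0 0 * \sum_(s <- S) x 0 1 ^ (s.1 + 1) * (x 0 1)^* ^ (s.2 + 1))).
  exists [:: p; q]; apply/seteqP; split=> x; rewrite /M_ /=.
    by rewrite -mulN1r E andbT => /eqP; rewrite eq_complex.
  by rewrite andbT -mulN1r E => pq; apply/eqP; rewrite eq_complex.
apply: real_polyD; first by apply: real_polyM; [|apply: real_polyJ];
  exact: real_polyX.
apply: real_polyM; first exact: real_polyC.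
apply: real_polyM; first exact: real_polyX.
elim: S Spos {SP} => [|s S IH] Spos.
  by have [p [q E]] := real_polyC 2 0; exists p, q => x; rewrite big_nil.
have {}IH := IH (fun t tS => Spos t (mem_behead (s := s :: S) tS)).
have /andP[] := Spos s (mem_head _ _).
case ek: (s.1 + 1) => [k|//] _; case el: (s.2 + 1) => [l|//] _.
have [] := real_polyD (real_polyM (real_polyXn k (real_polyX 1))
   (real_polyXn l (real_polyJ (real_polyX 1)))) IH.
by move=> p [q E]; exists p, q => x; rewrite big_cons ek el E.
Qed.

End RealAlgebraicM.

(* Main.v *)
Require Import Defs.
From HB Require Import structures.
From mathcomp Require Import all_boot all_order all_algebra.
From mathcomp Require Import complex ssrcomplements mpoly.
From mathcomp Require Import boolp classical_sets reals topology normedtype.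
From mathcomp Require Import polyrcf ring lra zify.

(* Write [S(w, w^* )] for the sum over the steps, so that [z = w w^* / S(w, w^* )] *)
(* on the surface, and [T(x, y) = x y / S(x, y)] for independent variables.    *)
(* For nonreal [al], counting weighted walks in the quarter plane with steps   *)
(* in [S] produces a convergent series [f(z, w)] with real coefficients such   *)
(* that [f + f^* = P(w w^* )] on the surface, where                            *)
(* [P(X) = 1 / (al - X) + 1 / (al^* - X)].  Clearing denominators, this is the *)
(* real algebraic condition imposed on the graphs.                             *)
(*   Suppose that an algebraic [f] satisfies it.  A minimal equation of [f]    *)
(* over [CC(z, w)] stays minimal on the surface, over the rational functions   *)
(* of [w, w^*], because [w^*] is quadratic over [CC(z, w)] with a discriminant *)
(* of odd order along some curve.  Comparing the two top coefficients of the   *)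
(* minimal equations of [f] and of [P - f^*], of degree [n], and replacing     *)
(* [(w, w^* )] by independent [(x, y)], one gets rational functions with       *)
(* [A(x, T) + B(y, T) = - n P(x y)], [T = T(x, y)].                            *)
(*   This is impossible when [al = x0^2] for a suitable critical point         *)
(* [(x0, x0)] of [T].  There the level curve of [T] is a node, and moving      *)
(* along it while fixing [x], then [y], dilates the slope of the leading terms *)
(* by a factor [sg^4], [|sg| > 1].  The leading forms of [A] and [B], seen as  *)
(* rational functions of one variable, are each invariant under one of the two *)
(* reflections, so that a pole has an infinite orbit; but [P(x y)] has a       *)
(* simple pole there.                                                          *)

Set Implicit Arguments.
Unset Strict Implicit.
Unset Printing Implicit Defensive.

Import Order.TTheory GRing.Theory Num.Theory.
Import numFieldNormedType.Exports.
Local Open Scope ring_scope.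

(** * One-variable asymptotics along rays *)

(** Bishop form: on the surface [z = T(w, v) = w v / S(w, v)], where [v] is the conjugate of [w].
    Expanding [T] at 0 gives [w v] plus terms of degree at least three, so the Bishop invariant is 0
    ([T_arr_sum], [elliptic_bishop]).

    A holomorphic solution: the kernel method ([walk_equation]) yields a convergent [f] with real
    coefficients such that [f(z, w) + f(z, v) = P(w v)] as soon as [w v = z S(w, v)]. On the surface
    [z] is real, so [f(z, v)] is the conjugate of [f(z, w)], and the graph of [f] lies over the
    surface in a real algebraic set. In [not_nash_artin] no algebraic germ at all satisfies the same
    inclusion, whatever the order of approximation.

    From an algebraic solution to rational functions: let [n] be the degree of a minimal equation of
    [f]. Substituting [P] minus the conjugate of [f] into it gives a second equation of degree [n]
    for the conjugate. The two are proportional, because the powers of [f] below [n] stay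
    independent after [v] is adjoined ([slice_independence], [slice_lin_indep]). The two top
    coefficients then give [A(x, T) + B(y, T) = - n P(x y)] ([trace_decoupling]).

    Contradiction at a node ([no_rational_decoupling]): put [x = x0 + s (1 + r)] and
    [y = x0 + s (sg^-1 + sg r)]; then [T - T(x0, x0)] is equivalent to [ka r s^2], and leading
    coefficients in [s] are rational functions of [r]. Up to scaling, those of [A] are invariant
    under [r -> 1 / r] and those of [B] under [r -> 1 / (sg^4 r)], while [P] contributes a simple
    pole at [r = - 1 / sg]. The two reflections compose to a dilation by [sg^4], which spreads a
    pole over an infinite orbit ([no_simple_pole]). Poles of higher order in [s] are peeled off
    beforehand with [invariant_ratio]. Suitable nodes are exhibited in [node1] to [node7]. *)

Section Germs1.
Variable C : numClosedFieldType.
Implicit Types (u v g h : C -> C) (s c d r B : C) (m n : nat).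

Lemma pos_min (r1 r2 : C) : 0 < r1 -> 0 < r2 ->
  exists2 r, 0 < r & r <= r1 /\ r <= r2.
Proof.
(* The order of [C] is partial; this harmonic expression stands in for a minimum. *)
move=> r1p r2p; exists (r1 * r2 / (r1 + r2)).
  by rewrite divr_gt0 ?mulr_gt0 ?addr_gt0.
by split; rewrite ler_pdivrMr ?addr_gt0 // mulrDr ?[r2 * r1]mulrC
  ?lerDr ?lerDl ?mulr_ge0 // ltW.
Qed.

(** In the order of [C], [0 < s] makes [s] a positive real: asymptotics are taken along a real
    parameter tending to 0. *)
Definition nearp (P : C -> Prop) : Prop :=
  exists2 r, 0 < r & forall s, 0 < s -> s <= r -> P s.

Lemma nearp_and (P Q : C -> Prop) : nearp P -> nearp Q ->
  nearp (fun s => P s /\ Q s).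
Proof.
move=> [r1 r1p P1] [r2 r2p Q2]; have [r rp [le1 le2]] := pos_min r1p r2p.
exists r => // s sp sr.
by split; [apply: P1 | apply: Q2] => //; apply: le_trans sr _.
Qed.

Lemma nearp_imp (P Q : C -> Prop) : (forall s, 0 < s -> P s -> Q s) ->
  nearp P -> nearp Q.
Proof.
by move=> PQ [r rp Pr]; exists r => // s sp sr; apply: PQ => //; apply: Pr.
Qed.

Lemma nearpT (P : C -> Prop) : (forall s, 0 < s -> P s) -> nearp P.
Proof. by move=> PT; exists 1 => // s sp _; apply: PT. Qed.

Definition bnd g : Prop := exists B, nearp (fun s => `|g s| <= B).

Lemma bnd_ext g h : nearp (fun s => g s = h s) -> bnd g -> bnd h.
Proof.
move=> gh [B gB]; exists B.
by apply: nearp_imp (nearp_and gh gB) => s _ [<-].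
Qed.

Lemma bndD g h : bnd g -> bnd h -> bnd (fun s => g s + h s).
Proof.
move=> [B gB] [B' hB]; exists (B + B').
apply: nearp_imp (nearp_and gB hB) => s _ [gs hs].
by apply: le_trans (ler_normD _ _) _; apply: lerD.
Qed.

Lemma bndM g h : bnd g -> bnd h -> bnd (fun s => g s * h s).
Proof.
move=> [B gB] [B' hB]; exists (B * B').
apply: nearp_imp (nearp_and gB hB) => s _ [gs hs].
by rewrite normrM; apply: ler_pM.
Qed.

Lemma bnd_cst c : bnd (fun=> c).
Proof. by exists `|c|; apply: nearpT. Qed.

Lemma bnd_id : bnd id.
Proof. by exists 1, 1 => // s sp s1; rewrite gtr0_norm. Qed.

Lemma bndX n : bnd (fun s => s ^+ n).
Proof.
elim: n => [|n IH]; first exact: bnd_cst.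
by apply: bnd_ext (bndM bnd_id IH); apply: nearpT => s _; rewrite exprS.
Qed.

Lemma bndN g : bnd g -> bnd (fun s => - g s).
Proof.
move=> /(bndM (bnd_cst (-1))); apply: bnd_ext; apply: nearpT => s _.
by rewrite mulN1r.
Qed.

Lemma bndE g n : bnd g -> bnd (fun s => g s ^+ n).
Proof.
move=> Hg; elim: n => [|n IH]; first exact: bnd_cst.
by apply: bnd_ext (bndM Hg IH); apply: nearpT => s _; rewrite exprS.
Qed.

Lemma bnd_inv g c : c != 0 -> bnd (fun s => (g s - c) / s) ->
  bnd (fun s => (g s)^-1).
Proof.
move=> c0 [B [r rp gB]].
have B0 : 0 <= B by apply: le_trans (gB r rp (lexx _)); apply: normr_ge0.
have B1 : 0 < B + 1 by rewrite ltr_wpDl.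
have cp : 0 < `|c| / 2 by rewrite divr_gt0 ?normr_gt0.
have [r' rp' [le1 le2]] := pos_min rp (divr_gt0 cp B1).
exists (`|c| / 2)^-1, r' => // s sp sr.
rewrite normfV lef_pV2 ?posrE //; last first.
  rewrite normr_gt0; apply/negP => /eqP gs0.
  have := gB s sp (le_trans sr le1).
  rewrite gs0 sub0r normrM normrN normfV (gtr0_norm sp) ler_pdivrMr // => H.
  suff : `|c| < `|c| by rewrite ltxx.
  apply: le_lt_trans H _; apply: (@lt_le_trans _ _ ((B + 1) * s)).
    by rewrite ltr_pM2r // ltrDl.
  apply: (@le_trans _ _ (`|c| / 2)); first by rewrite mulrC -ler_pdivlMr // (le_trans sr).
  by rewrite ler_pdivrMr // ler_peMr // ler1n.
have gs := gB s sp (le_trans sr le1).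
rewrite normrM normfV (gtr0_norm sp) ler_pdivrMr // in gs.
have h : B * s <= `|c| / 2.
  apply: (@le_trans _ _ ((B + 1) * s)); first by rewrite ler_pM2r // lerDl.
  by rewrite mulrC -ler_pdivlMr // (le_trans sr).
have := le_trans (lerB_dist c (g s)) (le_trans _ h); rewrite distrC => /(_ gs).
by rewrite lerBlDr -lerBlDl {1}(splitr `|c|) addrK.
Qed.

Definition O1 n u : Prop := bnd (fun s => u s / s ^+ n).

Lemma O1_ext n u v : nearp (fun s => u s = v s) -> O1 n u -> O1 n v.
Proof.
by move=> uv; apply: bnd_ext; apply: nearp_imp uv => s _ ->.
Qed.

Lemma O1D n u v : O1 n u -> O1 n v -> O1 n (fun s => u s + v s).
Proof.
move=> Hu Hv; apply: bnd_ext (bndD Hu Hv).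
by apply: nearpT => s _; rewrite mulrDl.
Qed.

Lemma O1M m n u v : O1 m u -> O1 n v -> O1 (m + n) (fun s => u s * v s).
Proof.
move=> Hu Hv; apply: bnd_ext (bndM Hu Hv); apply: nearpT => s sp.
by rewrite exprD invfM mulrACA.
Qed.

Lemma O1_bnd u : bnd u -> O1 0 u.
Proof.
by move=> Hu; apply: bnd_ext Hu; apply: nearpT => s _; rewrite divr1.
Qed.

Lemma O1_Xn n : O1 n (fun s => s ^+ n).
Proof.
apply: bnd_ext (bnd_cst 1); apply: nearpT => s sp.
by rewrite divff // expf_neq0 // gt_eqF.
Qed.

Lemma O1_le m n u : (m <= n)%N -> O1 n u -> O1 m u.
Proof.
move=> mn Hu; apply: bnd_ext (bndM Hu (bndX (n - m))); apply: nearpT => s sp.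
have s0 : s != 0 by rewrite gt_eqF.
have -> : s ^+ n = s ^+ m * s ^+ (n - m) by rewrite -exprD subnKC.
by field; rewrite !expf_neq0.
Qed.

Lemma O1_mulb n u g : O1 n u -> bnd g -> O1 n (fun s => u s * g s).
Proof. by move=> Hu /O1_bnd/(O1M Hu); rewrite addn0. Qed.

Lemma O1Z n c u : O1 n u -> O1 n (fun s => c * u s).
Proof.
move=> Hu; apply: O1_ext (O1_mulb Hu (bnd_cst c)).
by apply: nearpT => s _; rewrite mulrC.
Qed.

Lemma O1N n u : O1 n u -> O1 n (fun s => - u s).
Proof.
by move=> /(O1Z (-1)); apply: O1_ext; apply: nearpT => s _; rewrite mulN1r.
Qed.

Lemma O1B n u v : O1 n u -> O1 n v -> O1 n (fun s => u s - v s).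
Proof. by move=> Hu /O1N; apply: O1D. Qed.

Lemma O10 n : O1 n (fun=> 0).
Proof.
by apply: bnd_ext (bnd_cst 0); apply: nearpT => s _; rewrite mul0r.
Qed.

Lemma O1_sum n (I : Type) (rI : seq I) (P : pred I) (F : I -> C -> C) :
  (forall i, P i -> O1 n (F i)) -> O1 n (fun s => \sum_(i <- rI | P i) F i s).
Proof.
move=> HF; elim: rI => [|i rI IH].
  by apply: O1_ext (O10 n); apply: nearpT => s _; rewrite big_nil.
case Pi: (P i); last first.
  by apply: O1_ext IH; apply: nearpT => s _; rewrite big_cons Pi.
by apply: O1_ext (O1D (HF _ Pi) IH); apply: nearpT => s _; rewrite big_cons Pi.
Qed.

Lemma O1_exp m n u : O1 m u -> O1 (m * n) (fun s => u s ^+ n).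
Proof.
move=> Hu; elim: n => [|n IH].
  by rewrite muln0; apply/O1_bnd/bnd_cst.
by rewrite mulnS; apply: O1_ext (O1M Hu IH); apply: nearpT => s _; rewrite exprS.
Qed.

Lemma bnd_O1 n u : O1 n u -> bnd u.
Proof.
move=> /(O1_le (leq0n _)); apply: bnd_ext; apply: nearpT => s _.
by rewrite divr1.
Qed.

(** The coefficient [c] may be 0. Leading terms therefore add and multiply without case distinctions
    on cancellation, and an identity between functions passes to coefficients through
    [lead_uniq]. *)
Definition lead u m c : Prop := O1 m.+1 (fun s => u s - c * s ^+ m).

Lemma lead_ext u v m c : nearp (fun s => u s = v s) -> lead u m c -> lead v m c.
Proof.
by move=> uv; apply: O1_ext; apply: nearp_imp uv => s _ ->.
Qed.

Lemma lead_O1 u m c : lead u m c -> O1 m u.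
Proof.
move=> /(O1_le (leqnSn _)) Hu.
apply: O1_ext (O1D Hu (O1Z c (O1_Xn m))).
by apply: nearpT => s _; rewrite subrK.
Qed.

Lemma lead_O1S u m : lead u m 0 <-> O1 m.+1 u.
Proof.
by split; apply: O1_ext; apply: nearpT => s _; rewrite mul0r subr0.
Qed.

Lemma lead0 u m n : O1 n u -> (m < n)%N -> lead u m 0.
Proof. by move=> Hu mn; apply/lead_O1S; apply: O1_le Hu. Qed.

Lemma leadD u v m c d : lead u m c -> lead v m d ->
  lead (fun s => u s + v s) m (c + d).
Proof.
move=> Hu Hv; apply: O1_ext (O1D Hu Hv); apply: nearpT => s _.
by rewrite mulrDl opprD addrACA.
Qed.

Lemma leadM u v m n c d : lead u m c -> lead v n d ->
  lead (fun s => u s * v s) (m + n) (c * d).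
Proof.
move=> Hu Hv; have H1 := O1M Hu (lead_O1 Hv).
have H2 := O1Z c (O1M (O1_Xn m) Hv).
rewrite addSn in H1; rewrite addnS in H2.
by apply: O1_ext (O1D H1 H2); apply: nearpT => s _; rewrite exprD; ring.
Qed.

Lemma lead_cst c : lead (fun=> c) 0 c.
Proof.
by apply: O1_ext (O10 1); apply: nearpT => s _; rewrite mulr1 subrr.
Qed.

Lemma leadXn m c : lead (fun s => c * s ^+ m) m c.
Proof.
by apply: O1_ext (O10 m.+1); apply: nearpT => s _; rewrite subrr.
Qed.

Lemma leadZ u m c d : lead u m c -> lead (fun s => d * u s) m (d * c).
Proof. by move=> Hu; apply: (leadM (lead_cst d) Hu). Qed.

Lemma leadB u v m c d : lead u m c -> lead v m d ->
  lead (fun s => u s - v s) m (c - d).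
Proof.
move=> Hu /(leadZ (-1)) Hv; have := leadD Hu Hv; rewrite mulN1r.
by apply: lead_ext; apply: nearpT => s _; rewrite mulN1r.
Qed.

Lemma leadX u m c n : lead u m c -> lead (fun s => u s ^+ n) (m * n) (c ^+ n).
Proof.
move=> Hu; elim: n => [|n IH]; first by rewrite muln0; apply: lead_cst.
rewrite mulnS exprS; apply: lead_ext (leadM Hu IH).
by apply: nearpT => s _; rewrite exprS.
Qed.

Lemma lead_sum m (I : Type) (rI : seq I) (P : pred I) (F : I -> C -> C) (c : I -> C) :
  (forall i, P i -> lead (F i) m (c i)) ->
  lead (fun s => \sum_(i <- rI | P i) F i s) m (\sum_(i <- rI | P i) c i).
Proof.
move=> HF; have := O1_sum rI HF.
apply: O1_ext; apply: nearpT => s _.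
by rewrite sumrB mulr_suml.
Qed.

Lemma O1_lead_eq0 u m n c : O1 n u -> (m < n)%N -> lead u m c -> c = 0.
Proof.
move=> Hu mn Hc; apply/eqP/negPn/negP => c0.
have := leadB Hc (lead0 Hu mn); rewrite subr0 => /(O1_ext (v := fun s => 0 - c * s ^+ m)).
case=> [|B [r rp HB]]; first by apply: nearpT => s _; rewrite subrr.
have B0 : 0 <= B by apply: le_trans (HB r rp (lexx _)); apply: normr_ge0.
have B1 : 0 < B + 1 by rewrite ltr_wpDl.
have cp : 0 < `|c| by rewrite normr_gt0.
have [s sp [le1 le2]] := pos_min rp (divr_gt0 cp B1).
have := HB s sp le1.
have s0 : s != 0 by rewrite gt_eqF.
rewrite sub0r exprS invfM mulrA mulNr -mulNr.
rewrite mulrAC mulNr mulfK ?expf_neq0 // normrM normrN normfV (gtr0_norm sp).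
rewrite ler_pdivrMr // => H.
suff : `|c| < `|c| by rewrite ltxx.
apply: le_lt_trans H _; apply: (@lt_le_trans _ _ ((B + 1) * s)).
  by rewrite ltr_pM2r // ltrDl.
by rewrite mulrC -ler_pdivlMr.
Qed.

Lemma lead_uniq u m c d : lead u m c -> lead u m d -> c = d.
Proof.
move=> Hc Hd; apply/eqP; rewrite -subr_eq0; apply/eqP.
apply: O1_lead_eq0 (O10 m.+1) (ltnSn m) _.
by apply: lead_ext (leadB Hc Hd); apply: nearpT => s _; rewrite subrr.
Qed.

Lemma lead_near_neq0 u m c : c != 0 -> lead u m c -> nearp (fun s => u s != 0).
Proof.
move=> c0 Hc.
have [B [r rp HB]] : bnd (fun s => (u s / s ^+ m)^-1).
  apply: (bnd_inv c0); apply: bnd_ext Hc; apply: nearpT => s sp.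
  have s0 : s != 0 by rewrite gt_eqF.
  by rewrite exprSr; field; rewrite s0 ?expf_neq0.
have : nearp (fun s => `|(u s - c * s ^+ m) / s ^+ m.+1| <= `|c| / s / 2).
  case: Hc => B' [r' rp' HB'].
  have B0 : 0 <= B' by apply: le_trans (HB' r' rp' (lexx _)); apply: normr_ge0.
  have B1 : 0 < B' + 1 by rewrite ltr_wpDl.
  have cp : 0 < `|c| / 2 by rewrite divr_gt0 ?normr_gt0.
  have [r2 rp2 [le1 le2]] := pos_min rp' (divr_gt0 cp B1).
  exists r2 => // s sp sr; apply: le_trans (HB' s sp (le_trans sr le1)) _.
  rewrite mulrAC ler_pdivlMr //; apply: (@le_trans _ _ ((B' + 1) * s)).
    by rewrite ler_pM2r // lerDl.
  by rewrite mulrC -ler_pdivlMr // (le_trans sr).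
apply: nearp_imp => s sp; apply: contraTneq => ->.
have s0 : s != 0 by rewrite gt_eqF.
rewrite sub0r exprSr invfM [X in `|X|]mulrA mulNr mulfK ?expf_neq0 //.
rewrite normrM normrN normfV (gtr0_norm sp).
rewrite -real_ltNge ?realM ?realV ?ger0_real ?normr_ge0 // ?ltW //.
rewrite ltr_pdivrMr // ltr_pMr ?ltr1n //.
by rewrite divr_gt0 ?normr_gt0.
Qed.

Lemma lead_rem u m c g : bnd g ->
  nearp (fun s => u s = c * s ^+ m + s ^+ m.+1 * g s) -> lead u m c.
Proof.
move=> Hg Hu; apply: bnd_ext Hg; apply: nearp_imp Hu => s sp ->.
by rewrite addrC addKr mulrC mulKf // expf_neq0 // gt_eqF.
Qed.

Lemma leadV u c : c != 0 -> lead u 0 c -> lead (fun s => (u s)^-1) 0 c^-1.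
Proof.
move=> c0 Hu.
have H1 : bnd (fun s => (u s - c) / s).
  by apply: bnd_ext Hu; apply: nearpT => s _; rewrite mulr1 expr1.
have H2 := bndM (bndM H1 (bnd_inv c0 H1)) (bnd_cst (- c^-1)).
apply: bnd_ext H2; apply: nearp_imp (lead_near_neq0 c0 Hu) => s sp us.
by rewrite mulr1 expr1; field; rewrite us c0 gt_eqF.
Qed.

End Germs1.

Ltac bnd_tac := repeat first [exact: bnd_cst | exact: bnd_id | exact: bndX
  | apply: bndD | apply: bndM | apply: bndN | apply: bndE].

(** * Polynomials in two variables *)

Section Bivariate.
Variable C : numClosedFieldType.
Local Notation B2 := {poly {poly C}}.
Implicit Types (p q : B2) (x y : C) (u v : C -> C -> C).

(** The outer indeterminate is [y] and the inner one is [x]: the coefficient of [x^i y^j] is found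
    at index [j], then [i]. *)
Definition ev p x y : C := p.[y%:P].[x].

Lemma evE p x y : ev p x y = \sum_(j < size p) \sum_(i < size p`_j)
  p`_j`_i * (x ^+ i * y ^+ j).
Proof.
rewrite /ev (horner_coef p) horner_sum; apply: eq_bigr => j _.
rewrite hornerM -polyC_exp hornerC horner_coef mulr_suml.
by apply: eq_bigr => i _; rewrite mulrA.
Qed.

(** Handling polynomials as functions turns substitution into composition ([polyfun2_comp]);
    [ev_eq0] brings identities back to polynomials. *)
Definition polyfun2 u : Prop := exists p, forall x y, u x y = ev p x y.

Lemma polyfun2_ev p : polyfun2 (ev p).
Proof. by exists p. Qed.

Lemma polyfun2_ext u v : (forall x y, u x y = v x y) -> polyfun2 u -> polyfun2 v.
Proof. by move=> uv [p up]; exists p => x y; rewrite -uv. Qed.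

Lemma polyfun2C c : polyfun2 (fun _ _ => c).
Proof. by exists c%:P%:P => x y; rewrite /ev !hornerC. Qed.

Lemma polyfun2x : polyfun2 (fun x _ => x).
Proof. by exists 'X%:P => x y; rewrite /ev hornerC hornerX. Qed.

Lemma polyfun2y : polyfun2 (fun _ y => y).
Proof. by exists 'X => x y; rewrite /ev hornerX hornerC. Qed.

Lemma polyfun2D u v : polyfun2 u -> polyfun2 v -> polyfun2 (fun x y => u x y + v x y).
Proof. by move=> [p up] [q vq]; exists (p + q) => x y; rewrite up vq /ev !hornerD. Qed.

Lemma polyfun2M u v : polyfun2 u -> polyfun2 v -> polyfun2 (fun x y => u x y * v x y).
Proof. by move=> [p up] [q vq]; exists (p * q) => x y; rewrite up vq /ev !hornerM. Qed.

Lemma polyfun2N u : polyfun2 u -> polyfun2 (fun x y => - u x y).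
Proof. by move=> [p up]; exists (- p) => x y; rewrite up /ev !hornerN. Qed.

Lemma polyfun2B u v : polyfun2 u -> polyfun2 v -> polyfun2 (fun x y => u x y - v x y).
Proof. by move=> ? ?; apply: polyfun2D => //; apply: polyfun2N. Qed.

Lemma polyfun2X u n : polyfun2 u -> polyfun2 (fun x y => u x y ^+ n).
Proof. by move=> [p up]; exists (p ^+ n) => x y; rewrite up /ev !horner_exp. Qed.

Lemma polyfun2_sum (I : Type) (rI : seq I) (P : pred I) (F : I -> C -> C -> C) :
  (forall i, polyfun2 (F i)) -> polyfun2 (fun x y => \sum_(i <- rI | P i) F i x y).
Proof.
move=> HF; elim: rI => [|i rI IH].
  by apply: polyfun2_ext (polyfun2C 0) => x y; rewrite big_nil.
case Pi: (P i); last by apply: polyfun2_ext IH => x y; rewrite big_cons Pi.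
by apply: polyfun2_ext (polyfun2D (HF i) IH) => x y; rewrite big_cons Pi.
Qed.

Lemma polyfun2_comp u v1 v2 : polyfun2 u -> polyfun2 v1 -> polyfun2 v2 ->
  polyfun2 (fun x y => u (v1 x y) (v2 x y)).
Proof.
move=> [p up] H1 H2.
apply: (@polyfun2_ext (fun x y => \sum_(j < size p) \sum_(i < size p`_j)
  p`_j`_i * (v1 x y ^+ i * v2 x y ^+ j))); first by move=> x y; rewrite up evE.
apply: polyfun2_sum => j; apply: polyfun2_sum => i.
by apply: polyfun2M; [apply: polyfun2C|apply: polyfun2M; apply: polyfun2X].
Qed.

Lemma poly_inj_roots (p : {poly C}) (f : nat -> C) : injective f ->
  (forall n, p.[f n] = 0) -> p = 0.
Proof.
move=> fI pf; apply/eqP; apply/negPn/negP => p0.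
have := @max_poly_roots _ p [seq f n | n <- iota 0 (size p)] p0.
rewrite size_map size_iota ltnn map_inj_uniq // iota_uniq => H.
by suff : false by []; apply: H => //; apply/allP => x /mapP[n _ ->]; apply/rootP.
Qed.

Lemma ev_grid_eq0 p (f : nat -> C) : injective f ->
  (forall n m, ev p (f n) (f m) = 0) -> p = 0.
Proof.
move=> fI H.
have H1 m : p.[(f m)%:P] = 0 by apply: (poly_inj_roots fI) => n; apply: H.
apply/eqP/negPn/negP => p0.
have fI' : injective (fun n => (f n)%:P) by move=> a b /polyC_inj/fI.
have := @max_poly_roots _ p [seq (f n)%:P | n <- iota 0 (size p)] p0.
rewrite size_map size_iota ltnn map_inj_uniq // iota_uniq => H'.
by suff : false by []; apply: H' => //; apply/allP => x /mapP[n _ ->]; apply/rootP.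
Qed.

Lemma natC_inj : injective (fun n : nat => n%:R : C).
Proof. by move=> a b /eqP; rewrite eqr_nat => /eqP. Qed.

Lemma ev_eq0 p : (forall x y, ev p x y = 0) -> p = 0.
Proof. by move=> H; apply: (ev_grid_eq0 natC_inj) => n m; apply: H. Qed.

Lemma polyfun2_mulf_eq0 u v : polyfun2 u -> polyfun2 v ->
  (forall x y, u x y * v x y = 0) ->
  (forall x y, u x y = 0) \/ (forall x y, v x y = 0).
Proof.
move=> [p up] [q vq] H.
have : p * q = 0.
  by apply: ev_eq0 => x y; have := H x y; rewrite up vq /ev !hornerM.
move=> /eqP; rewrite mulf_eq0 => /orP[] /eqP E; [left|right] => x y.
  by rewrite up E /ev !horner0.
by rewrite vq E /ev !horner0.
Qed.

(* [x = a + i b] and [x^* = a - i b] are linear in the real coordinates of [x]. *)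
Lemma polyfun2_conj_eq0 u : polyfun2 u -> (forall x, u x x^* = 0) ->
  forall x y, u x y = 0.
Proof.
move=> Hu H0.
have [p Hp] : polyfun2 (fun x y => u (x + 'i * y) (x - 'i * y)).
  have Hi : polyfun2 (fun _ y => 'i * y).
    by apply: polyfun2M; [apply: polyfun2C | apply: polyfun2y].
  by apply: polyfun2_comp => //; [apply: polyfun2D|apply: polyfun2B] => //;
    apply: polyfun2x.
have p0 : p = 0.
  apply: (ev_grid_eq0 natC_inj) => n m; rewrite -Hp.
  rewrite -[RHS](H0 (n%:R + 'i * m%:R)); congr u.
  by rewrite rmorphD rmorphM /= conjCi !conjC_nat mulNr.
move=> x y; have := Hp ((x + y) / 2) ((x - y) / (2 * 'i)).
rewrite p0 /ev !horner0 => <-; congr u; field;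
  by rewrite neq0Ci ?pnatr_eq0.
Qed.

(* The variables have weights [1] and [be]. *)
Definition wform (be : nat) p (v : nat) x y : C :=
  \sum_(j < size p | (be * j <= v)%N)
     p`_j`_(v - be * j) * (x ^+ (v - be * j) * y ^+ j).

Definition wge (be : nat) p (v : nat) : Prop :=
  forall i j, (i + be * j < v)%N -> p`_j`_i = 0.

(** The monomial [x^i y^j] has order [i + be * j] in [s], so only those of weight exactly [v]
    contribute to the coefficient of [s ^+ v]. *)
Lemma lead_ev be p (v : nat) (X Y : C -> C) x y : wge be p v ->
  lead X 1 x -> lead Y be y ->
  lead (fun s => ev p (X s) (Y s)) v (wform be p v x y).
Proof.
move=> pv HX HY.
apply: (@lead_ext _ (fun s => \sum_(j < size p) \sum_(i < size p`_j)
    p`_j`_i * (X s ^+ i * Y s ^+ j))).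
  by apply: nearpT => s _; rewrite evE.
rewrite /wform [X in lead _ _ X]big_mkcond; apply: lead_sum => j _.
(* For a given [j], a single [i] has the weight [v]. *)
have -> : (if (be * j <= v)%N then
    p`_j`_(v - be * j) * (x ^+ (v - be * j) * y ^+ j) else 0) =
  \sum_(i < size p`_j | (i + be * j == v)%N) p`_j`_i * (x ^+ i * y ^+ j).
  case: leqP => [le|lt]; last first.
    rewrite big_pred0 // => i; apply/negbTE; rewrite gtn_eqF //.
    exact: leq_trans lt (leq_addl _ _).
  case: (ltnP (v - be * j) (size p`_j)) => [iS|iS].
    rewrite (big_pred1 (Ordinal iS)) // => i /=; rewrite -val_eqE /=.
    by rewrite -{1}(subnK le) eqn_add2r.
  rewrite nth_default // mul0r big_pred0 // => i; apply/negbTE.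
  by rewrite -(subnK le) eqn_add2r ltn_eqF // (leq_trans (ltn_ord i)).
rewrite [X in lead _ _ X]big_mkcond; apply: lead_sum => i _.
have H := leadZ p`_j`_i (leadM (leadX i HX) (leadX j HY)).
rewrite mul1n in H.
case: eqP => [<- //|/eqP].
rewrite neq_ltn => /orP[/pv ->|lt]; last exact: lead0 (lead_O1 H) lt.
by apply/lead_O1S; apply: O1_ext (O10 C _); apply: nearpT => s _; rewrite mul0r.
Qed.

Lemma min_weight be p : p != 0 -> exists v : nat, wge be p v /\
  exists i j, (i + be * j = v)%N /\ p`_j`_i != 0.
Proof.
move=> p0.
pose P (v : nat) := `[< exists i j, (i + be * j = v)%N /\ p`_j`_i != 0 >].
have exP : exists v : nat, P v.
  exists ((size (lead_coef p)).-1 + be * (size p).-1)%N.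
  apply/asboolP; exists (size (lead_coef p)).-1, (size p).-1.
  by split => //; rewrite -/(lead_coef p) -/(lead_coef _) !lead_coef_eq0.
have [v /asboolP Pv vmin] := ex_minnP exP.
exists v; split => // i j ij; apply/eqP/negPn/negP => n0.
have : P (i + be * j)%N by apply/asboolP; exists i, j.
by move=> /vmin; rewrite leqNgt ij.
Qed.

Lemma wformZ be p (v : nat) (l x y : C) :
  wform be p v (l * x) (l ^+ be * y) = l ^+ v * wform be p v x y.
Proof.
rewrite /wform mulr_sumr; apply: eq_bigr => j le.
have -> : l ^+ v = l ^+ (v - be * j) * l ^+ (be * j) by rewrite -exprD subnK.
by rewrite !exprMn -exprM; ring.
Qed.

Lemma polyfun2_wform be p (v : nat) : polyfun2 (wform be p v).
Proof.
apply: polyfun2_sum => j.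
by apply: polyfun2M; [apply: polyfun2C|apply: polyfun2M; apply: polyfun2X];
  [apply: polyfun2x|apply: polyfun2y].
Qed.

(** Distinct monomials of the same weight carry distinct powers of [y], so nothing is lost by
    setting [x = 1]. *)
Lemma wform_eq0 be p (v : nat) : wge be p v ->
  (forall y, wform be p v 1 y = 0) -> wge be p v.+1.
Proof.
move=> pv H i j; rewrite ltnS leq_eqVlt => /orP[/eqP E|]; last exact: pv.
apply/eqP/negPn/negP => n0.
have jp : (j < size p)%N.
  by rewrite ltnNge; apply: contra n0 => h; rewrite (nth_default _ h) coef0.
pose q : {poly C} := \poly_(j < size p) (if (be * j <= v)%N then p`_j`_(v - be * j) else 0).
have q0 : q = 0.
  apply: (poly_inj_roots natC_inj) => n; rewrite -[RHS](H n%:R) /wform horner_poly.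
  rewrite [RHS]big_mkcond; apply: eq_bigr => k _.
  by case: ifP; rewrite ?mul0r // expr1n mul1r.
have := congr1 (fun r : {poly C} => r`_j) q0.
rewrite coef_poly jp coef0 -E leq_addl addnK => /eqP.
by rewrite (negbTE n0).
Qed.

Lemma wge0 be p : wge be p 0.
Proof. by []. Qed.

Lemma wge_le be p (m n : nat) : (m <= n)%N -> wge be p n -> wge be p m.
Proof. by move=> mn pn i j lt; apply: pn; apply: leq_trans lt mn. Qed.

End Bivariate.

(** * Rational functions with a dilation symmetry *)

Section Roots.
Variable C : numClosedFieldType.
Implicit Types (p q g : {poly C}) (r m k : C).

Lemma poly_eq0_nz p : (forall r, r != 0 -> p.[r] = 0) -> p = 0.
Proof.
move=> H; apply: (@poly_inj_roots _ _ (fun n : nat => n.+1%:R)).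
  by move=> a b /natC_inj[].
by move=> n; apply: H; rewrite pnatr_eq0.
Qed.

(** The points [m ^+ n * r] have distinct moduli, and a nonzero polynomial has finitely many
    roots. *)
Lemma expanding_orbit_root p m (Q : C -> Prop) r : p != 0 -> 1 < `|m| ->
  (forall s, Q s -> [/\ s != 0, p.[s] = 0 & Q (m * s)]) -> ~ Q r.
Proof.
move=> p0 m1 HQ Qr; have [r0 _ _] := HQ _ Qr.
have Qn n : Q (m ^+ n * r).
  elim: n => [|n IH]; first by rewrite mul1r.
  by rewrite exprS -mulrA; case: (HQ _ IH).
apply/negP: p0; rewrite negbK; apply/eqP.
apply: (@poly_inj_roots _ _ (fun n => m ^+ n * r)); last first.
  by move=> n; case: (HQ _ (Qn n)).
move=> a b /(mulIf r0) /(congr1 Num.norm); rewrite !normrX.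
by apply: ieexprIn; rewrite ?gt_eqF // (lt_trans ltr01).
Qed.

Lemma coprime_decomp p q : q != 0 -> exists g p' q',
  [/\ p = g * p', q = g * q', g != 0 & coprimep p' q'].
Proof.
move=> q0; exists (gcdp p q), (p %/ gcdp p q), (q %/ gcdp p q); split.
- by rewrite mulrC divpK // dvdp_gcdl.
- by rewrite mulrC divpK // dvdp_gcdr.
- by rewrite gcdp_eq0 negb_and q0 orbT.
- by rewrite coprimep_div_gcd // q0 orbT.
Qed.

(** The reciprocal polynomial [r^N p(1 / (m r))]. With it, identities between values at [r] and at
    [1 / (m r)] become polynomial identities, from which common factors can be cancelled. *)
Definition revm m (N : nat) p : {poly C} :=
  \sum_(i < size p) (p`_i / m ^+ i) *: 'X^(N - i).

Lemma horner_revm m (N : nat) p r : m != 0 -> r != 0 -> (size p <= N)%N ->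
  (revm m N p).[r] = r ^+ N * p.[(m * r)^-1].
Proof.
move=> m0 r0 pN; rewrite (horner_coef p) mulr_sumr horner_sum; apply: eq_bigr => i _.
rewrite hornerZ hornerXn exprVn exprMn invfM.
have -> : r ^+ N = r ^+ (N - i) * r ^+ i.
  by rewrite -exprD subnK // (leq_trans _ pN) // ltnW.
by field; rewrite !expf_neq0.
Qed.

(** The hypothesis is the functional equation [k r F(r) = F(1 / (m r))] of [F = p / q]. After
    cancelling [g] and its reversal it holds for [p' / q'], and [p'] does not vanish at a root of
    [q']. *)
Lemma pole_inversion m k p q g p' q' : m != 0 -> k != 0 ->
  p = g * p' -> q = g * q' -> g != 0 -> coprimep p' q' ->
  (forall r, r != 0 ->
    k * r * p.[r] * q.[(m * r)^-1] = p.[(m * r)^-1] * q.[r]) ->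
  forall r, r != 0 -> q'.[r] = 0 -> q'.[(m * r)^-1] = 0.
Proof.
move=> m0 k0 pE qE g0 cop H r r0 qr.
pose N := (size g + size p' + size q')%N.
have gN : (size g <= N)%N by rewrite /N -addnA leq_addr.
have pN : (size p' <= N)%N by rewrite /N addnAC leq_addl.
have qN : (size q' <= N)%N by rewrite leq_addl.
have : g * revm m N g * (k *: ('X * p') * revm m N q' - revm m N p' * q') = 0.
  apply: poly_eq0_nz => s s0; have := H s s0.
  rewrite pE qE !(hornerM, hornerD, hornerN, hornerZ, hornerX) !horner_revm // => E.
  transitivity (s ^+ N * s ^+ N * (k * s * (g.[s] * p'.[s]) * (g.[(m * s)^-1] * q'.[(m * s)^-1])
    - g.[(m * s)^-1] * p'.[(m * s)^-1] * (g.[s] * q'.[s]))).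
    by ring.
  by rewrite E subrr mulr0.
move/eqP; rewrite !mulf_eq0 (negbTE g0) orFb => /orP[/eqP g'0|/eqP/(congr1 (fun p => p.[r]))].
  case/negP: g0; apply/eqP; apply: poly_eq0_nz => s s0.
  have : (revm m N g).[(m * s)^-1] = 0 by rewrite g'0 horner0.
  rewrite horner_revm ?invr_eq0 ?mulf_neq0 //.
  have -> : (m * (m * s)^-1)^-1 = s by field; rewrite m0 s0.
  by move/eqP; rewrite mulf_eq0 expf_eq0 invr_eq0 mulf_eq0 (negbTE m0) (negbTE s0) andbF => /eqP.
rewrite !(hornerM, hornerD, hornerN, hornerZ, hornerX) horner0 qr mulr0 subr0 horner_revm //.
move/eqP; rewrite !mulf_eq0 (negbTE k0) (negbTE r0) expf_eq0 (negbTE r0) andbF /= => /orP[|/eqP //].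
have := coprimep_root (p := q') (q := p') (x := r).
by rewrite coprimep_sym => /(_ cop); rewrite /root qr eqxx => /(_ isT)/negbTE ->.
Qed.

Lemma pole_transfer p' q' u' v' k (r l : C) : coprimep p' q' -> l != 0 ->
  l * (v'.[r] * p'.[r] + q'.[r] * u'.[r]) = k * q'.[r] * v'.[r] ->
  q'.[r] = 0 -> v'.[r] = 0.
Proof.
move=> cop l0 + qr; rewrite qr mul0r addr0 mulr0 mul0r => /eqP.
rewrite !mulf_eq0 (negbTE l0) orFb => /orP[/eqP //|].
have := coprimep_root (p := q') (q := p') (x := r).
by rewrite coprimep_sym => /(_ cop); rewrite /root qr eqxx => /(_ isT)/negbTE ->.
Qed.

(* The poles of [a1 / a0] are stable under [r |-> 1 / r], those of [b1 / b0]   *)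
(* under [r |-> 1 / (sg^4 r)], and both sets agree away from [-1 / sg].        *)
Lemma no_simple_pole (sg c : C) (a1 a0 b1 b0 : {poly C}) (m n : nat) :
  1 < `|sg| -> c != 0 -> a0 != 0 -> b0 != 0 ->
  (forall r, r != 0 -> r ^+ m * a1.[r^-1] = a1.[r]) ->
  (forall r, r != 0 -> r ^+ m.+1 * a0.[r^-1] = a0.[r]) ->
  (forall r, r != 0 -> (sg ^+ 2 * r) ^+ n * b1.[(sg ^+ 4 * r)^-1] = b1.[r]) ->
  (forall r, r != 0 -> (sg ^+ 2 * r) ^+ n.+1 * b0.[(sg ^+ 4 * r)^-1] = b0.[r]) ->
  (forall r, (1 + sg * r) * (b0.[r] * a1.[r] + a0.[r] * b1.[r])
     = c * a0.[r] * b0.[r]) -> False.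
Proof.
move=> sg1 c0 a00 b00 Ha1 Ha0 Hb1 Hb0 E.
have s0 : sg != 0 by rewrite -normr_gt0 (lt_trans ltr01).
have s40 : sg ^+ 4 != 0 by rewrite expf_neq0.
have s20 : sg ^+ 2 != 0 by rewrite expf_neq0.
have [g [a1' [a0' [a1E a0E g0 copa]]]] := coprime_decomp a1 a00.
have [h [b1' [b0' [b1E b0E h0 copb]]]] := coprime_decomp b1 b00.
have {}E r : (1 + sg * r) * (b0'.[r] * a1'.[r] + a0'.[r] * b1'.[r])
     = c * a0'.[r] * b0'.[r].
  apply/eqP; rewrite -subr_eq0.
  have : g * h * ((1%:P + sg *: 'X) * (b0' * a1' + a0' * b1') - c *: (a0' * b0')) = 0.
    apply: poly_eq0_nz => s _; have := E s.
    rewrite a1E a0E b1E b0E !(hornerM, hornerD, hornerN, hornerZ, hornerX) hornerC => Es.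
    have := congr1 (fun x => x - (c * (g.[s] * a0'.[s]) * (h.[s] * b0'.[s]))) Es.
    by rewrite subrr => <-; ring.
  move/eqP; rewrite !mulf_eq0 (negbTE g0) (negbTE h0) /= => /eqP/(congr1 (fun p => p.[r])).
  by rewrite !(hornerM, hornerD, hornerN, hornerZ, hornerX) hornerC horner0 mulrA => /eqP.
have invA r : r != 0 -> a0'.[r] = 0 -> a0'.[r^-1] = 0.
  move=> r0 ar; rewrite -[r]mul1r.
  apply: (pole_inversion (oner_neq0 _) (oner_neq0 _) a1E a0E g0 copa) => // s sn0.
  by rewrite !mul1r -(Ha1 _ sn0) -(Ha0 _ sn0) exprS; ring.
have invB r : r != 0 -> b0'.[r] = 0 -> b0'.[(sg ^+ 4 * r)^-1] = 0.
  apply: (pole_inversion s40 s20 b1E b0E h0 copb) => s sn0.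
  by rewrite -(Hb1 _ sn0) -(Hb0 _ sn0) [_ ^+ n.+1]exprS; ring.
have AB r : 1 + sg * r != 0 -> a0'.[r] = 0 -> b0'.[r] = 0.
  by move=> l0; apply: (pole_transfer copa l0 (E r)).
have BA r : 1 + sg * r != 0 -> b0'.[r] = 0 -> a0'.[r] = 0.
  move=> l0; apply: (pole_transfer (k := c) (u' := a1') copb l0).
  by rewrite [X in _ * X = _]addrC E mulrAC.
have big_neq s : `|s| != 1 -> 1 + s != 0.
  by apply: contraNneq => /eqP; rewrite addrC addr_eq0 => /eqP ->; rewrite normrN normr1.
have a0'0 : a0' != 0 by apply: contraNneq a00; rewrite a0E => ->; rewrite mulr0.
(* From a pole [s] of the first fraction one passes to the second, applies [s -> 1 / (sg^4 s)],
   passes back and applies [s -> 1 / s], reaching [sg^4 s]. Both passages avoid the exceptional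
   point [- 1 / sg] because of the moduli. *)
have noA1 r : 1 <= `|r| -> a0'.[r] != 0.
  move=> r1; apply/negP => /eqP ar.
  have s41 : 1 < `|sg ^+ 4| by rewrite normrX exprn_egt1.
  apply: (@expanding_orbit_root _ _ (fun s => 1 <= `|s| /\ a0'.[s] = 0) r a0'0 s41) => // s [sl as0].
  have sn0 : s != 0 by rewrite -normr_gt0 (lt_le_trans ltr01).
  split => //; split; first by rewrite normrM mulr_ege1 // ltW.
  have bs : b0'.[s] = 0.
    apply: AB as0; apply: big_neq; rewrite gt_eqF // normrM.
    by apply: lt_le_trans sg1 _; rewrite ler_peMr.
  have rn0 : (sg ^+ 4 * s)^-1 != 0 by rewrite invr_eq0 mulf_neq0.
  rewrite -[sg ^+ 4 * s]invrK; apply: invA => //; apply: BA; last exact: invB.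
  apply: big_neq; rewrite lt_eqF // exprS -mulrA invfM mulVKf //.
  rewrite normfV invf_lt1 ?normr_gt0 ?mulf_neq0 ?expf_neq0 // normrM.
  apply: (@lt_le_trans _ _ `|sg ^+ 3|); first by rewrite normrX exprn_egt1.
  by rewrite ler_peMr.
have noA r : r != 0 -> a0'.[r] != 0.
  move=> r0; have [r1|r1] := real_leP (real1 C) (normr_real r); first exact: noA1.
  apply/negP => /eqP/(invA _ r0) ar; have := noA1 r^-1.
  rewrite ar eqxx normfV invf_ge1 ?normr_gt0 // => /(_ (ltW r1)).
  by [].
have r0n0 : - sg^-1 != 0 by rewrite oppr_eq0 invr_eq0.
(* At [- 1 / sg] the left side vanishes, so [b0'] does. Inversion gives the root [- 1 / sg^3] of
   [b0'], away from [- 1 / sg], hence a nonzero root of [a0']. *)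
have := E (- sg^-1); rewrite mulrN divff // subrr mul0r => /esym/eqP.
rewrite !mulf_eq0 (negbTE c0) (negbTE (noA _ r0n0)) /= => /eqP/(invB _ r0n0)/BA.
rewrite (_ : (sg ^+ 4 * - sg^-1)^-1 = - (sg ^+ 3)^-1); last by field.
have n30 : - (sg ^+ 3)^-1 != 0 by rewrite oppr_eq0 invr_eq0 expf_neq0.
move=> H; have := noA _ n30; rewrite H ?eqxx //.
apply: big_neq; rewrite lt_eqF // exprS mulrN invfM mulVKf // normrN normfV.
by rewrite invf_lt1 ?normr_gt0 // normrX exprn_egt1.
Qed.

Lemma monomial_of_no_root p : (forall r, r != 0 -> p.[r] != 0) ->
  exists i c, c != 0 /\ p = c *: 'X^i.
Proof.
move=> H; have p0 : p != 0 by apply: contraTneq (H 1 (oner_neq0 _)) => ->; rewrite horner0 eqxx.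
have [i [q q0 pE]] := multiplicity_XsubC p 0.
rewrite p0 /= subr0 in q0 pE; exists i.
have /size_poly1P[c c0 qE] : size q == 1.
  apply/negPn/negP => /closed_rootP[r qr].
  have [r0|r0] := eqVneq r 0; first by rewrite r0 in qr; rewrite qr in q0.
  by have := H r r0; rewrite pE hornerM (eqP qr) mul0r eqxx.
by exists c; split => //; rewrite pE qE mul_polyC.
Qed.

Lemma scale_poly_neq0 p m : m != 0 -> p != 0 -> p \Po (m *: 'X) != 0.
Proof.
move=> m0; apply: contra => /eqP H; apply/eqP; apply: poly_eq0_nz => r _.
have := congr1 (fun q : {poly C} => q.[r / m]) H.
by rewrite horner_comp hornerZ hornerX horner0 mulrC divfK.
Qed.

(** A quotient that is multiplied by a constant under [r -> m r] has its poles stable under that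
    dilation. *)
Lemma no_root_of_scaling p q m k : 1 < `|m| -> k != 0 -> coprimep p q -> q != 0 ->
  (forall r, r != 0 -> k * p.[m * r] * q.[r] = p.[r] * q.[m * r]) ->
  forall r, r != 0 -> q.[r] != 0.
Proof.
move=> m1 k0 cop q0 H r r0; apply/negP => /eqP qr.
have m0 : m != 0 by rewrite -normr_gt0 (lt_trans ltr01).
apply: (@expanding_orbit_root q m (fun s => s != 0 /\ q.[s] = 0) r q0 m1) => // s [s0 qs].
split => //; split; first by rewrite mulf_neq0.
have := H s s0; rewrite qs mulr0 => /esym/eqP; rewrite mulf_eq0 => /orP[|/eqP //].
have := coprimep_root (p := q) (q := p) (x := s).
by rewrite coprimep_sym => /(_ cop); rewrite /root qs eqxx => /(_ isT)/negbTE ->.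
Qed.

(* With [m = sg ^ 4], [a1 / a0] is multiplied by [sg ^ - 2 e] under [r |-> m r],*)
(* hence is a monomial.                                                        *)
Lemma invariant_ratio (sg : C) (a1 a0 b1 b0 : {poly C}) (w v e : nat) :
  1 < `|sg| -> a1 != 0 -> a0 != 0 -> b0 != 0 ->
  (forall r, r != 0 -> r ^+ w * a1.[r^-1] = a1.[r]) ->
  (forall r, r != 0 -> r ^+ (w + e) * a0.[r^-1] = a0.[r]) ->
  (forall r, r != 0 -> (sg ^+ 2 * r) ^+ v * b1.[(sg ^+ 4 * r)^-1] = b1.[r]) ->
  (forall r, r != 0 -> (sg ^+ 2 * r) ^+ (v + e) * b0.[(sg ^+ 4 * r)^-1] = b0.[r]) ->
  (forall r, b0.[r] * a1.[r] + a0.[r] * b1.[r] = 0) ->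
  exists (k : nat) c, e = k.*2 /\ 'X^k * a1 = c *: a0.
Proof.
move=> sg1 a10 a00 b00 Ha1 Ha0 Hb1 Hb0 E.
have s0 : sg != 0 by rewrite -normr_gt0 (lt_trans ltr01).
pose m := sg ^+ 4.
have m0 : m != 0 by rewrite expf_neq0.
have m1 : 1 < `|m| by rewrite normrX exprn_egt1.
pose sc := m *: 'X : {poly C}.
have scE (p : {poly C}) r : (p \Po sc).[r] = p.[m * r].
  by rewrite horner_comp hornerZ hornerX.
(* Evaluating the relation at [1 / (m r)], applying both inversions, and eliminating [b1] with the
   relation at [r] produces the dilation. *)
have E1 r : r != 0 ->
    b0.[r] * (sg ^+ (2 * e) * a1.[m * r] * a0.[r] - a1.[r] * a0.[m * r]) = 0.
  move=> r0; pose t := (m * r)^-1.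
  have t0 : t != 0 by rewrite invr_eq0 mulf_neq0.
  have h1 := E t; rewrite -(Ha1 _ t0) -(Ha0 _ t0) /t invrK in h1.
  have h2 := congr1 (fun x => x * (sg ^+ 2 * r) ^+ (v + e)) h1.
  rewrite mul0r mulrDl in h2.
  have {}h2 : b0.[r] * (t ^+ w * a1.[m * r]) +
      t ^+ (w + e) * a0.[m * r] * ((sg ^+ 2 * r) ^+ e * b1.[r]) = 0.
    rewrite -(Hb0 _ r0) -(Hb1 _ r0) -/m -[RHS]h2 /t !exprD; ring.
  have {h1}h3 : b0.[r] * (sg ^+ (2 * e) * a1.[m * r]) + a0.[m * r] * b1.[r] = 0.
    have : t ^+ w * (b0.[r] * a1.[m * r] + t ^+ e * a0.[m * r] * ((sg ^+ 2 * r) ^+ e * b1.[r])) = 0.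
      by rewrite -[RHS]h2 exprD; ring.
    move/eqP; rewrite mulf_eq0 expf_eq0 (negbTE t0) andbF => /eqP h4.
    have te : t ^+ e * (sg ^+ 2 * r) ^+ e = sg ^- (2 * e).
      rewrite -exprMn exprM -exprVn; congr (_ ^+ _); rewrite /t /m.
      by field; rewrite r0 s0.
    have -> : b0.[r] * (sg ^+ (2 * e) * a1.[m * r]) + a0.[m * r] * b1.[r] =
       sg ^+ (2 * e) * (b0.[r] * a1.[m * r] + t ^+ e * a0.[m * r] * ((sg ^+ 2 * r) ^+ e * b1.[r])).
      have -> : t ^+ e * a0.[m * r] * ((sg ^+ 2 * r) ^+ e * b1.[r]) =
        (t ^+ e * (sg ^+ 2 * r) ^+ e) * a0.[m * r] * b1.[r] by ring.
      by rewrite te; field; rewrite expf_neq0.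
    by rewrite h4 mulr0.
  transitivity (a0.[r] * (b0.[r] * (sg ^+ (2 * e) * a1.[m * r]) + a0.[m * r] * b1.[r])
     - a0.[m * r] * (b0.[r] * a1.[r] + a0.[r] * b1.[r])); first by ring.
  by rewrite h3 E !mulr0 subrr.
have [g [p [q [pE qE g0 cop]]]] := coprime_decomp a1 a00.
have sc0 (u : {poly C}) : u != 0 -> u \Po sc != 0 by apply: scale_poly_neq0.
have E2 r : sg ^+ (2 * e) * p.[m * r] * q.[r] = p.[r] * q.[m * r].
  apply/eqP; rewrite -subr_eq0.
  have : b0 * (g * (g \Po sc)) *
    (sg ^+ (2 * e) *: ((p \Po sc) * q) - p * (q \Po sc)) = 0.
    apply: poly_eq0_nz => s /E1; rewrite pE qE !(hornerM, hornerD, hornerN, hornerZ) !scE => H.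
    by rewrite -[RHS]H; ring.
  move/eqP; rewrite !mulf_eq0 (negbTE b00) (negbTE g0) (negbTE (sc0 _ g0)) /=.
  move=> /eqP/(congr1 (fun u => u.[r])).
  by rewrite !(hornerM, hornerD, hornerN, hornerZ) !scE horner0 mulrA => /eqP.
have q0 : q != 0 by apply: contraNneq a00; rewrite qE => ->; rewrite mulr0.
have p0 : p != 0 by apply: contraNneq a10; rewrite pE => ->; rewrite mulr0.
have se0 : sg ^+ (2 * e) != 0 by rewrite expf_neq0.
have [i [c [c0 qM]]] : exists i c, c != 0 /\ q = c *: 'X^i.
  by apply: monomial_of_no_root; apply: (no_root_of_scaling m1 se0 cop q0) => r _; apply: E2.
have [j [d [d0 pM]]] : exists i c, c != 0 /\ p = c *: 'X^i.
  apply: monomial_of_no_root.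
  apply: (no_root_of_scaling (p := q) (k := (sg ^+ (2 * e))^-1) m1 _ _ p0) => //.
  - by rewrite invr_eq0.
  - by rewrite coprimep_sym.
  - move=> r _; apply: (mulfI se0); rewrite -mulrA mulVKf // [LHS]mulrC -E2.
    by ring.
have := E2 1; rewrite mulr1 qM pM !hornerZ !hornerXn !expr1n !mulr1 => h.
have {}h : sg ^+ (2 * e + 4 * j) = sg ^+ (4 * i).
  apply: (mulfI (mulf_neq0 c0 d0)); rewrite exprD [sg ^+ (4 * j)]exprM [sg ^+ (4 * i)]exprM -/m.
  have -> : c * d * (sg ^+ (2 * e) * m ^+ j) = sg ^+ (2 * e) * (d * m ^+ j) * c by ring.
  by rewrite h; ring.
(* Since [|sg| > 1], comparing moduli compares exponents; in particular [e] is even. *)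
have {}h : (2 * e + 4 * j = 4 * i)%N.
  move: (congr1 Num.norm h); rewrite !normrX; apply: ieexprIn.
    by rewrite (lt_trans ltr01).
  by rewrite gt_eqF.
have ij : (j <= i)%N by rewrite -(leq_pmul2l (m := 4)) // -h leq_addl.
exists (i - j)%N, (d / c); split.
  apply/eqP; rewrite -(eqn_pmul2l (m := 2)) // -muln2 mulnCA (mulnC _ (2 * 2)) mulnBr -h addnK.
  by [].
have Xi : 'X^i = 'X^(i - j) * 'X^j :> {poly C} by rewrite -exprD subnK.
by rewrite pE qE pM qM -!scalerAr scalerA divfK // Xi mulrCA.
Qed.

End Roots.

(** * Decoupling at a node *)

Section Node.
Variable C : numClosedFieldType.
Local Notation B2 := {poly {poly C}}.
Implicit Types (p q : B2) (x y r c : C).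

Lemma evD p q x y : ev (p + q) x y = ev p x y + ev q x y.
Proof. by rewrite /ev !hornerD. Qed.
Lemma evM p q x y : ev (p * q) x y = ev p x y * ev q x y.
Proof. by rewrite /ev !hornerM. Qed.
Lemma evC c x y : ev c%:P%:P x y = c.
Proof. by rewrite /ev !hornerC. Qed.
Lemma evXn (k : nat) x y : ev 'X^k x y = y ^+ k.
Proof. by rewrite /ev hornerXn -polyC_exp hornerC. Qed.

Lemma leadX1 c : lead (fun s => c * s) 1 c.
Proof. exact: (leadXn 1 c). Qed.

Lemma wform_uniq be p (v : nat) x y c : wge be p v ->
  lead (fun s => ev p (x * s) (y * s ^+ be)) v c -> wform be p v x y = c.
Proof.
by move=> pv; apply: lead_uniq; apply: lead_ev => //; [apply: leadX1|apply: leadXn].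
Qed.

Lemma wge_Xn (k : nat) p (v : nat) : wge 2 p v -> wge 2 ('X^k * p) (v + k.*2).
Proof.
move=> pv i j lt; rewrite coefXnM; case: ltnP => [_|kj]; first by rewrite coef0.
by apply: pv; lia.
Qed.

Lemma wform_Xn (k : nat) p (v : nat) x y : wge 2 p v ->
  wform 2 ('X^k * p) (v + k.*2) x y = y ^+ k * wform 2 p v x y.
Proof.
move=> pv; apply: wform_uniq; first exact: wge_Xn.
have h : lead (fun s => ev p (x * s) (y * s ^+ 2)) v (wform 2 p v x y).
  by apply: lead_ev => //; [apply: leadX1|apply: leadXn].
have := leadM (leadX k (leadXn 2 y)) h; rewrite mul2n addnC.
by apply: lead_ext; apply: nearpT => s _; rewrite evM evXn.
Qed.

Lemma wge_lin p q c (v : nat) : wge 2 p v -> wge 2 q v -> wge 2 (p + c%:P%:P * q) v.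
Proof.
by move=> pv qv i j lt; rewrite coefD coefCM coefD coefCM pv // qv // mulr0 addr0.
Qed.

Lemma wform_lin p q c (v : nat) x y : wge 2 p v -> wge 2 q v ->
  wform 2 (p + c%:P%:P * q) v x y = wform 2 p v x y + c * wform 2 q v x y.
Proof.
move=> pv qv; apply: wform_uniq; first exact: wge_lin.
have h u : wge 2 u v -> lead (fun s => ev u (x * s) (y * s ^+ 2)) v (wform 2 u v x y).
  by move=> uv; apply: lead_ev => //; [apply: leadX1|apply: leadXn].
apply: lead_ext (leadD (h _ pv) (leadZ c (h _ qv))).
by apply: nearpT => s _; rewrite evD evM evC.
Qed.

(** The form of weight [v] at the point [(L(r), ka r)], as a polynomial in the direction [r]: the
    leading coefficient of [p] along the branch of parameter [r] through the node. *)
Definition wpol (L : {poly C}) (ka : C) p (v : nat) : {poly C} :=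
  \sum_(j < size p | (2 * j <= v)%N)
     p`_j`_(v - 2 * j) *: (L ^+ (v - 2 * j) * (ka *: 'X) ^+ j).

Lemma wpolE L ka p (v : nat) r : (wpol L ka p v).[r] = wform 2 p v L.[r] (ka * r).
Proof.
rewrite horner_sum; apply: eq_bigr => j _.
by rewrite hornerZ hornerM !horner_exp hornerZ hornerX.
Qed.

(** For any [y] the quadratic equation [y L(r)^2 = ka r] has a root with [L(r)] nonzero when [y] is
    nonzero; homogeneity then transports the vanishing at [r] to [(1, y)]. For [y = 0] one takes
    [r = 0]. *)
Lemma wpol_eq0 (c0 c1 ka : C) p (v : nat) : c0 != 0 -> c1 != 0 -> ka != 0 ->
  wge 2 p v -> wpol (c0%:P + c1 *: 'X) ka p v = 0 -> wge 2 p v.+1.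
Proof.
move=> c00 c10 k0 pv H; apply: wform_eq0 => // y.
have E r : wform 2 p v (c0 + c1 * r) (ka * r) = 0.
  by have := congr1 (fun u : {poly C} => u.[r]) H; rewrite wpolE horner0 hornerD hornerC hornerZ hornerX.
have [->|y0] := eqVneq y 0.
  have := E 0; rewrite !mulr0 addr0 => h.
  have := wformZ 2 p v c0 1 0; rewrite mulr1 mulr0 h => /esym/eqP.
  by rewrite mulf_eq0 expf_eq0 (negbTE c00) andbF => /eqP.
pose A := y * c1 ^+ 2; pose B := 2 * y * c0 * c1 - ka; pose D := B ^+ 2 - 4 * A * (y * c0 ^+ 2).
pose r := (sqrtC D - B) / (2 * A).
have A0 : A != 0 by rewrite mulf_neq0 ?expf_neq0.
have rE : y * (c0 + c1 * r) ^+ 2 = ka * r.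
  have rr : A * r ^+ 2 + B * r + y * c0 ^+ 2 = 0.
    have -> : A * r ^+ 2 + B * r + y * c0 ^+ 2 = (sqrtC D ^+ 2 - D) / (4 * A).
      by rewrite /r /D; field; rewrite A0.
    by rewrite sqrtCK subrr mul0r.
  by apply/eqP; rewrite -subr_eq0 -rr /A /B; apply/eqP; ring.
have l0 : c0 + c1 * r != 0.
  apply: contra_neq c00 => l0.
  move: rE; rewrite l0 expr0n /= mulr0 => /esym/eqP; rewrite mulf_eq0 (negbTE k0) /= => /eqP r0.
  by rewrite -l0 r0 mulr0 addr0.
have := wformZ 2 p v (c0 + c1 * r) 1 y; rewrite mulr1 [_ ^+ 2 * y]mulrC rE E => /esym/eqP.
by rewrite mulf_eq0 expf_eq0 (negbTE l0) andbF => /eqP.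
Qed.

Variables (sg ka : C).
Hypothesis sg1 : 1 < `|sg|.
Hypothesis ka0 : ka != 0.
Let L1 : {poly C} := 1%:P + 1 *: 'X.
Let L2 : {poly C} := (sg^-1)%:P + sg *: 'X.
Let sg0 : sg != 0. Proof. by rewrite -normr_gt0 (lt_trans ltr01). Qed.

(** After rescaling [s] by [r], the directions [r] and [1 / r] have the same [x] and the same [tau]:
    this is the reflection of the level curve that fixes [x]. *)
Lemma wpol_sym1 p (v : nat) r : r != 0 ->
  r ^+ v * (wpol L1 ka p v).[r^-1] = (wpol L1 ka p v).[r].
Proof.
move=> r0; rewrite !wpolE -wformZ; congr wform.
  by rewrite !(hornerD, hornerC, hornerZ, hornerX) !mul1r mulrDr mulr1 divff // addrC.
by field.
Qed.

(** The reflection that fixes [y], with rescaling factor [sg^2 r]. *)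
Lemma wpol_sym2 p (v : nat) r : r != 0 ->
  (sg ^+ 2 * r) ^+ v * (wpol L2 ka p v).[(sg ^+ 4 * r)^-1] = (wpol L2 ka p v).[r].
Proof.
move=> r0; rewrite !wpolE -wformZ; congr wform.
  by rewrite !(hornerD, hornerC, hornerZ, hornerX); field; rewrite r0 sg0.
by field; rewrite r0 sg0.
Qed.

Variables (X Y tau l nm : C -> C -> C) (c1 c2 : C).
Hypothesis c10 : c1 != 0.
Hypothesis c20 : c2 != 0.
Hypothesis leadXr : forall r, lead (X r) 1 (1 + r).
Hypothesis leadYr : forall r, lead (Y r) 1 (sg^-1 + sg * r).
Hypothesis leadtau : forall r, lead (tau r) 2 (ka * r).
Hypothesis leadl : forall r, lead (l r) 1 (c1 * (1 + sg * r)).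
Hypothesis leadnm : forall r, lead (nm r) 0 c2.

(** The equation [a1 / a0 + b1 / b0 = - nm / l] with its denominators cleared. *)
Definition node_relation a1 a0 b1 b0 : Prop := forall r, nearp (fun s =>
  l r s * (ev b0 (Y r s) (tau r s) * ev a1 (X r s) (tau r s)
           + ev a0 (X r s) (tau r s) * ev b1 (Y r s) (tau r s))
  + nm r s * (ev a0 (X r s) (tau r s) * ev b0 (Y r s) (tau r s)) = 0).

Let leadA p (v : nat) r : wge 2 p v ->
  lead (fun s => ev p (X r s) (tau r s)) v (wpol L1 ka p v).[r].
Proof.
move=> pv; rewrite wpolE; apply: lead_ev => //; rewrite hornerD hornerC hornerZ hornerX mul1r.
exact: leadXr.
Qed.

Let leadB p (v : nat) r : wge 2 p v ->
  lead (fun s => ev p (Y r s) (tau r s)) v (wpol L2 ka p v).[r].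
Proof.
by move=> pv; rewrite wpolE; apply: lead_ev => //; rewrite hornerD hornerC hornerZ hornerX.
Qed.

Lemma poly_ext (p q : {poly C}) : (forall r, p.[r] = q.[r]) -> p = q.
Proof.
move=> H; apply/eqP; rewrite -subr_eq0; apply/eqP; apply: poly_eq0_nz => r _.
by rewrite hornerD hornerN H subrr.
Qed.

(* Induction on the order of the pole: [e.+1] bounds the orders of [a1 / a0]   *)
(* and [b1 / b0].  A pole of order at least two is removed by subtracting a    *)
(* multiple of [tau ^- k].                                                     *)
Lemma node_contradiction_weights (e : nat) (a1 a0 b1 b0 : B2) (wa wb : nat) :
  (e < wa)%N -> (e < wb)%N ->
  wge 2 a0 wa -> wge 2 b0 wb -> wpol L1 ka a0 wa != 0 -> wpol L2 ka b0 wb != 0 ->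
  wge 2 a1 (wa - e.+1) -> wge 2 b1 (wb - e.+1) -> node_relation a1 a0 b1 b0 -> False.
Proof.
elim: e a1 a0 b1 b0 wa wb => [|e IH] a1 a0 b1 b0 wa wb ea eb
  Ha0 Hb0 na0 nb0 Ha1 Hb1 R.
  case: wa ea Ha0 na0 Ha1 => // m _ Ha0 na0; rewrite subn1 /= => Ha1.
  case: wb eb Hb0 nb0 Hb1 => // n _ Hb0 nb0; rewrite subn1 /= => Hb1.
  apply: (no_simple_pole (c := - c2 / c1) sg1 _ na0 nb0 (wpol_sym1 a1 m) (wpol_sym1 a0 m.+1)
    (wpol_sym2 b1 n) (wpol_sym2 b0 n.+1)) => [|r].
    by rewrite mulf_neq0 ?oppr_eq0 ?invr_eq0.
  have h1 := leadM (leadB r Hb0) (leadA r Ha1).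
  have h2 := leadM (leadA r Ha0) (leadB r Hb1).
  have h3 := leadM (leadnm r) (leadM (leadA r Ha0) (leadB r Hb0)).
  rewrite add0n in h3; rewrite (_ : n.+1 + m = m.+1 + n)%N in h1; last by lia.
  have h4 := leadM (leadl r) (leadD h1 h2).
  rewrite (_ : 1 + (m.+1 + n) = m.+1 + n.+1)%N in h4; last by lia.
  have := leadD h4 h3 => /(lead_ext (R r)) h5.
  have := lead_uniq h5 (lead0 (O10 C _) (ltnSn _)) => /eqP.
  rewrite addr_eq0 => /eqP h6; apply: (mulfI c10).
  by rewrite mulrA h6; field.
(* The quotient [nm / l] has order one in [1 / s], less than [e.+2]: at this order the contributions
   of the two fractions cancel. *)
have E r : (wpol L2 ka b0 wb).[r] * (wpol L1 ka a1 (wa - e.+2)).[r] +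
    (wpol L1 ka a0 wa).[r] * (wpol L2 ka b1 (wb - e.+2)).[r] = 0.
  have E1 s : (1 + sg * s) * ((wpol L2 ka b0 wb).[s] * (wpol L1 ka a1 (wa - e.+2)).[s] +
    (wpol L1 ka a0 wa).[s] * (wpol L2 ka b1 (wb - e.+2)).[s]) = 0.
    have h1 := leadM (leadB s Hb0) (leadA s Ha1).
    have h2 := leadM (leadA s Ha0) (leadB s Hb1).
    rewrite (_ : wb + (wa - e.+2) = wa + (wb - e.+2))%N in h1; last by lia.
    have h4 := leadM (leadl s) (leadD h1 h2).
    have h3 := leadM (leadnm s) (leadM (leadA s Ha0) (leadB s Hb0)).
    have h3' : (1 + (wa + (wb - e.+2)) < 0 + (wa + wb))%N by lia.
    have := leadD h4 (lead0 (lead_O1 h3) h3') => /(lead_ext (R s)) h5.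
    have := lead_uniq h5 (lead0 (O10 C _) (ltnSn _)); rewrite addr0 -mulrA => /eqP.
    by rewrite mulf_eq0 (negbTE c10) => /eqP.
  have : (1%:P + sg *: 'X) * (wpol L2 ka b0 wb * wpol L1 ka a1 (wa - e.+2) +
    wpol L1 ka a0 wa * wpol L2 ka b1 (wb - e.+2)) = 0.
    apply: poly_eq0_nz => s _; rewrite hornerM -[RHS](E1 s).
    by rewrite !(hornerM, hornerD, hornerC, hornerZ, hornerX).
  move/eqP; rewrite mulf_eq0 => /orP[/eqP/(congr1 (fun u : {poly C} => u.[0]))|/eqP/(congr1 (fun u : {poly C} => u.[r]))].
    by rewrite hornerD hornerC hornerZ hornerX horner0 mulr0 addr0 => /eqP; rewrite oner_eq0.
  by rewrite hornerD !hornerM horner0.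
have [A0|A0] := eqVneq (wpol L1 ka a1 (wa - e.+2)) 0.
  have B0 : wpol L2 ka b1 (wb - e.+2) = 0.
    apply/eqP; move: na0; apply: contraNT => B0.
    have : wpol L1 ka a0 wa * wpol L2 ka b1 (wb - e.+2) = 0.
      apply: poly_eq0_nz => s _; have := E s.
      by rewrite A0 horner0 mulr0 add0r hornerM.
    by move=> /eqP; rewrite mulf_eq0 (negbTE B0) orbF.
  apply: (IH a1 a0 b1 b0 wa wb); rewrite ?(ltn_trans (ltnSn e)) //.
    rewrite (_ : wa - e.+1 = (wa - e.+2).+1)%N; last by lia.
    exact: wpol_eq0 (oner_neq0 _) (oner_neq0 _) ka0 Ha1 A0.
  rewrite (_ : wb - e.+1 = (wb - e.+2).+1)%N; last by lia.
  by apply: (wpol_eq0 _ sg0 ka0 Hb1 B0); rewrite invr_eq0.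
have wae : (wa = wa - e.+2 + e.+2)%N by rewrite subnK.
have wbe : (wb = wb - e.+2 + e.+2)%N by rewrite subnK.
have [k [c [ek Ek]]] : exists (k : nat) c, e.+2 = k.*2 /\
    'X^k * wpol L1 ka a1 (wa - e.+2) = c *: wpol L1 ka a0 wa.
  apply: (invariant_ratio sg1 A0 na0 nb0 (wpol_sym1 _ _) _ (wpol_sym2 _ _) _ E) => r r0.
    by rewrite -wae; apply: wpol_sym1.
  by rewrite -wbe; apply: wpol_sym2.
have Ek' r : r ^+ k * (wpol L2 ka b1 (wb - e.+2)).[r] = - c * (wpol L2 ka b0 wb).[r].
  have : wpol L1 ka a0 wa * ('X^k * wpol L2 ka b1 (wb - e.+2) + c *: wpol L2 ka b0 wb) = 0.
    apply: poly_eq0_nz => s _.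
    have := congr1 (fun u : {poly C} => u.[s]) Ek; rewrite hornerM hornerXn hornerZ => Es.
    rewrite hornerM hornerD hornerM hornerZ hornerXn.
    transitivity (s ^+ k * ((wpol L2 ka b0 wb).[s] * (wpol L1 ka a1 (wa - e.+2)).[s] +
      (wpol L1 ka a0 wa).[s] * (wpol L2 ka b1 (wb - e.+2)).[s])
      - (wpol L2 ka b0 wb).[s] * (s ^+ k * (wpol L1 ka a1 (wa - e.+2)).[s] - c * (wpol L1 ka a0 wa).[s])).
      by ring.
    by rewrite E Es subrr !mulr0 subrr.
  move/eqP; rewrite mulf_eq0 (negbTE na0) /= => /eqP/(congr1 (fun u : {poly C} => u.[r])).
  rewrite hornerD hornerM hornerXn hornerZ horner0 => /eqP.
  by rewrite addr_eq0 mulNr => /eqP.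
(* The leading term of [a1 / a0] is [c' / tau ^+ k]. Subtracting this from the first fraction and
   adding it to the second preserves the relation and lowers the order of both poles. *)
pose c' := c * ka ^+ k.
pose a1' := 'X^k * a1 + (- c')%:P%:P * a0; pose b1' := 'X^k * b1 + c'%:P%:P * b0.
have wa1 : wge 2 ('X^k * a1) wa by rewrite wae ek; apply: wge_Xn; rewrite -ek.
have wb1 : wge 2 ('X^k * b1) wb by rewrite wbe ek; apply: wge_Xn; rewrite -ek.
have fX p (v : nat) (L : {poly C}) : wge 2 p v ->
    wpol L ka ('X^k * p) (v + k.*2) = (ka *: 'X) ^+ k * wpol L ka p v.
  move=> pv; apply: poly_ext => r.
  by rewrite wpolE wform_Xn // hornerM horner_exp hornerZ hornerX wpolE.
have kX0 : (ka *: 'X : {poly C}) ^+ k != 0.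
  by rewrite expf_neq0 // scaler_eq0 negb_or ka0 polyX_eq0.
apply: (IH a1' ('X^k * a0) b1' ('X^k * b0) (wa + k.*2)%N (wb + k.*2)%N).
- by rewrite -ek; apply: leq_trans (leq_addl _ _); apply: leqnSn.
- by rewrite -ek; apply: leq_trans (leq_addl _ _); apply: leqnSn.
- exact: wge_Xn.
- exact: wge_Xn.
- by rewrite fX // mulf_neq0.
- by rewrite fX // mulf_neq0.
- rewrite (_ : wa + k.*2 - e.+1 = wa.+1)%N; last by rewrite -ek -addSnnS addnK.
  apply: (wpol_eq0 (oner_neq0 C) (oner_neq0 C) ka0); first exact: wge_lin.
  apply: poly_ext => r; rewrite horner0 wpolE wform_lin // -!wpolE.
  rewrite [in wpol _ _ ('X^k * a1) _]wae ek fX -?ek // hornerM horner_exp hornerZ hornerX exprMn.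
  have := congr1 (fun u : {poly C} => u.[r]) Ek; rewrite hornerM hornerXn hornerZ => Es.
  by rewrite -mulrA Es /c'; ring.
- rewrite (_ : wb + k.*2 - e.+1 = wb.+1)%N; last by rewrite -ek -addSnnS addnK.
  apply: (wpol_eq0 (invr_neq0 sg0) sg0 ka0); first exact: wge_lin.
  apply: poly_ext => r; rewrite horner0 wpolE wform_lin // -!wpolE.
  rewrite [in wpol _ _ ('X^k * b1) _]wbe ek fX -?ek // hornerM horner_exp hornerZ hornerX exprMn.
  by rewrite -mulrA Ek' /c'; ring.
- move=> r; apply: nearp_imp (R r) => s _ Rs.
  rewrite /a1' /b1' !(evD, evM, evC, evXn) -[RHS](mulr0 (tau r s ^+ k * tau r s ^+ k)) -Rs.
  by ring.
Qed.

Theorem node_contradiction (a1 a0 b1 b0 : B2) : a0 != 0 -> b0 != 0 ->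
  node_relation a1 a0 b1 b0 -> False.
Proof.
move=> a00 b00 R.
have minw p (d0 d1 : C) : d0 != 0 -> d1 != 0 -> p != 0 ->
    exists v, wge 2 p v /\ wpol (d0%:P + d1 *: 'X) ka p v != 0.
  move=> d00 d10 /(min_weight 2)[v [pv [i [j [ij n0]]]]]; exists v; split => //.
  apply: contra n0 => /eqP/(wpol_eq0 d00 d10 ka0 pv) H; apply/eqP; apply: H.
  by rewrite -ij.
have [wa [Ha0 na0]] := minw _ _ _ (oner_neq0 C) (oner_neq0 C) a00.
have [wb [Hb0 nb0]] : exists v, wge 2 b0 v /\ wpol L2 ka b0 v != 0.
  exact: (minw _ _ _ (invr_neq0 sg0) sg0 b00).
pose k := (wa + wb).+1.
have fX p (v : nat) (L : {poly C}) : wge 2 p v ->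
    wpol L ka ('X^k * p) (v + k.*2) = (ka *: 'X) ^+ k * wpol L ka p v.
  move=> pv; apply: poly_ext => r.
  by rewrite wpolE wform_Xn // hornerM horner_exp hornerZ hornerX wpolE.
have kX0 : (ka *: 'X : {poly C}) ^+ k != 0.
  by rewrite expf_neq0 // scaler_eq0 negb_or ka0 polyX_eq0.
apply: (@node_contradiction_weights (wa + wb) ('X^k * a1) ('X^k * a0) ('X^k * b1) ('X^k * b0)
  (wa + k.*2) (wb + k.*2)).
- by rewrite /k; lia.
- by rewrite /k; lia.
- exact: wge_Xn.
- exact: wge_Xn.
- by rewrite fX // mulf_neq0.
- by rewrite fX // mulf_neq0.
- by refine (wge_le _ (@wge_Xn k a1 0 (@wge0 C 2 a1))); rewrite /k; lia.
- by refine (wge_le _ (@wge_Xn k b1 0 (@wge0 C 2 b1))); rewrite /k; lia.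
- move=> r; apply: nearp_imp (R r) => s _ Rs.
  rewrite !(evM, evXn) -[RHS](mulr0 (tau r s ^+ k * tau r s ^+ k)) -Rs.
  by ring.
Qed.

End Node.

(** * The step polynomial *)

Section Steps.
Variable C : numClosedFieldType.
Local Notation B2 := {poly {poly C}}.
Variables k01 k02 k12 k22 : nat.
Implicit Types (x y t : C).

(** A step [(a, b)] contributes [x^(a+1) y^(b+1)]. All seven sets are symmetric and contain
    [(-1, -1)], whence the constant 1 and one parameter for each remaining symmetric orbit of
    monomials. [step_a], [step_b] and [step_c] are the coefficients of the sum as a quadratic in
    [y]. *)
Definition step_sum x y : C := 1 + k01%:R * (x + y) + k02%:R * (x ^+ 2 + y ^+ 2)
  + k12%:R * (x * y * (x + y)) + k22%:R * (x * y) ^+ 2.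
Definition step_a x : C := k02%:R + k12%:R * x + k22%:R * x ^+ 2.
Definition step_b x : C := k01%:R + k12%:R * x ^+ 2.
Definition step_c x : C := 1 + k01%:R * x + k02%:R * x ^+ 2.
Definition height x y : C := x * y / step_sum x y.

Lemma StE x y : step_sum x y = step_a x * y ^+ 2 + step_b x * y + step_c x.
Proof. by rewrite /step_sum /step_a /step_b /step_c; ring. Qed.

Lemma Tf_quadratic x y : step_sum x y != 0 ->
  height x y * step_a x * y ^+ 2 = (x - height x y * step_b x) * y - height x y * step_c x.
Proof. by move=> S0; rewrite /height; move: S0; rewrite StE => S0; field. Qed.

(** The first equation makes [(x0, x0)] a critical point of [height]; the second makes the Hessian
    there proportional to [(xi - sg eta)(xi - sg^-1 eta)], see [node_expansion]. As [x0 ^+ 2] is not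
    real, only one of the two poles of [P] passes through the node. *)
Definition is_node (x0 sg : C) : Prop :=
  [/\ x0 != 0, step_sum x0 x0 != 0, step_a x0 != 0 & 1 < `|sg| ] /\
  [/\ x0 ^+ 2 * step_a x0 = step_c x0,
     (sg + sg^-1) * (x0 ^+ 2 * step_a x0) =
      step_sum x0 x0 - x0 ^+ 2 * (4 * k12%:R * x0 + 4 * k22%:R * x0 ^+ 2)
    & (x0 ^+ 2)^* != x0 ^+ 2].

Lemma node_expansion x0 sg xi eta : sg != 0 -> x0 ^+ 2 * step_a x0 = step_c x0 ->
  (sg + sg^-1) * (x0 ^+ 2 * step_a x0) =
      step_sum x0 x0 - x0 ^+ 2 * (4 * k12%:R * x0 + 4 * k22%:R * x0 ^+ 2) ->
  step_sum x0 x0 * ((x0 + xi) * (x0 + eta)) - x0 ^+ 2 * step_sum (x0 + xi) (x0 + eta) =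
  - (x0 ^+ 2 * step_a x0) * (xi ^+ 2 - (sg + sg^-1) * (xi * eta) + eta ^+ 2)
  - x0 ^+ 2 * (k12%:R * (xi * eta * (xi + eta))
     + k22%:R * (2 * x0 * (xi + eta) * (xi * eta) + (xi * eta) ^+ 2)).
Proof.
move=> s0 H1 H2.
have -> : - (x0 ^+ 2 * step_a x0) * (xi ^+ 2 - (sg + sg^-1) * (xi * eta) + eta ^+ 2) =
  - (x0 ^+ 2 * step_a x0) * (xi ^+ 2 + eta ^+ 2) + (sg + sg^-1) * (x0 ^+ 2 * step_a x0) * (xi * eta).
  by ring.
rewrite H2; apply/eqP; rewrite -subr_eq0.
have /eqP : (step_c x0 - x0 ^+ 2 * step_a x0) * (x0 * (xi + eta)) = 0 by rewrite H1 subrr mul0r.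
by apply: etrans; congr (_ == _); rewrite /step_sum /step_a /step_c; ring.
Qed.

Theorem no_rational_decoupling x0 sg (n : nat) (a1 a0 b1 b0 : B2) :
  is_node x0 sg -> (0 < n)%N -> a0 != 0 -> b0 != 0 ->
  (forall x y, step_sum x y != 0 ->
    (x0 ^+ 2 - x * y) * ((x0 ^+ 2)^* - x * y) *
      (ev b0 y (height x y) * ev a1 x (height x y) + ev a0 x (height x y) * ev b1 y (height x y))
    + n%:R * (x0 ^+ 2 + (x0 ^+ 2)^* - 2 * (x * y)) *
      (ev a0 x (height x y) * ev b0 y (height x y)) = 0) -> False.
Proof.
move=> [[x00 S0 a00 sg1] [H1 H2 al0]] n0 A0 B0 R.
have s0 : sg != 0 by rewrite -normr_gt0 (lt_trans ltr01).
pose t0 := x0 ^+ 2 / step_sum x0 x0.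
have tr (p : B2) : exists p' : B2, (forall xi tau, ev p' xi tau = ev p (x0 + xi) (t0 + tau))
    /\ (p != 0 -> p' != 0).
  have [p' p'E] : polyfun2 (fun xi tau => ev p (x0 + xi) (t0 + tau)).
    apply: polyfun2_comp; first exact: polyfun2_ev.
      by apply: polyfun2D; [apply: polyfun2C|apply: polyfun2x].
    by apply: polyfun2D; [apply: polyfun2C|apply: polyfun2y].
  exists p'; split => // p0; apply: contra p0 => /eqP p'0; apply/eqP/ev_eq0 => x y.
  have := p'E (x - x0) (y - t0); rewrite p'0 /ev !horner0 => /esym.
  by rewrite !subrKC.
have [a1' [a1E _]] := tr a1; have [a0' [a0E /(_ A0) A0']] := tr a0.
have [b1' [b1E _]] := tr b1; have [b0' [b0E /(_ B0) B0']] := tr b0.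
(* Along this line [xi - sg eta] is [s (1 - sg^2) r] and [xi - sg^-1 eta] is [s (1 - sg^-2)], so the
   quadratic part of [tau] is linear in [r]. Moreover the sum of the two coordinates is
   [s (1 + sg^-1)(1 + sg r)], which locates the zero of [l]. *)
pose X r s : C := s * (1 + r); pose Y r s : C := s * (sg^-1 + sg * r).
pose xf r s := x0 + X r s; pose yf r s := x0 + Y r s.
pose tau r s := height (xf r s) (yf r s) - t0.
pose l r s := (x0 ^+ 2 - xf r s * yf r s) * ((x0 ^+ 2)^* - xf r s * yf r s).
pose nm r s := n%:R * (x0 ^+ 2 + (x0 ^+ 2)^* - 2 * (xf r s * yf r s)).
pose be := (x0 ^+ 2)^* - x0 ^+ 2.
have be0 : be != 0 by rewrite subr_eq0.
have sgm : 1 + sg^-1 != 0.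
  apply/negP; rewrite addrC addr_eq0 => /eqP/(congr1 Num.norm).
  rewrite normrN normr1 normfV => /(congr1 GRing.inv); rewrite invrK invr1 => h.
  by move: sg1; rewrite h ltxx.
have sgq : sg - sg^-1 != 0.
  rewrite subr_eq0; apply/negP => /eqP/(congr1 Num.norm); rewrite normfV => h.
  have : `|sg|^-1 < 1 by rewrite invf_lt1 ?normr_gt0.
  by rewrite -h => /lt_trans/(_ sg1); rewrite ltxx.
pose ka := x0 ^+ 2 * step_a x0 * (sg - sg^-1) ^+ 2 / step_sum x0 x0 ^+ 2.
have ka0 : ka != 0 by rewrite !mulf_neq0 ?invr_eq0 ?expf_neq0.
have lSt r : lead (fun s => step_sum (xf r s) (yf r s)) 0 (step_sum x0 x0).
  pose u := 1 + r; pose v := sg^-1 + sg * r.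
  apply: (lead_rem (g := fun s => k01%:R * (u + v) +
   k02%:R * (2 * x0 * u + s * u ^+ 2 + 2 * x0 * v + s * v ^+ 2)
   + k12%:R * (x0 ^+ 2 * (u + v) + (x0 * (u + v) + s * (u * v)) * (2 * x0 + s * (u + v)))
   + k22%:R * ((x0 * (u + v) + s * (u * v)) * (2 * x0 ^+ 2 + s * (x0 * (u + v) + s * (u * v)))))).
    by bnd_tac.
  by apply: nearpT => s _; rewrite /step_sum /xf /yf /X /Y -/u -/v; ring.
apply: (@node_contradiction C sg ka sg1 ka0 X Y tau l nm (- x0 * (1 + sg^-1) * be) (n%:R * be)
   _ _ _ _ _ _ _ a1' a0' b1' b0') => //.
- by rewrite !mulf_neq0 ?oppr_eq0.
- by rewrite mulf_neq0 // pnatr_eq0 -lt0n.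
- move=> r; apply: (lead_rem (g := fun=> 0)); first exact: bnd_cst.
  by apply: nearpT => s _; rewrite /X; ring.
- move=> r; apply: (lead_rem (g := fun=> 0)); first exact: bnd_cst.
  by apply: nearpT => s _; rewrite /Y; ring.
- move=> r; pose u := 1 + r; pose v := sg^-1 + sg * r.
  have h1 : lead (fun s => step_sum x0 x0 * (xf r s * yf r s) - x0 ^+ 2 * step_sum (xf r s) (yf r s)) 2
      (x0 ^+ 2 * step_a x0 * (sg - sg^-1) ^+ 2 * r).
    apply: (lead_rem (g := fun s => - x0 ^+ 2 * (k12%:R * (u * v * (u + v))
     + k22%:R * (2 * x0 * (u + v) * (u * v) + s * (u * v) ^+ 2)))); first by bnd_tac.
    apply: nearpT => s _; rewrite /xf /yf (node_expansion _ _ s0 H1 H2) /X /Y -/u -/v.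
    rewrite (_ : x0 ^+ 2 * step_a x0 * (sg - sg^-1) ^+ 2 * r =
      - (x0 ^+ 2 * step_a x0) * (u ^+ 2 - (sg + sg^-1) * (u * v) + v ^+ 2)); first by ring.
    by rewrite /u /v; field.
  have h2 := leadM h1 (leadV S0 (lSt r)).
  have := leadZ (step_sum x0 x0)^-1 h2; rewrite addn0.
  rewrite (_ : (step_sum x0 x0)^-1 * _ = ka * r); last by rewrite /ka; field; rewrite S0.
  apply: lead_ext; apply: nearp_imp (lead_near_neq0 S0 (lSt r)) => s _ Ss.
  by rewrite /tau /height /t0; field; rewrite Ss S0.
- move=> r; pose u := 1 + r; pose v := sg^-1 + sg * r.
  have h1 : lead (fun s => x0 ^+ 2 - xf r s * yf r s) 1 (- x0 * (u + v)).
    apply: (lead_rem (g := fun s => - (u * v))); first by bnd_tac.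
    by apply: nearpT => s _; rewrite /xf /yf /X /Y -/u -/v; ring.
  have h2 : lead (fun s => (x0 ^+ 2)^* - xf r s * yf r s) 0 be.
    apply: (lead_rem (g := fun s => - x0 * (u + v) - s * (u * v))); first by bnd_tac.
    by apply: nearpT => s _; rewrite /xf /yf /X /Y -/u -/v /be; ring.
  have := leadM h1 h2; rewrite addn0; congr lead.
  by rewrite /u /v; field.
- move=> r; pose u := 1 + r; pose v := sg^-1 + sg * r.
  apply: (lead_rem (g := fun s => n%:R * (- 2 * (x0 * (u + v) + s * (u * v))))); first by bnd_tac.
  by apply: nearpT => s _; rewrite /nm /xf /yf /X /Y -/u -/v /be; ring.
- move=> r; apply: nearp_imp (lead_near_neq0 S0 (lSt r)) => s _ Ss.
  rewrite a1E a0E b1E b0E /tau !subrKC.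
  exact: (R _ _ Ss).
Qed.

End Steps.

(** * Formal expansions and traces on the surface *)

Section Expandable.
Variable C : numClosedFieldType.
Local Notation B2 := {poly {poly C}}.
Implicit Types (p q : B2) (x y t c : C) (u v : C -> C -> C) (n : nat).

Lemma O1_conj n (u : C -> C) : O1 n u -> O1 n (fun s => (u s)^*).
Proof.
move=> [B HB]; exists B; apply: nearp_imp HB => s _.
by rewrite !normrM !normfV norm_conjC.
Qed.

Lemma conj_pos (s : C) : 0 < s -> s^* = s.
Proof. by move=> sp; apply: conj_Creal; apply: gtr0_real. Qed.

Definition O2 n u : Prop := forall X Y, O1 1 X -> O1 1 Y -> O1 n (fun s => u (X s) (Y s)).
Definition flat2 u : Prop := forall n, O2 n u.
(** The germ has a formal Taylor expansion at the origin, tested on all curves [X, Y = O(s)]; the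
    flat germs are those with zero expansion. *)
Definition Exp2 u : Prop := forall n, exists p, O2 n (fun x t => u x t - ev p x t).

Lemma O2_ext n u v : (forall x y, u x y = v x y) -> O2 n u -> O2 n v.
Proof.
by move=> uv H X Y HX HY; apply: O1_ext (H X Y HX HY); apply: nearpT => s _; rewrite uv.
Qed.

Lemma O2D n u v : O2 n u -> O2 n v -> O2 n (fun x y => u x y + v x y).
Proof. by move=> Hu Hv X Y HX HY; apply: O1D; [apply: Hu|apply: Hv]. Qed.

Lemma O2_mulb n u v : O2 n u -> O2 0 v -> O2 n (fun x y => u x y * v x y).
Proof. by move=> Hu Hv X Y HX HY; have := O1M (Hu X Y HX HY) (Hv X Y HX HY); rewrite addn0. Qed.

Lemma O2_le (m n : nat) u : (m <= n)%N -> O2 n u -> O2 m u.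
Proof. by move=> mn Hu X Y HX HY; apply: O1_le mn (Hu X Y HX HY). Qed.

Lemma O2_ev p n : wge 1 p n -> O2 n (ev p).
Proof.
move=> pn X Y HX HY.
apply: (@O1_ext _ _ (fun s => \sum_(j < size p) \sum_(i < size p`_j)
    p`_j`_i * (X s ^+ i * Y s ^+ j))).
  by apply: nearpT => s _; rewrite evE.
apply: O1_sum => j _; apply: O1_sum => i _.
case: (ltnP (i + 1 * j) n) => [/pn ->|le].
  by apply: O1_ext (O10 C n); apply: nearpT => s _; rewrite mul0r.
apply: O1Z; apply: O1_le le _.
have := O1M (O1_exp i HX) (O1_exp j HY); rewrite mul1n.
by [].
Qed.

Lemma O2_ev0 p : O2 0 (ev p).
Proof. by apply: O2_ev. Qed.

Lemma Exp2_O20 u : Exp2 u -> O2 0 u.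
Proof.
move=> /(_ 0)[p Hp]; apply: O2_ext (O2D Hp (O2_ev0 p)) => x y.
by rewrite subrK.
Qed.

Lemma Exp2_ext u v : (forall x y, u x y = v x y) -> Exp2 u -> Exp2 v.
Proof.
by move=> uv H n; have [p Hp] := H n; exists p; apply: O2_ext Hp => x y; rewrite uv.
Qed.

Lemma Exp2_poly u : polyfun2 u -> Exp2 u.
Proof.
move=> [p up] n; exists p => X Y _ _; apply: O1_ext (O10 C n).
by apply: nearpT => s _; rewrite up subrr.
Qed.

Lemma Exp2D u v : Exp2 u -> Exp2 v -> Exp2 (fun x y => u x y + v x y).
Proof.
move=> Hu Hv n; have [p Hp] := Hu n; have [q Hq] := Hv n; exists (p + q).
by apply: O2_ext (O2D Hp Hq) => x y; rewrite evD; ring.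
Qed.

Lemma Exp2M u v : Exp2 u -> Exp2 v -> Exp2 (fun x y => u x y * v x y).
Proof.
move=> Hu Hv n; have [p Hp] := Hu n; have [q Hq] := Hv n; exists (p * q).
apply: O2_ext (O2D (O2_mulb Hp (Exp2_O20 Hv)) (O2_mulb Hq (O2_ev0 p))) => x y.
by rewrite evM; ring.
Qed.

Lemma Exp2X u n : Exp2 u -> Exp2 (fun x y => u x y ^+ n).
Proof.
move=> Hu; elim: n => [|n IH].
  by apply: Exp2_poly; apply: polyfun2C.
by apply: Exp2_ext (Exp2M Hu IH) => x y; rewrite exprS.
Qed.

Lemma Exp2_sum (I : Type) (rI : seq I) (F : I -> C -> C -> C) :
  (forall i, Exp2 (F i)) -> Exp2 (fun x y => \sum_(i <- rI) F i x y).
Proof.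
move=> HF; elim: rI => [|i rI IH].
  by apply: Exp2_ext (Exp2_poly (polyfun2C 0)) => x y; rewrite big_nil.
by apply: Exp2_ext (Exp2D (HF i) IH) => x y; rewrite big_cons.
Qed.

Definition flat1 (u : C -> C) : Prop := forall n, O1 n u.
(** Flatness along each real ray of the [w] plane separately: functions on the surface also involve
    the conjugate of [w], and on a ray both are linear in [s]. *)
Definition rflat (u : C -> C) : Prop := forall z, flat1 (fun s => u (s * z)).

Definition rnear (P : C -> Prop) : Prop := forall z, nearp (fun s => P (s * z)).

Lemma rflat_ext (u v : C -> C) : rnear (fun w => u w = v w) -> rflat u -> rflat v.
Proof. by move=> uv H z n; apply: O1_ext (uv z) (H z n). Qed.

Lemma rflatD (u v : C -> C) : rflat u -> rflat v -> rflat (fun w => u w + v w).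
Proof. by move=> Hu Hv z n; apply: O1D; [apply: Hu|apply: Hv]. Qed.

Lemma rflatM (u g : C -> C) : rflat u -> (forall z, bnd (fun s => g (s * z))) ->
  rflat (fun w => u w * g w).
Proof. by move=> Hu Hg z n; apply: O1_mulb; [apply: Hu|apply: Hg]. Qed.

Lemma rflat_conj (u : C -> C) : rflat u -> rflat (fun w => (u w)^*).
Proof. by move=> Hu z n; apply: O1_conj (Hu z n). Qed.

Lemma poly_flat2_eq0 p : flat2 (ev p) -> p = 0.
Proof.
move=> Hp; suff H (v : nat) : wge 1 p v.
  apply/polyP => j; apply/polyP => i; rewrite !coef0.
  exact: (H (i + 1 * j).+1).
elim: v => // v pv; apply: wform_eq0 => // y.
apply: (O1_lead_eq0 (Hp v.+1 (fun s => 1 * s) (fun s => y * s) _ _) (ltnSn v)).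
- exact: lead_O1 (leadX1 1).
- exact: lead_O1 (leadX1 y).
by apply: lead_ev => //; apply: leadX1.
Qed.

Lemma lead_poly (p : {poly C}) (l : nat) : (forall i, (i < l)%N -> p`_i = 0) ->
  lead (fun s => p.[s]) l p`_l.
Proof.
move=> pl; apply: (@lead_ext _ (fun s => \sum_(i < maxn l.+1 (size p)) p`_i * s ^+ i)).
  by apply: nearpT => s _; rewrite (horner_coef_wide _ (leq_maxr l.+1 _)).
have lt : (l < maxn l.+1 (size p))%N by rewrite leq_maxl.
rewrite (_ : p`_l = \sum_(i < maxn l.+1 (size p)) if i == Ordinal lt then p`_l else 0); last first.
  by rewrite -big_mkcond big_pred1_eq.
apply: lead_sum => i _; rewrite -val_eqE /=; move: (nat_of_ord i) => {lt} {}i.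
have H := leadXn i p`_i; case: eqP => [il|/eqP]; first by rewrite -il.
rewrite neq_ltn => /orP[/pl ->|lt']; last exact: lead0 (lead_O1 H) lt'.
by apply/lead_O1S; apply: O1_ext (O10 C _); apply: nearpT => s _; rewrite mul0r.
Qed.

(** The square of a formal power series has even order. *)
Lemma lead_sqr_odd (u : C -> C) (m : nat) c :
  (forall n, exists p : {poly C}, O1 n (fun s => u s - p.[s])) ->
  lead (fun s => u s ^+ 2) m.*2.+1 c -> c = 0.
Proof.
move=> Hu Hc; have [p Hp] := Hu m.+1.
have [Hs|] := pselect (forall i, (i < m.+1)%N -> p`_i = 0).
  have h : O1 m.+1 u.
    have hp : O1 m.+1 (fun s => p.[s]) := lead_O1 (lead_poly Hs).
    by apply: O1_ext (O1D Hp hp); apply: nearpT => s _; rewrite subrK.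
  have h2 := O1_exp 2 h.
  by apply: (O1_lead_eq0 h2 _ Hc); rewrite muln2 doubleS.
move=> /existsNP[i /not_implyP[im /eqP pi0]].
have ex : exists l, p`_l != 0 by exists i.
have [l pl0 lmin] := ex_minnP ex.
have lm : (l < m.+1)%N by apply: leq_ltn_trans (lmin _ pi0) im.
have pl : lead (fun s => p.[s]) l p`_l.
  by apply: lead_poly => j jl; apply/eqP/negPn/negP => /lmin; rewrite leqNgt jl.
have ul : lead u l p`_l.
  have := leadD pl (lead0 Hp lm); rewrite addr0; apply: lead_ext.
  by apply: nearpT => s _; rewrite subrKC.
have u2 := leadX 2 ul.
have lt : (l * 2 < m.*2.+1)%N by rewrite muln2 ltnS leq_double -ltnS.
have /eqP := O1_lead_eq0 (lead_O1 Hc) lt u2.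
by rewrite expf_eq0 (negbTE pl0) andbF.
Qed.

Lemma Exp2_curve u v1 v2 : Exp2 u -> polyfun2 v1 -> polyfun2 v2 ->
  O1 1 (fun s => v1 s 0) -> O1 1 (fun s => v2 s 0) ->
  forall n, exists p : {poly C}, O1 n (fun s => u (v1 s 0) (v2 s 0) - p.[s]).
Proof.
move=> Hu P1 P2 H1 H2 n; have [p Hp] := Hu n.
have [q Hq] := polyfun2_comp (polyfun2_ev p) P1 P2.
exists q.[0%:P]; apply: O1_ext (Hp _ _ H1 H2); apply: nearpT => s _.
by rewrite Hq.
Qed.

End Expandable.

(** * Restriction to the surface, and independence of 1 and the conjugate of [w] *)

Section Slice.
Variable C : numClosedFieldType.
Local Notation B2 := {poly {poly C}}.
Variables k01 k02 k12 k22 : nat.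
Local Notation St := (@step_sum C k01 k02 k12 k22).
Local Notation Sa := (@step_a C k02 k12 k22).
Local Notation Sb := (@step_b C k01 k12).
Local Notation Sc := (@step_c C k01 k02).
Local Notation Tf := (@height C k01 k02 k12 k22).
Implicit Types (p q : B2) (x y t c w z : C) (u v : C -> C -> C) (n : nat).

Definition slice_height (w : C) : C := Tf w w^*.

Lemma St_sym x y : St x y = St y x.
Proof. by rewrite /step_sum; ring. Qed.

Lemma Tf_sym x y : Tf x y = Tf y x.
Proof. by rewrite /height St_sym [x * y]mulrC. Qed.

Lemma St_conj x y : (St x y)^* = St x^* y^*.
Proof. by rewrite /step_sum !(rmorphD, rmorphM, rmorphXn, rmorph1, rmorph_nat). Qed.

Lemma Tw_conj w : (slice_height w)^* = slice_height w.
Proof.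
rewrite /slice_height /height rmorphM fmorphV /= St_conj rmorphM /= conjCK.
by rewrite St_sym mulrC [w^* * w]mulrC mulrC.
Qed.

Lemma ray_conj (s z : C) : 0 < s -> (s * z)^* = s * z^*.
Proof. by move=> sp; rewrite rmorphM /= conj_pos. Qed.

Lemma lead_St_ray z : lead (fun s => St (s * z) (s * z)^*) 0 1.
Proof.
apply: (lead_rem (g := fun s => k01%:R * (z + z^*) + s * (k02%:R * (z ^+ 2 + z^* ^+ 2))
  + s ^+ 2 * (k12%:R * (z * z^* * (z + z^*))) + s ^+ 3 * (k22%:R * (z * z^*) ^+ 2))).
  by bnd_tac.
by apply: nearpT => s sp; rewrite ray_conj // /step_sum; ring.
Qed.

Lemma rnear_St : rnear (fun w => St w w^* != 0).
Proof. by move=> z; apply: lead_near_neq0 (oner_neq0 C) (lead_St_ray z). Qed.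

Lemma lead_ray z : lead (fun s => s * z) 1 z.
Proof.
apply: (lead_rem (g := fun=> 0)); first exact: bnd_cst.
by apply: nearpT => s _; ring.
Qed.

Lemma lead_ray_conj z : lead (fun s => (s * z)^*) 1 z^*.
Proof.
by apply: lead_ext (lead_ray z^*); apply: nearpT => s sp; rewrite ray_conj.
Qed.

Lemma lead_Tw_ray z : lead (fun s => slice_height (s * z)) 2 (z * z^*).
Proof.
have := leadM (leadM (lead_ray z) (lead_ray_conj z)) (leadV (oner_neq0 C) (lead_St_ray z)).
by rewrite invr1 mulr1.
Qed.

Lemma O1_ray z : O1 1 (fun s => s * z).
Proof. exact: lead_O1 (lead_ray z). Qed.

Lemma O1_Tw_ray z : O1 1 (fun s => slice_height (s * z)).
Proof. by apply: O1_le (lead_O1 (lead_Tw_ray z)). Qed.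

Lemma flat2_slice u : flat2 u -> rflat (fun w => u w (slice_height w)).
Proof.
move=> H z n; apply: (H n (fun s => s * z) (fun s => slice_height (s * z))).
  exact: O1_ray.
exact: O1_Tw_ray.
Qed.

Lemma bnd_slice u : Exp2 u -> forall z, bnd (fun s => u (s * z) (slice_height (s * z))).
Proof.
move=> /Exp2_O20 H z.
exact: bnd_O1 (H (fun s => s * z) (fun s => slice_height (s * z)) (O1_ray z) (O1_Tw_ray z)).
Qed.

Lemma bnd_ray_conj z : bnd (fun s => (s * z)^*).
Proof. exact: bnd_O1 (lead_O1 (lead_ray_conj z)). Qed.

Lemma bnd_polyslice u : polyfun2 u -> forall z, bnd (fun s => u (s * z) (s * z)^*).
Proof.
move=> [p up] z; apply: (@bnd_ext _ (fun s => ev p (s * z) (s * z)^*)).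
  by apply: nearpT => s _; rewrite up.
apply: bnd_O1 (lead_O1 (lead_ev (be := 1) (@wge0 C 1 p) (lead_ray z) (lead_ray_conj z))).
Qed.

(* On the surface [t ~ w w^*] has weight two, and distinct monomials of the    *)
(* same weight in [w, t] have distinct leading terms.                          *)
Lemma slice_flat2 u : Exp2 u -> rflat (fun w => u w (slice_height w)) -> flat2 u.
Proof.
move=> Hu Hf n; have [p Hp] := Hu n.*2.
have pn (v : nat) : (v <= n.*2)%N -> wge 2 p v.
  elim: v => [|v IH] lev; first by [].
  have pv := IH (ltnW lev).
  apply: wform_eq0 => // y.
  have H0 z : wform 2 p v z (z * z^*) = 0.
    have h : lead (fun s => ev p (s * z) (slice_height (s * z))) v (wform 2 p v z (z * z^*)).
      by apply: lead_ev => //; [apply: lead_ray|apply: lead_Tw_ray].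
    apply: (O1_lead_eq0 _ lev h).
    have h1 := Hp (fun s => s * z) (fun s => slice_height (s * z)) (O1_ray z) (O1_Tw_ray z).
    by apply: O1_ext (O1B (Hf z n.*2) h1); apply: nearpT => s _; ring.
  have := @polyfun2_conj_eq0 C (fun x y => wform 2 p v x (x * y)) _ H0 1 y.
  rewrite mul1r; apply; apply: polyfun2_comp; first exact: polyfun2_wform.
    exact: polyfun2x.
  by apply: polyfun2M; [apply: polyfun2x|apply: polyfun2y].
have {}pn : wge 1 p n.
  by move=> i j ij; apply: (pn n.*2 (leqnn _)); lia.
have n2 : (n <= n.*2)%N by lia.
by apply: O2_ext (O2D (O2_le n2 Hp) (O2_ev pn)) => x y; rewrite subrK.
Qed.

Definition Disc x t : C := (x - t * Sb x) ^+ 2 - 4 * t ^+ 2 * Sa x * Sc x.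

(** [Disc] is the discriminant in [y] of [t * S(x, y) = x * y]. A whole family of curves is
    required, so that [ka] can be chosen to keep a given nonflat germ nonzero on the curve
    ([nonflat_lead]). *)
Definition odd_curve : Prop := exists (k m : nat) (b1 b2 bad : C) (de : C -> C),
  (0 < k)%N /\ forall ka, ka != bad -> de ka != 0 /\
    lead (fun s => Disc (b1 * s + b2 * s ^+ 2 + ka * s ^+ k) s) m.*2.+1 (de ka).

(** In the coordinates [t] and [X = x - b1 t - b2 t^2], of weights 1 and [k], the lowest weighted
    form at [(1, ka)] is a nonzero polynomial in [ka]. *)
Lemma nonflat_lead v (k : nat) (b1 b2 bad : C) : (0 < k)%N -> Exp2 v -> ~ flat2 v ->
  exists ka (n : nat) c, [/\ ka != bad, c != 0 &
    lead (fun s => v (b1 * s + b2 * s ^+ 2 + ka * s ^+ k) s) n c].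
Proof.
move=> k0 Hv /existsNP[n0 Hn0]; have [p Hp] := Hv (k * n0)%N.
have [p' Hp'] : polyfun2 (fun t X => ev p (b1 * t + b2 * t ^+ 2 + X) t).
  apply: polyfun2_comp; [exact: polyfun2_ev| |exact: polyfun2x].
  apply: polyfun2D; last exact: polyfun2y.
  by apply: polyfun2D; apply: polyfun2M; [apply: polyfun2C|apply: polyfun2x|
    apply: polyfun2C|apply: polyfun2X; apply: polyfun2x].
have nw : ~ wge k p' (k * n0).
  move=> pw; apply: Hn0.
  have {}pw : wge 1 p' n0.
    move=> i j ij; apply: pw; apply: (@leq_ltn_trans (k * (i + 1 * j))); last by rewrite ltn_pmul2l.
    by rewrite mulnDr mul1n leq_add2r leq_pmull.
  have Hp0 : O2 n0 (ev p).
    move=> X Y HX HY.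
    have HX' : O1 1 (fun s => X s - (b1 * Y s + b2 * Y s ^+ 2)).
      apply: O1B => //; apply: O1D; first exact: O1Z.
      by apply: O1Z; apply: O1_le (O1_exp 2 HY).
    apply: O1_ext (O2_ev pw HY HX'); apply: nearpT => s _.
    by rewrite -Hp' subrKC.
  have le : (n0 <= k * n0)%N by rewrite leq_pmull.
  by apply: O2_ext (O2D (O2_le le Hp) Hp0) => x y; rewrite subrK.
have p'0 : p' != 0 by apply: contra_not_neq nw => -> i j _; rewrite !coef0.
have [n [pn [i [j [ij n0']]]]] := min_weight k p'0.
have lt : (n < k * n0)%N.
  by rewrite ltnNge; apply/negP => le; apply: nw => a b lt; apply: pn; apply: leq_trans lt le.
have [ka [kb wk]] : exists ka, ka != bad /\ wform k p' n 1 ka != 0.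
  have [//|H] := pselect (exists ka, ka != bad /\ wform k p' n 1 ka != 0).
  have H1 x y : (y - bad) * wform k p' n 1 y = 0.
    have [->|yb] := eqVneq y bad; first by rewrite subrr mul0r.
    apply/eqP; rewrite mulf_eq0; apply/orP; right; apply/negPn/negP => h.
    by apply: H; exists y.
  case: (@polyfun2_mulf_eq0 C (fun _ y => y - bad) (fun _ y => wform k p' n 1 y) _ _ H1).
  - by apply: polyfun2B; [apply: polyfun2y|apply: polyfun2C].
  - apply: polyfun2_comp; [exact: polyfun2_wform|exact: polyfun2C|exact: polyfun2y].
  - by move=> /(_ 0 (bad + 1)) /eqP; rewrite addrC addKr oner_eq0.
  - move=> /(_ 0) /(wform_eq0 pn) /(_ i j); rewrite ij => /(_ (ltnSn _)) h.
    by rewrite h eqxx in n0'.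
exists ka, n, (wform k p' n 1 ka); split => //.
have hX : O1 1 (fun s => b1 * s + b2 * s ^+ 2 + ka * s ^+ k).
  apply: O1D; last by apply: O1Z; apply: O1_le (O1_Xn C k).
  by apply: O1D; apply: O1Z; [apply: (O1_Xn C 1)|apply: O1_le (O1_Xn C 2)].
have h1 := Hp _ _ hX (O1_Xn C 1).
have h2 : lead (fun s => ev p' s (ka * s ^+ k)) n (wform k p' n 1 ka).
  apply: lead_ev => //; last exact: leadXn.
  by apply: lead_ext (leadX1 1); apply: nearpT => s _; rewrite mul1r.
have := leadD h2 (lead0 h1 lt); rewrite addr0; apply: lead_ext.
by apply: nearpT => s _; rewrite -Hp' expr1 subrKC.
Qed.

(* [y] is quadratic over [CC(x, t)], and its discriminant has odd order along  *)
(* a curve: [y] does not belong to the fraction field of [CC[[x, t]]].         *)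
Lemma slice_independence u v : odd_curve -> Exp2 u -> Exp2 v ->
  rflat (fun w => u w (slice_height w) + w^* * v w (slice_height w)) -> flat2 u /\ flat2 v.
Proof.
move=> [k [m [b1 [b2 [bad [de [k0 Hde]]]]]]] Hu Hv HF.
have Pa : polyfun2 (fun x t => Sa x).
  by rewrite /step_a; repeat first [exact: polyfun2C | exact: polyfun2x | apply: polyfun2D | apply: polyfun2M | apply: polyfun2X].
have Pb : polyfun2 (fun x t => Sb x).
  by rewrite /step_b; repeat first [exact: polyfun2C | exact: polyfun2x | apply: polyfun2D | apply: polyfun2M | apply: polyfun2X].
have Pc : polyfun2 (fun x t => Sc x).
  by rewrite /step_c; repeat first [exact: polyfun2C | exact: polyfun2x | apply: polyfun2D | apply: polyfun2M | apply: polyfun2X].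
have Pt := @polyfun2y C; have Px := @polyfun2x C.
have Pta : polyfun2 (fun x t => t * Sa x) by apply: polyfun2M.
have Pxb : polyfun2 (fun x t => x - t * Sb x) by apply: polyfun2B => //; apply: polyfun2M.
have Ptc : polyfun2 (fun x t => t * Sc x) by apply: polyfun2M.
(* The norm of [u + y v] for the quadratic equation of [y], times [t * Sa x]. It is a germ in
   [(x, t)] alone, divisible by [u + y v] on the surface. *)
pose th x t := t * Sa x * u x t ^+ 2 + (x - t * Sb x) * (u x t * v x t) + t * Sc x * v x t ^+ 2.
have Eth : Exp2 th.
  apply: Exp2D; first apply: Exp2D.
  - by apply: Exp2M; [apply: Exp2_poly|apply: Exp2X].
  - by apply: Exp2M; [apply: Exp2_poly|apply: Exp2M].
  - by apply: Exp2M; [apply: Exp2_poly|apply: Exp2X].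
have Fth : flat2 th.
  apply: slice_flat2 => //.
  pose g w := slice_height w * Sa w * (u w (slice_height w) - w^* * v w (slice_height w)) + (w - slice_height w * Sb w) * v w (slice_height w).
  have Hg z : bnd (fun s => g (s * z)).
    have h1 := bnd_slice (Exp2_poly Pta) z; have h2 := bnd_slice (Exp2_poly Pxb) z.
    have h3 := bnd_slice Hu z; have h4 := bnd_slice Hv z; have h5 := bnd_ray_conj z.
    apply: bndD; apply: bndM => //; apply: bndD => //; apply: bndN.
    exact: bndM.
  apply: rflat_ext (rflatM HF Hg) => z; apply: nearp_imp (rnear_St z) => s _ Ss.
  rewrite /g /th; move: (s * z) Ss => w Sw.
  have := Tf_quadratic Sw; rewrite -/(slice_height w); move: (u w (slice_height w)) (v w (slice_height w)) => U V E.
  apply/eqP; rewrite -subr_eq0.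
  have -> : (U + w^* * V) * (slice_height w * Sa w * (U - w^* * V) + (w - slice_height w * Sb w) * V) -
    (slice_height w * Sa w * U ^+ 2 + (w - slice_height w * Sb w) * (U * V) + slice_height w * Sc w * V ^+ 2) =
    V ^+ 2 * (((w - slice_height w * Sb w) * w^* - slice_height w * Sc w) - slice_height w * Sa w * w^* ^+ 2) by ring.
  by rewrite E subrr mulr0.
have Fv : flat2 v.
  apply: contrapT => /(nonflat_lead b1 b2 bad k0 Hv)[ka [n [c [kb c0 Hc]]]].
  have [de0 HD] := Hde ka kb.
  (* Completing the square: [om^2 = Disc v^2 + 4 t Sa th]. With [th] flat, [Disc v^2] agrees with a
     square to all orders, against its odd order on the curve. *)
  pose om x t := 2 * (t * Sa x) * u x t + (x - t * Sb x) * v x t.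
  have Eom : Exp2 om.
    apply: Exp2D; apply: Exp2M => //; apply: Exp2_poly => //.
    by apply: polyfun2M => //; apply: polyfun2C.
  pose xc s := b1 * s + b2 * s ^+ 2 + ka * s ^+ k.
  have Pxc : polyfun2 (fun s (_ : C) => xc s).
    by rewrite /xc; repeat first [exact: polyfun2C | exact: polyfun2x | apply: polyfun2D | apply: polyfun2M | apply: polyfun2X].
  have Oxc : O1 1 xc.
    apply: O1D; last by apply: O1Z; apply: O1_le (O1_Xn C k).
    by apply: O1D; apply: O1Z; [apply: (O1_Xn C 1)|apply: O1_le (O1_Xn C 2)].
  have Os : O1 1 (fun s : C => s) := O1_Xn C 1.
  have h1 := leadM HD (leadX 2 Hc).
  rewrite (_ : m.*2.+1 + n * 2 = (m + n).*2.+1)%N in h1; last by lia.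
  have h2 : O1 (m + n).*2.+2 (fun s => 4 * (s * Sa (xc s)) * th (xc s) s).
    have := Fth (m + n).*2.+2 xc id Oxc Os => h3.
    apply: O1_ext (O1_mulb h3 (_ : bnd (fun s => 4 * (s * Sa (xc s))))).
      by apply: nearpT => s _; ring.
    apply: bndM; first exact: bnd_cst.
    exact: bnd_O1 (Exp2_O20 (Exp2_poly Pta) Oxc Os).
  have h3 := leadD h1 (lead0 h2 (ltnSn _)); rewrite addr0 in h3.
  have /eqP : de ka * c ^+ 2 = 0.
    apply: (@lead_sqr_odd C (fun s => om (xc s) s) (m + n)).
      exact: (@Exp2_curve C om (fun s _ => xc s) (fun s _ => s) Eom Pxc Px Oxc Os).
    apply: lead_ext h3; apply: nearpT => s _; rewrite -/(xc s) /om /th /Disc.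
    by ring.
  by rewrite mulf_eq0 expf_eq0 (negbTE de0) (negbTE c0).
split => //; apply: slice_flat2 => //.
have hv := @rflatM C _ (fun w => - w^*) (flat2_slice Fv) (fun z => bndN (bnd_ray_conj z)).
by apply: rflat_ext (rflatD HF hv) => z; apply: nearpT => s _; ring.
Qed.

End Slice.

Ltac polyfun2_tac := intros; repeat first [assumption | exact: polyfun2C | exact: polyfun2x
  | exact: polyfun2y | apply: polyfun2D | apply: polyfun2B | apply: polyfun2M
  | apply: polyfun2N | apply: polyfun2X].

(** * Minimal equations and their subleading coefficients *)

Section Decouple.
Variable C : numClosedFieldType.
Local Notation B2 := {poly {poly C}}.
Variables k01 k02 k12 k22 : nat.
Local Notation St := (@step_sum C k01 k02 k12 k22).
Local Notation Sa := (@step_a C k02 k12 k22).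
Local Notation Sb := (@step_b C k01 k12).
Local Notation Sc := (@step_c C k01 k02).
Local Notation Tf := (@height C k01 k02 k12 k22).
Local Notation Tw := (@slice_height C k01 k02 k12 k22).
Implicit Types (p q : B2) (x y t c w z : C) (u v : C -> C -> C) (n : nat).

Lemma polyfun2_univ (p : {poly C}) : polyfun2 (fun x _ => p.[x]).
Proof. by exists p%:P => x y; rewrite /ev hornerC. Qed.

Lemma polyfun2_conj u : polyfun2 u -> polyfun2 (fun x y => (u x^* y^*)^*).
Proof.
move=> [p up]; apply: (@polyfun2_ext _ (fun x y => \sum_(j < size p) \sum_(i < size p`_j)
   (p`_j`_i)^* * (x ^+ i * y ^+ j))).
  move=> x y; rewrite up evE rmorph_sum; apply: eq_bigr => j _.
  rewrite rmorph_sum; apply: eq_bigr => i _.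
  by rewrite !rmorphM !rmorphXn /= !conjCK.
by apply: polyfun2_sum => j; apply: polyfun2_sum => i; polyfun2_tac.
Qed.

Lemma polyfun2_swap u : polyfun2 u -> polyfun2 (fun x y => u y x).
Proof. by move=> H; apply: polyfun2_comp => //; polyfun2_tac. Qed.

(** Powers of [y] are reduced by its quadratic equation, each reduction costing a factor [t * Sa x].
    All large [M] are allowed so that finitely many coefficients share an exponent. *)
Lemma reduce_y u : polyfun2 u -> exists M0, forall M, (M0 <= M)%N ->
  exists al be, [/\ polyfun2 al, polyfun2 be & forall x y t,
    t * Sa x * y ^+ 2 = (x - t * Sb x) * y - t * Sc x ->
    (t * Sa x) ^+ M * u x y = al x t + y * be x t].
Proof.
have Pa : polyfun2 (fun x (t : C) => Sa x) by rewrite /step_a; polyfun2_tac.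
have Pb : polyfun2 (fun x (t : C) => Sb x) by rewrite /step_b; polyfun2_tac.
have Pc : polyfun2 (fun x (t : C) => Sc x) by rewrite /step_c; polyfun2_tac.
move=> [p up].
suff [M0 H] : exists M0, forall M, (M0 <= M)%N ->
    exists al be, [/\ polyfun2 al, polyfun2 be & forall x y t,
    t * Sa x * y ^+ 2 = (x - t * Sb x) * y - t * Sc x ->
    (t * Sa x) ^+ M * ev p x y = al x t + y * be x t].
  exists M0 => M /H[al [be [Hal Hbe E]]]; exists al, be; split => // x y t /E.
  by rewrite up.
elim/poly_ind: p {up} => [|p c [M0 IH]].
  exists 0%N => M _; exists (fun _ _ => 0), (fun _ _ => 0); split; [exact: polyfun2C..|].
  by move=> x y t _; rewrite /ev !horner0 !mulr0 addr0.
exists M0.+1 => [[//|M]]; rewrite ltnS => /IH[al [be [Hal Hbe E]]].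
exists (fun x t => (t * Sa x) ^+ M.+1 * c.[x] - t * Sc x * be x t),
  (fun x t => t * Sa x * al x t + (x - t * Sb x) * be x t); split.
- by have := polyfun2_univ c; polyfun2_tac.
- by polyfun2_tac.
move=> x y t Q; have := E x y t Q.
rewrite /ev hornerD hornerM hornerX hornerC hornerD hornerM hornerC -/(ev p x y) => E'.
have -> : (t * Sa x) ^+ M.+1 * (ev p x y * y + c.[x]) =
  t * Sa x * y * ((t * Sa x) ^+ M * ev p x y) + (t * Sa x) ^+ M.+1 * c.[x].
  by rewrite exprS; ring.
rewrite E'; apply/eqP; rewrite -subr_eq0; apply/eqP.
transitivity (be x t * (t * Sa x * y ^+ 2 - ((x - t * Sb x) * y - t * Sc x))); first by ring.
by rewrite Q subrr mulr0.
Qed.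

Lemma homogenize u : polyfun2 u -> exists M0, forall M, (M0 <= M)%N ->
  exists2 h, polyfun2 h & forall x y, St x y != 0 -> h x y = St x y ^+ M * u x (Tf x y).
Proof.
move=> [p up]; exists (size p) => M leM.
exists (fun x y => \sum_(j < size p) \sum_(i < size p`_j)
  p`_j`_i * (x ^+ i * (x * y) ^+ j) * St x y ^+ (M - j)).
  apply: polyfun2_sum => j; apply: polyfun2_sum => i.
  by rewrite /step_sum; polyfun2_tac.
move=> x y S0; rewrite up evE mulr_sumr; apply: eq_bigr => j _.
rewrite mulr_sumr; apply: eq_bigr => i _.
have -> : St x y ^+ M = St x y ^+ (M - j) * St x y ^+ j.
  by rewrite -exprD subnK // (leq_trans _ leM) // ltnW.
by rewrite /height expr_div_n; field; rewrite expf_neq0.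
Qed.

Definition ev3 (m : {poly B2}) x t c : C := \sum_(i < size m) ev m`_i x t * c ^+ i.

Lemma ev0 x y : ev (0 : B2) x y = 0.
Proof. by rewrite /ev !horner0. Qed.

Lemma ev3_wide (m : {poly B2}) (N : nat) x t c : (size m <= N)%N ->
  ev3 m x t c = \sum_(i < N) ev m`_i x t * c ^+ i.
Proof.
move=> mN; rewrite /ev3 (big_ord_widen N (fun i => ev m`_i x t * c ^+ i)) //.
rewrite big_mkcond; apply: eq_bigr => i _.
by case: ltnP => // h; rewrite (nth_default _ h) ev0 mul0r.
Qed.

Variable f : C -> C -> C.
Hypothesis Ef : Exp2 f.
Hypothesis Hodd : odd_curve C k01 k02 k12 k22.
Hypothesis Sa1 : Sa 1 != 0.

Let fs w := f w (Tw w).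

Definition kills (m : {poly B2}) : Prop := flat2 (fun x t => ev3 m x t (f x t)).

Lemma Exp2_ev3 (m : {poly B2}) : Exp2 (fun x t => ev3 m x t (f x t)).
Proof.
apply: Exp2_sum => i; apply: Exp2M; last exact: Exp2X.
by apply: Exp2_poly; apply: polyfun2_ev.
Qed.

(* [1, f, .., f ^ (n - 1)] stay linearly independent over [CC(x, y)]. *)
Lemma slice_lin_indep (m : {poly B2}) (ka : nat -> C -> C -> C) :
  (forall q : {poly B2}, (size q < size m)%N -> kills q -> q = 0) ->
  (forall i, polyfun2 (ka i)) ->
  rflat (fun w => \sum_(i < (size m).-1) ka i w w^* * fs w ^+ i) ->
  forall i, (i < (size m).-1)%N -> forall x y, ka i x y = 0.
Proof.
set n := (size m).-1 => minm Pka HF i0 i0n.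
have [m0|m0] := eqVneq (size m) 0%N; first by rewrite /n m0 in i0n.
have [M0 HM0] := choice (fun i => reduce_y (Pka i)).
have [M leM] : exists M, forall i, (i < n)%N -> (M0 i <= M)%N.
  by exists (\max_(i < n) M0 i)%N => i lt; apply: (leq_bigmax (Ordinal lt)).
have HM i : exists ab : B2 * B2, (i < n)%N -> forall x y t,
    t * Sa x * y ^+ 2 = (x - t * Sb x) * y - t * Sc x ->
    (t * Sa x) ^+ M * ka i x y = ev ab.1 x t + y * ev ab.2 x t.
  case: (ltnP i n) => [lt|]; last by exists (0, 0).
  have [al [be [[p Hp] [q Hq] E]]] := HM0 i M (leM i lt); exists (p, q) => _ x y t Q.
  by rewrite (E x y t Q) Hp Hq.
have {HM}[ab Hab] := choice HM.
pose A : {poly B2} := \poly_(i < n) (ab i).1; pose B : {poly B2} := \poly_(i < n) (ab i).2.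
have An : (size A <= n)%N by apply: size_poly.
have Bn : (size B <= n)%N by apply: size_poly.
have nm : (n < size m)%N by rewrite /n prednK // lt0n.
have evA x t c : ev3 A x t c = \sum_(i < n) ev (ab i).1 x t * c ^+ i.
  by rewrite (ev3_wide _ _ _ An); apply: eq_bigr => i _; rewrite coef_poly ltn_ord.
have evB x t c : ev3 B x t c = \sum_(i < n) ev (ab i).2 x t * c ^+ i.
  by rewrite (ev3_wide _ _ _ Bn); apply: eq_bigr => i _; rewrite coef_poly ltn_ord.
have HAB : rflat (fun w => ev3 A w (Tw w) (fs w) + w^* * ev3 B w (Tw w) (fs w)).
  have hb z : bnd (fun s => (fun w => (Tw w * Sa w) ^+ M) (s * z)).
    have Pta : polyfun2 (fun x t => (t * Sa x) ^+ M) by rewrite /step_a; polyfun2_tac.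
    exact: (bnd_slice k01 k02 k12 k22 (Exp2_poly Pta) z).
  apply: rflat_ext (@rflatM C _ (fun w => (Tw w * Sa w) ^+ M) HF hb) => z.
  apply: nearp_imp (rnear_St k01 k02 k12 k22 z) => s _.
  move: (s * z) => w Sw; have Q := Tf_quadratic Sw; rewrite -/(Tw w) in Q.
  rewrite evA evB mulr_suml mulr_sumr -big_split; apply: eq_bigr => i _ /=.
  have h := Hab i (ltn_ord i) _ _ _ Q.
  rewrite mulrA -mulrDl.
  rewrite -h.
  by move: (ka i _ _) (fs w ^+ i) ((_ * _) ^+ M) => a b c; rewrite mulrC mulrA.
have [FA FB] := slice_independence Hodd (Exp2_ev3 A) (Exp2_ev3 B) HAB.
have A0 := minm A (leq_ltn_trans An nm) FA.
have B0 := minm B (leq_ltn_trans Bn nm) FB.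
have H0 x y : (x * y * Sa x) ^+ M * St x y * ka i0 x y = 0.
  have [->|S0] := eqVneq (St x y) 0; first by rewrite mulr0 mul0r.
  have := Hab i0 i0n x y _ (Tf_quadratic S0).
  have -> : (ab i0).1 = 0.
    by have := congr1 (fun P : {poly B2} => P`_i0) A0; rewrite coef_poly i0n coef0.
  have -> : (ab i0).2 = 0.
    by have := congr1 (fun P : {poly B2} => P`_i0) B0; rewrite coef_poly i0n coef0.
  rewrite !ev0 mulr0 addr0 => E.
  transitivity (St x y ^+ M.+1 * ((Tf x y * Sa x) ^+ M * ka i0 x y)).
    have -> : x * y * Sa x = St x y * (Tf x y * Sa x) by rewrite /height; field.
    by rewrite exprMn exprS; ring.
  by rewrite E mulr0.
have P1 : polyfun2 (fun x y => (x * y * Sa x) ^+ M * St x y).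
  by rewrite /step_a /step_sum; polyfun2_tac.
case: (polyfun2_mulf_eq0 P1 (Pka i0) H0) => // H1.
have := H1 1 1 => /eqP; rewrite !mul1r mulf_eq0 expf_eq0 (negbTE Sa1) andbF /=.
rewrite (_ : St 1 1 = (1 + k01 + k01 + k02 + k02 + k12 + k12 + k22)%N%:R).
  by rewrite pnatr_eq0 -!addnA.
by rewrite /step_sum !natrD; ring.
Qed.

Variables (l nm : C -> C -> C).
Hypothesis Pl : polyfun2 l.
Hypothesis Pnm : polyfun2 nm.
Hypothesis l00 : l 0 0 != 0.
Hypothesis frel : rnear (fun w => l w w^* * (fs w + (fs w)^*) = nm w w^*).

(** Both sides are [a^n] times the polynomial with coefficients [A], taken at [b / a - g]; the left
    one is sorted by powers of [g]. *)
Lemma binomial_resum (n : nat) (A : nat -> C) (a b g : C) :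
  \sum_(j < n.+1) (\sum_(i < n.+1) 'C(i, j)%:R * (-1) ^+ j * A i * b ^+ (i - j) * a ^+ (n - (i - j))) * g ^+ j
  = \sum_(i < n.+1) A i * a ^+ (n - i) * (b - a * g) ^+ i.
Proof.
under eq_bigr do rewrite mulr_suml.
rewrite exchange_big; apply: eq_bigr => i _ /=.
rewrite exprDn (big_ord_widen n.+1 (fun j => b ^+ (i - j) * (- (a * g)) ^+ j *+ 'C(i, j))) //.
rewrite [in RHS]big_mkcond mulr_sumr; apply: eq_bigr => j _.
rewrite ltnS; case: leqP => [ji|ij]; last by rewrite bin_small // !mul0r mulr0.
have -> : (n - (i - j) = (n - i) + j)%N.
  by have := ltn_ord i; rewrite ltnS => h; lia.
rewrite -mulr_natr exprD -[- (a * g)]mulN1r !exprMn; ring.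
Qed.

Theorem trace_decoupling (m0 : {poly B2}) : m0 != 0 -> kills m0 ->
  exists (n : nat) (a1 a0 b1 b0 : B2), [/\ (0 < n)%N, a0 != 0, b0 != 0 &
   forall x y, St x y != 0 ->
    l x y * (ev b0 y (Tf x y) * ev a1 x (Tf x y) + ev a0 x (Tf x y) * ev b1 y (Tf x y))
    + n%:R * nm x y * (ev a0 x (Tf x y) * ev b0 y (Tf x y)) = 0].
Proof.
move=> m00 Km0.
pose P (k : nat) := `[< exists m, [/\ m != 0, kills m & size m = k] >].
have exP : exists k, P k by exists (size m0); apply/asboolP; exists m0.
have [k /asboolP[m [mn0 Km mk]] kmin] := ex_minnP exP.
have minm (q : {poly B2}) : (size q < size m)%N -> kills q -> q = 0.
  move=> qm Kq; apply/eqP/negPn/negP => q0.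
  have : P (size q) by apply/asboolP; exists q.
  by move=> /kmin; rewrite -mk leqNgt qm.
have [n' mn] : exists n', size m = n'.+2.
  case E: (size m) => [|[|n']]; last by exists n'.
    by move/eqP: E; rewrite size_poly_eq0 (negbTE mn0).
  (* An equation of degree 0 would be a nonzero flat polynomial. *)
  have /size_poly1P[a a0 aE] : size m == 1 by rewrite E.
  case/negP: a0; apply/eqP; apply: poly_flat2_eq0 => N X Y HX HY.
  apply: O1_ext (Km N X Y HX HY); apply: nearpT => s _.
  by rewrite /ev3 E big_ord1 aE coefC mulr1.
pose n := n'.+1.
pose A i x t := ev m`_i x t.
pose Bc i y t := (ev m`_i y^* t^*)^*.
have PA i : polyfun2 (A i) by apply: polyfun2_ev.
have PB i : polyfun2 (Bc i) by apply: polyfun2_conj (PA i).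
have [MA HMA] := choice (fun i => homogenize (PA i)).
have [MB HMB] := choice (fun i => homogenize (PB i)).
have [M leM] : exists M, forall i, (i < n.+1)%N -> (MA i <= M)%N /\ (MB i <= M)%N.
  exists (\sum_(i < n.+1) (MA i + MB i))%N => i lt.
  have : (MA i + MB i <= \sum_(i < n.+1) (MA i + MB i))%N.
    by rewrite (bigD1 (Ordinal lt)) //= leq_addr.
  by move=> h; split; apply: leq_trans h; rewrite ?leq_addr ?leq_addl.
have hA i : exists h, polyfun2 h /\ ((i < n.+1)%N ->
    forall x y, St x y != 0 -> h x y = St x y ^+ M * A i x (Tf x y)).
  case: (ltnP i n.+1) => [lt|_]; last by exists (fun _ _ => 0); split => //; exact: polyfun2C.
  by have [h Ph Eh] := HMA i M (leM i lt).1; exists h.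
have hB i : exists h, polyfun2 h /\ ((i < n.+1)%N ->
    forall x y, St x y != 0 -> h x y = St x y ^+ M * Bc i y (Tf x y)).
  case: (ltnP i n.+1) => [lt|_]; last by exists (fun _ _ => 0); split => //; exact: polyfun2C.
  have [h Ph Eh] := HMB i M (leM i lt).2; exists (fun x y => h y x).
  split; first exact: polyfun2_swap.
  by move=> _ x y S0; rewrite Eh ?(St_sym _ _ _ _ y) // (Tf_sym _ _ _ _ y).
have [Ah HAh] := choice hA; have [Bh HBh] := choice hB.
(* The coefficients of the equation obtained for the conjugate of [f] by replacing [f] with [nm / l]
   minus that conjugate, cleared by [l ^+ n]. *)
pose D j x y := \sum_(i < n.+1) 'C(i, j)%:R * (-1) ^+ j * Ah i x y * nm x y ^+ (i - j) * l x y ^+ (n - (i - j)).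
have PAh i : polyfun2 (Ah i) by have [] := HAh i.
have PBh i : polyfun2 (Bh i) by have [] := HBh i.
have PD j : polyfun2 (D j).
  by apply: polyfun2_sum => i; have := PAh i; polyfun2_tac.
(* Eliminating the top coefficient between the two equations leaves a relation of degree below [n],
   which minimality forces to be zero. Its coefficient of index [n'] is the desired decoupling. *)
pose E j x y := Bh n x y * D j x y - D n x y * Bh j x y.
have PE j : polyfun2 (E j).
  by have := PD j; have := PD n; have := PBh j; have := PBh n; rewrite /E; polyfun2_tac.
have rE : rflat (fun w => \sum_(j < n) E j w w^* * (fs w)^* ^+ j).
  pose F w := ev3 m w (Tw w) (fs w).
  have HF : rflat F := @flat2_slice C k01 k02 k12 k22 _ Km.
  have PS : polyfun2 (fun x y => Bh n x y * l x y ^+ n * St x y ^+ M).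
    by have := PBh n; rewrite /step_sum; polyfun2_tac.
  have PS' : polyfun2 (fun x y => - (D n x y * St x y ^+ M)).
    by have := PD n; rewrite /step_sum; polyfun2_tac.
  have h1 := @rflatM C F (fun w => Bh n w w^* * l w w^* ^+ n * St w w^* ^+ M) HF (bnd_polyslice PS).
  have h2 := @rflatM C (fun w => (F w)^*) (fun w => - (D n w w^* * St w w^* ^+ M)) (rflat_conj HF)
    (bnd_polyslice PS').
  apply: rflat_ext (rflatD h1 h2) => z.
  apply: nearp_imp (nearp_and (frel z) (rnear_St k01 k02 k12 k22 z)) => s _.
  move: (s * z) => w [Rw Sw].
  have -> : \sum_(j < n) E j w w^* * (fs w)^* ^+ j = \sum_(j < n.+1) E j w w^* * (fs w)^* ^+ j.
    rewrite [RHS]big_ord_recr /= [X in _ = _ + X](_ : _ = 0) ?addr0 //.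
    by rewrite /E [D n _ _ * _]mulrC subrr mul0r.
  have -> : \sum_(j < n.+1) E j w w^* * (fs w)^* ^+ j =
     Bh n w w^* * (\sum_(j < n.+1) D j w w^* * (fs w)^* ^+ j)
     - D n w w^* * (\sum_(j < n.+1) Bh j w w^* * (fs w)^* ^+ j).
    rewrite !mulr_sumr -sumrB; apply: eq_bigr => j _.
    by rewrite /E; ring.
  rewrite (binomial_resum n (fun i => Ah i w w^*)).
  have -> : \sum_(i < n.+1) Ah i w w^* * l w w^* ^+ (n - i) * (nm w w^* - l w w^* * (fs w)^*) ^+ i
     = l w w^* ^+ n * St w w^* ^+ M * F w.
    rewrite /F /ev3 mn mulr_sumr; apply: eq_bigr => i _.
    rewrite -Rw (HAh i).2 // mulrDr addrK exprMn /A -/(Tw w).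
    have -> : l w w^* ^+ n = l w w^* ^+ (n - i) * l w w^* ^+ i.
      by rewrite -exprD subnK // -ltnS.
    by ring.
  have -> : \sum_(j < n.+1) Bh j w w^* * (fs w)^* ^+ j = St w w^* ^+ M * (F w)^*.
    rewrite /F /ev3 mn rmorph_sum mulr_sumr; apply: eq_bigr => i _.
    rewrite (HBh i).2 // /Bc rmorphM rmorphXn /= conjCK -/(Tw w) Tw_conj.
    by rewrite mulrA.
  by ring.
have E0 j : (j < n)%N -> forall x y, E j x y = 0.
  move=> jn x y.
  (* The relation concerns powers of the conjugate of [f]; conjugating it yields powers of [f] and
     exchanges the two arguments. *)
  pose ka i x y := (E i y^* x^*)^*.
  have Pka i : polyfun2 (ka i).
    exact: (polyfun2_conj (polyfun2_swap (PE i))).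
  have nE : (size m).-1 = n by rewrite mn.
  have H : rflat (fun w => \sum_(i < (size m).-1) ka i w w^* * fs w ^+ i).
    rewrite nE; apply: rflat_ext (rflat_conj rE) => z; apply: nearpT => s _.
    rewrite rmorph_sum; apply: eq_bigr => i _.
    by rewrite rmorphM rmorphXn /= conjCK /ka conjCK.
  have := slice_lin_indep minm Pka H; rewrite nE => /(_ j jn y^* x^*).
  by rewrite /ka !conjCK => /(congr1 Num.conj); rewrite conjCK conjC0.
pose Rel x y := l x y * (Bh n x y * Ah n' x y + Ah n x y * Bh n' x y)
   + n%:R * nm x y * (Ah n x y * Bh n x y).
have DnE x y : D n x y = (-1) ^+ n * Ah n x y * l x y ^+ n.
  rewrite /D big_ord_recr big1 ?add0r /=; last first.
    by move=> i _; rewrite bin_small // !mul0r.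
  by rewrite add0r binn subnn subn0 mul1r expr0 mulr1.
have Dn'E x y : D n' x y = (-1) ^+ n' * l x y ^+ n' * (l x y * Ah n' x y + n%:R * nm x y * Ah n x y).
  rewrite /D !big_ord_recr big1 ?add0r /=; last first.
    by move=> i _; rewrite bin_small // !mul0r.
  rewrite add0r binn binSn subnn subn0 -/n (_ : n - n' = 1)%N; last by rewrite /n subSn // subnn.
  by rewrite (_ : n - 1 = n')%N ?subn1 // /n !exprS; ring.
have PR : polyfun2 Rel.
  by have := PAh n; have := PAh n'; have := PBh n; have := PBh n'; rewrite /Rel; polyfun2_tac.
have R0 x y : Rel x y = 0.
  have Pln : polyfun2 (fun x y => l x y ^+ n') by apply: polyfun2X.
  have H a b : l a b ^+ n' * Rel a b = 0.
    have := E0 n' (ltnSn _) a b; rewrite /E DnE Dn'E /n !exprS => h.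
    have s0 : (-1) ^+ n' != 0 :> C by rewrite signr_eq0.
    by apply: (mulfI s0); rewrite mulr0 -[RHS]h /Rel /n; ring.
  case: (polyfun2_mulf_eq0 Pln PR H) => // /(_ 0 0) /eqP.
  by rewrite expf_eq0 (negbTE l00) andbF.
have [b0 Hb0] := PB n; have [b1 Hb1] := PB n'.
exists n, m`_n', m`_n, b1, b0; split => //.
- by rewrite /n -[n'.+1]/(n'.+2.-1) -mn -/(lead_coef m) lead_coef_eq0.
- apply: contra mn0 => /eqP b00; rewrite -lead_coef_eq0 lead_coefE mn -/n.
  apply/eqP/ev_eq0 => x y; have := Hb0 x^* y^*; rewrite b00 ev0 /Bc !conjCK.
  by move=> /(congr1 Num.conj); rewrite conjCK conjC0.
move=> x y S0; rewrite -Hb0 -Hb1.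
have n'n : (n' < n.+1)%N by rewrite ltnW.
apply: (mulfI (expf_neq0 (M + M) S0)); rewrite mulr0 -[RHS](R0 x y) /Rel.
rewrite !(HAh _).2 // !(HBh _).2 // exprD /A; ring.
Qed.

End Decouple.

(** * Odd curves and nodes of the seven surfaces *)

Section OddCurves.
Variable C : numClosedFieldType.

Let shift_neq0 (a b : C) (n : nat) : a != b -> n.+1%:R * (a - b) != 0.
Proof. by move=> ab; rewrite mulf_neq0 ?pnatr_eq0 // subr_eq0. Qed.

(** To lowest order the discriminant has the branches [x = (k01 + 2) t] and [x = (k01 - 2) t]. The
    curves are tangent to the first, and the excluded [ka] is its second Taylor coefficient. *)
Lemma odd_curve_diag k01 k12 k22 : odd_curve C k01 1 k12 k22.
Proof.
exists 2%N, 1%N, (k01%:R + 2), 0, ((k12%:R + k01%:R) * (k01%:R + 2)),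
  (fun ka => 4 * (ka - (k12%:R + k01%:R) * (k01%:R + 2))).
split=> // ka kab; split; first exact: shift_neq0.
pose be : C := k01%:R + 2; pose X s := be + ka * s.
pose w s := ka - k12%:R * s * X s ^+ 2.
apply: (lead_rem (g := fun s => w s ^+ 2 - 4 * k12%:R * X s ^+ 2 - 4 * ((k12%:R + k01%:R) * ka
  + X s ^+ 2 * (1 + k22%:R + k12%:R * k01%:R) + s * X s ^+ 3 * (k12%:R + k01%:R * k22%:R)
  + s ^+ 2 * X s ^+ 4 * k22%:R))).
  by rewrite /w /X; bnd_tac.
by apply: nearpT => s _; rewrite /Disc /step_a /step_b /step_c /w /X /be; ring.
Qed.

(** [Disc] is divisible by [x]; on curves close to the branch [x = 0] its dominant term is
    [- 4 t^2 x]. *)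
Lemma odd_curve_1 : odd_curve C 0 0 1 1.
Proof.
exists 3%N, 2%N, 0, 0, 0, (fun ka => 4 * (0 - ka)).
split=> // ka ka0; split; first by rewrite shift_neq0 // eq_sym.
apply: (lead_rem (g := fun s => ka ^+ 2 * (1 - ka * s ^+ 4) ^+ 2 - 4 * ka ^+ 2 * s ^+ 2)).
  by bnd_tac.
by apply: nearpT => s _; rewrite /Disc /step_a /step_b /step_c; ring.
Qed.

(** One branch of the discriminant is [x = t + 2 t^2 + 5 t^3 + ...]. *)
Lemma odd_curve_2 : odd_curve C 1 0 0 1.
Proof.
exists 3%N, 2%N, 1, 2, 5, (fun ka => 4 * (ka - 5)).
split=> // ka ka0; split; first exact: shift_neq0.
pose Y s := 2 + ka * s.
apply: (lead_rem (g := fun s => ka ^+ 2 - 4 * (2 * ka + 3 * Y s + Y s ^+ 2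
  + 3 * s * Y s ^+ 2 + s ^+ 2 * Y s ^+ 3))).
  by rewrite /Y; bnd_tac.
by apply: nearpT => s _; rewrite /Disc /step_a /step_b /step_c /Y; ring.
Qed.

(** The discriminant curve has a cusp tangent to [x = t]; every [ka] gives order three, coming from
    [- 4 t^2 x]. *)
Lemma odd_curve_3 : odd_curve C 1 0 1 0.
Proof.
exists 2%N, 1%N, 1, 0, 0, (fun=> - 4).
split=> // ka _; split; first by rewrite oppr_eq0 pnatr_eq0.
pose X s := 1 + ka * s.
apply: (lead_rem (g := fun s => (ka - s * X s ^+ 2) ^+ 2 - 4 * ka - 4 * X s ^+ 2)).
  by rewrite /X; bnd_tac.
by apply: nearpT => s _; rewrite /Disc /step_a /step_b /step_c /X; ring.
Qed.

End OddCurves.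

(** * Existence of nodes with nonreal multiplier *)

Section NodeExistence.
Variable C : numClosedFieldType.
Implicit Types (x y r u v A B : C).

Lemma nonreal_root u v : u \is Num.real -> u ^+ 2 - 4 * v < 0 ->
  exists2 y, y ^+ 2 = - u * y - v & y \isn't Num.real.
Proof.
move=> ur d; pose s := sqrtC (4 * v - u ^+ 2).
have sp : 0 < s by rewrite sqrtC_gt0 -oppr_lt0 opprB.
have s2 : s ^+ 2 = 4 * v - u ^+ 2 by rewrite sqrtCK.
exists ((- u + 'i * s) / 2).
  apply/eqP; rewrite -subr_eq0.
  have -> : ((- u + 'i * s) / 2) ^+ 2 - (- u * ((- u + 'i * s) / 2) - v) =
     (4 * v - u ^+ 2 + 'i ^+ 2 * s ^+ 2) / 4 by field.
  by rewrite sqrCi s2 mulN1r subrr mul0r.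
apply/negP => H.
have : 'i * s \is Num.real.
  have -> : 'i * s = ((- u + 'i * s) / 2) * 2 + u by field.
  apply: realD => //; apply: realM => //; apply: realn.
rewrite CrealE rmorphM /= conjCi (conj_Creal (gtr0_real sp)) mulNr -subr_eq0 -opprD oppr_eq0 -mulr2n.
by rewrite mulrn_eq0 /= mulf_eq0 (negbTE (neq0Ci C)) gt_eqF.
Qed.

Lemma nonreal_lin y A B : y \isn't Num.real -> A \is Num.real -> B \is Num.real ->
  A + B * y = 0 -> A = 0 /\ B = 0.
Proof.
move=> yn Ar Br E; have B0 : B = 0.
  apply/eqP/negPn/negP => B0; case/negP: yn.
  have -> : y = - A / B.
    by apply: (mulIf B0); rewrite divfK // mulrC; apply/eqP; rewrite -addr_eq0 addrC E.
  by rewrite rpredM ?rpredN ?rpredV.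
by split => //; rewrite -E B0 mul0r addr0.
Qed.

(** On the unit circle the inverse is the conjugate, so [s + s^-1] would be real; off the circle,
    one of [s] and [s^-1] lies outside. *)
Lemma joukowski r : r \isn't Num.real -> exists2 s, 1 < `|s| & s + s^-1 = r.
Proof.
move=> rn; pose s := (r + sqrtC (r ^+ 2 - 4)) / 2.
have Es : s * (r - s) = 1.
  have -> : s * (r - s) = (r ^+ 2 - sqrtC (r ^+ 2 - 4) ^+ 2) / 4 by rewrite /s; field.
  by rewrite sqrtCK subKr divff // pnatr_eq0.
have s0 : s != 0 by apply: contra_eq_neq Es => ->; rewrite mul0r eq_sym oner_eq0.
have sV : s^-1 = r - s by apply: (mulfI s0); rewrite divff.
have sr : s + s^-1 = r by rewrite sV subrKC.
have n1 : `|s| != 1.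
  apply: contra rn => /eqP n1; rewrite CrealE -sr rmorphD /= addrC.
  have sc : s^* = s^-1.
    by apply: (mulfI s0); rewrite -normCK n1 expr1n divff.
  by rewrite sc fmorphV /= sc invrK.
have [lt|lt|e] := real_ltgtP (normr_real s) (real1 C); last by rewrite e eqxx in n1.
  exists s^-1; last by rewrite invrK addrC.
  by rewrite normfV invf_gt1 ?normr_gt0.
by exists s.
Qed.

Lemma mk_node k01 k02 k12 k22 (x0 rho : C) : x0 != 0 -> step_sum k01 k02 k12 k22 x0 x0 != 0 ->
  step_a k02 k12 k22 x0 != 0 -> x0 ^+ 2 * step_a k02 k12 k22 x0 = step_c k01 k02 x0 ->
  rho * (x0 ^+ 2 * step_a k02 k12 k22 x0) = step_sum k01 k02 k12 k22 x0 x0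
     - x0 ^+ 2 * (4 * k12%:R * x0 + 4 * k22%:R * x0 ^+ 2) ->
  rho \isn't Num.real -> x0 ^+ 2 \isn't Num.real ->
  exists sg, is_node k01 k02 k12 k22 x0 sg.
Proof.
move=> x00 S0 a0 H1 H2 /joukowski[sg sg1 sgE] xn; exists sg.
by split; split => //; rewrite ?sgE // -CrealE.
Qed.

End NodeExistence.

Ltac real_tac := repeat first [assumption | exact: real1 | exact: realn | exact: real0
  | apply: realB | apply: realD | rewrite realN | apply: realM | apply: realX].

Section RealRoots.
Variable R : realType.

Lemma cubic_root : exists2 th : R, 5 / 4 < th < 2 & th ^+ 3 = th + 1.
Proof.
pose p : {poly R} := 'X^3 - 'X - 1.
have pE x : p.[x] = x ^+ 3 - x - 1 by rewrite /p !hornerE.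
have [||x xI /rootP px] := @poly_ivtoo _ p (5 / 4) 2; [lra|by rewrite !pE; lra|].
by exists x => //; move: px; rewrite pE; lra.
Qed.

Lemma resolvent_root : exists2 u : R, 0 < u < 1 / 2 & u ^+ 6 + 4 * u ^+ 2 = 1.
Proof.
pose p : {poly R} := 'X^6 + 4 *: 'X^2 - 1.
have pE x : p.[x] = x ^+ 6 + 4 * x ^+ 2 - 1 by rewrite /p !hornerE.
have [||x xI /rootP px] := @poly_ivtoo _ p 0 (1 / 2); [lra|by rewrite !pE; lra|].
by exists x => //; move: px; rewrite pE; lra.
Qed.

End RealRoots.

Section SevenNodes.
Variable R : realType.
Local Notation C := (CC R).
Implicit Types (y u v : C).

Let emb (a : R) : C := (a%:C)%C.

Let emb_real (a : R) : emb a \is Num.real.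
Proof. by rewrite CrealE; apply/eqP; apply: conjc_real. Qed.

Let emb_neq0 (a : R) : a != 0 -> emb a != 0.
Proof. by rewrite /emb eq_complex /= eqxx andbT. Qed.

Let embD a b : emb (a + b) = emb a + emb b. Proof. exact: rmorphD. Qed.
Let embM a b : emb (a * b) = emb a * emb b. Proof. exact: rmorphM. Qed.
Let embN a : emb (- a) = - emb a. Proof. exact: rmorphN. Qed.
Let embX a n : emb (a ^+ n) = emb a ^+ n. Proof. exact: rmorphXn. Qed.
Let embn n : emb n%:R = n%:R. Proof. exact: rmorph_nat. Qed.
Let emb1 : emb 1 = 1. Proof. exact: rmorph1. Qed.
Let embE := (embD, embN, embM, embX, embn, emb1).

(** Over the reals [y^4 - y - 1 = (y^2 + u y + v)(y^2 - u y + u^2 - v)], where [u^2] is a root of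
    the resolvent cubic; the first factor has nonreal roots. The inequations are those needed at the
    nodes. *)
Lemma quartic_root : exists u v y : C,
  [/\ u \is Num.real, v \is Num.real, y \isn't Num.real & y ^+ 2 = - u * y - v] /\
  [/\ y ^+ 4 = y + 1, 2 * u * v = u ^+ 3 + 1, u != 0 & u ^+ 2 - v != 0] /\
  [/\ 3 - 2 * u != 0, 1 - u != 0, 1 - 4 * u + 3 * v != 0 & u ^+ 2 - 1 - 2 * u ^+ 3 - v != 0].
Proof.
have [u /andP[u0 u1] E] := resolvent_root R.
pose v := (u ^+ 2 + u^-1) / 2.
have uv : 2 * u * v = u ^+ 3 + 1 by rewrite /v; field; rewrite gt_eqF.
have u2 : u ^+ 2 < 1 / 4 by nra.
have v1 : 1 < v by have : 0 < u * (v - 1); [nra|rewrite pmulr_rgt0 // subr_gt0].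
have u3 : 0 < u ^+ 3 by rewrite exprn_gt0.
have v2 : v ^+ 2 - u ^+ 2 * v = 1.
  have u20 : 4 * u ^+ 2 != 0 by rewrite mulf_neq0 ?pnatr_eq0 // expf_neq0 // gt_eqF.
  apply: (mulfI u20); rewrite mulr1.
  have -> : 4 * u ^+ 2 * (v ^+ 2 - u ^+ 2 * v) = (2 * u * v) ^+ 2 - 2 * u ^+ 3 * (2 * u * v) by ring.
  rewrite uv; apply/eqP; rewrite -subr_eq0; apply/eqP.
  transitivity (1 - (u ^+ 6 + 4 * u ^+ 2)); first by ring.
  by rewrite E subrr.
have d : emb u ^+ 2 - 4 * emb v < 0.
  rewrite -embX -(embn 4) -embM -embN -embD ltcR; lra.
have [y y2 yn] := nonreal_root (emb_real u) d.
exists (emb u), (emb v), y; split; first by split.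
split; split.
- have -> : y ^+ 4 = (y ^+ 2) ^+ 2 by ring.
  have -> : (y ^+ 2) ^+ 2 = (2 * emb u * emb v - emb u ^+ 3) * y + (emb v ^+ 2 - emb u ^+ 2 * emb v).
    rewrite y2.
    transitivity (emb u ^+ 2 * y ^+ 2 + 2 * emb u * emb v * y + emb v ^+ 2); first by ring.
    by rewrite y2; ring.
  have -> : 2 * emb u * emb v = emb u ^+ 3 + 1 by rewrite -(embn 2) -!embM uv !embE.
  have -> : emb v ^+ 2 - emb u ^+ 2 * emb v = 1 by rewrite -!embX -embM -embN -embD v2 emb1.
  by ring.
- by rewrite -(embn 2) -!embM uv !embE.
- by apply: emb_neq0; rewrite gt_eqF.
- have := @emb_neq0 (u ^+ 2 - v); rewrite !embE; apply; nra.
- have := @emb_neq0 (3%:R - 2%:R * u); rewrite !embE; apply; nra.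
- have := @emb_neq0 (1 - u); rewrite !embE; apply; nra.
- have := @emb_neq0 (1 - 4%:R * u + 3%:R * v); rewrite !embE; apply; nra.
- have := @emb_neq0 (u ^+ 2 - 1 - 2%:R * u ^+ 3 - v); rewrite !embE; apply; nra.
Qed.

(** Here [y^3 - y - 1 = (y - th)(y^2 + th y + th^2 - 1)], and the quadratic factor has negative
    discriminant. *)
Lemma cubic_nonreal_root : exists th y : C,
  [/\ th \is Num.real, y \isn't Num.real & y ^+ 2 = - th * y - (th ^+ 2 - 1)] /\
  [/\ y ^+ 3 = y + 1, th != 0, 2 - th != 0 & 2 * th ^+ 2 - 3 * th - 1 != 0].
Proof.
have [u /andP[u0 u1] E] := cubic_root R.
have d : emb u ^+ 2 - 4 * emb (u ^+ 2 - 1) < 0.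
  rewrite -embX -(embn 4) -embM -embN -embD ltcR; nra.
have [y y2 yn] := nonreal_root (emb_real u) d.
rewrite !embE in y2.
exists (emb u), y; split; first by split.
split.
- have -> : y ^+ 3 = y * y ^+ 2 by ring.
  rewrite y2; transitivity (- emb u * y ^+ 2 - (emb u ^+ 2 - 1) * y); first by ring.
  rewrite y2; transitivity (y + (emb u ^+ 3 - emb u)); first by ring.
  by rewrite -embX -embN -embD E addrAC subrr add0r emb1.
- by apply: emb_neq0; rewrite gt_eqF //; lra.
- have := @emb_neq0 (2%:R - u); rewrite !embE; apply; nra.
- have := @emb_neq0 (2%:R * u ^+ 2 - 3%:R * u - 1); rewrite !embE; apply.
  apply/negP => /eqP h.
  have : u * (2 * u ^+ 2 - 3 * u - 1) = 0 by rewrite h mulr0.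
  have -> : u * (2 * u ^+ 2 - 3 * u - 1) = 2 * u ^+ 3 - 3 * u ^+ 2 - u by ring.
  rewrite E; lra.
Qed.

Lemma nr_neq0 y : y \isn't Num.real -> y != 0.
Proof. by apply: contraNneq => ->; apply: real0. Qed.

Lemma nr_affine y A B : y \isn't Num.real -> A \is Num.real -> B \is Num.real ->
  B != 0 -> A + B * y \isn't Num.real.
Proof.
move=> yn Ar Br B0; apply/negP => H.
have E : A - (A + B * y) + B * y = 0 by ring.
have [_ /eqP] := nonreal_lin yn (realB Ar H) Br E.
by rewrite (negbTE B0).
Qed.

Lemma nrV y : y \isn't Num.real -> y^-1 \isn't Num.real.
Proof. by rewrite realV. Qed.

Lemma modrel (a b k r : C) : a - b = k * r -> r = 0 -> a = b.
Proof. by move=> E r0; apply/eqP; rewrite -subr_eq0 E r0 mulr0. Qed.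

Local Notation has_node k01 k02 k12 k22 := (exists x0 sg : C, is_node k01 k02 k12 k22 x0 sg).

(** In the seven cases the critical point equation [x^2 step_a(x) = step_c(x)] simplifies to
    [x^4 + x^3 = 1] (first and fifth), [x^4 = x + 1] (second and sixth), [x^3 = x + 1] (third and
    seventh) and [x^3 = 1] (fourth). Nonreality of [sg + sg^-1] is checked in the basis [1, y] (or
    [1, x]) over the reals. *)
Lemma node1 : has_node 0 0 1 1.
Proof.
have [u [v [y [[ur vr yn y2] [[y4 uv u0 puv] [f1 f2 f3 f4]]]]]] := quartic_root.
have y0 := nr_neq0 yn; pose x := y^-1.
have r0 : x ^+ 4 + x ^+ 3 - 1 = 0.
  have -> : x ^+ 4 + x ^+ 3 - 1 = (1 + y - y ^+ 4) / y ^+ 4 by rewrite /x; field.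
  by rewrite y4 [1 + y]addrC subrr mul0r.
have x3n : x ^+ 3 \isn't Num.real.
  rewrite /x exprVn; apply: nrV.
  rewrite (_ : y ^+ 3 = u * v + (u ^+ 2 - v) * y); first by apply: nr_affine => //; real_tac.
  by rewrite exprS y2 mulrBr mulrCA -expr2 y2; ring.
exists x; apply: (@mk_node _ _ _ _ _ _ (x ^+ 3 - 2)).
- by rewrite invr_eq0.
- rewrite (_ : step_sum 0 0 1 1 x x = 2 + 1 * x ^+ 3); last by apply: (modrel (k := 1) _ r0); rewrite /step_sum; ring.
  by apply: nr_neq0; apply: nr_affine => //; rewrite ?oner_neq0 //; real_tac.
- rewrite (_ : step_a 0 1 1 x = (y + 1) / y ^+ 2); last by rewrite /step_a /x; field.
  by rewrite mulf_neq0 ?invr_eq0 ?expf_neq0 // -y4 expf_neq0.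
- by apply: (modrel (k := 1) _ r0); rewrite /step_a /step_c; ring.
- by apply: (modrel (k := x ^+ 3 + 1) _ r0); rewrite /step_a /step_sum; ring.
- rewrite (_ : x ^+ 3 - 2 = - 2 + 1 * x ^+ 3); last by ring.
  by apply: nr_affine => //; rewrite ?oner_neq0 //; real_tac.
- rewrite /x exprVn; apply: nrV; rewrite y2 addrC.
  by apply: nr_affine; rewrite ?oppr_eq0 //; real_tac.
Qed.

Lemma node2 : has_node 1 0 0 1.
Proof.
have [u [v [x [[ur vr xn x2] [[x4 uv u0 puv] [f1 f2 f3 f4]]]]]] := quartic_root.
have x0 := nr_neq0 xn.
have r0 : x ^+ 4 - x - 1 = 0 by rewrite x4; ring.
have xn1 : 1 + 1 * x \isn't Num.real.
  by apply: nr_affine => //; rewrite ?oner_neq0 //; real_tac.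
have hS : x ^+ 2 * step_a 0 0 1 x = step_c 1 0 x by apply: (modrel (k := 1) _ r0); rewrite /step_a /step_c; ring.
exists x; apply: (@mk_node _ _ _ _ _ _ (- 1 + (- 1) * (1 + 1 * x)^-1)) => //.
- rewrite (_ : step_sum 1 0 0 1 x x = 2 + 3 * x); last by apply: (modrel (k := 1) _ r0); rewrite /step_sum; ring.
  by apply: nr_neq0; apply: nr_affine => //; rewrite ?pnatr_eq0 //; real_tac.
- by rewrite /step_a !mul0r !add0r mul1r expf_neq0.
- rewrite hS; apply: (modrel (k := 3) _ r0); rewrite /step_c /step_sum; field.
  by have := nr_neq0 xn1; rewrite mul1r.
- by apply: (nr_affine (nrV xn1)); rewrite ?oppr_eq0 ?oner_neq0 //; real_tac.
- by rewrite x2 addrC; apply: nr_affine; rewrite ?oppr_eq0 //; real_tac.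
Qed.

Lemma node3 : has_node 1 0 1 0.
Proof.
have [th [x [[tr xn x2] [x3 t0 t2 tt]]]] := cubic_nonreal_root.
have x0 := nr_neq0 xn.
have r0 : x ^+ 3 - x - 1 = 0 by rewrite x3; ring.
have xn1 : 1 + 1 * x \isn't Num.real.
  by apply: nr_affine => //; rewrite ?oner_neq0 //; real_tac.
have hS : x ^+ 2 * step_a 0 1 0 x = step_c 1 0 x by apply: (modrel (k := 1) _ r0); rewrite /step_a /step_c; ring.
exists x; apply: (@mk_node _ _ _ _ _ _ (0 + (- 1) * (1 + 1 * x)^-1)) => //.
- rewrite (_ : step_sum 1 0 1 0 x x = 3 + 4 * x); last by apply: (modrel (k := 2) _ r0); rewrite /step_sum; ring.
  by apply: nr_neq0; apply: nr_affine => //; rewrite ?pnatr_eq0 //; real_tac.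
- by rewrite /step_a mul0r addr0 add0r mul1r.
- rewrite hS; apply: (modrel (k := 2) _ r0); rewrite /step_c /step_sum; field.
  by have := nr_neq0 xn1; rewrite mul1r.
- by apply: (nr_affine (nrV xn1)); rewrite ?oppr_eq0 ?oner_neq0 //; real_tac.
- by rewrite x2 addrC; apply: nr_affine; rewrite ?oppr_eq0 //; real_tac.
Qed.

Lemma node4 : has_node 0 1 1 0.
Proof.
have [|x x2 xn] := @nonreal_root C 1 1 (real1 _).
  by rewrite expr1n mulr1 -opprB oppr_lt0 subr_gt0 ltr1n.
have x0 := nr_neq0 xn.
have r0 : x ^+ 2 + x + 1 = 0 by rewrite x2; ring.
have hS : x ^+ 2 * step_a 1 1 0 x = step_c 0 1 x by apply: (modrel (k := x - 1) _ r0); rewrite /step_a /step_c; ring.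
exists x; apply: (@mk_node _ _ _ _ _ _ (2 + 3 * x^-1)) => //.
- rewrite (_ : step_sum 0 1 1 0 x x = 1 + (- 2) * x); last by apply: (modrel (k := 2 * x) _ r0); rewrite /step_sum; ring.
  by apply: nr_neq0; apply: nr_affine => //; rewrite ?oppr_eq0 ?pnatr_eq0 //; real_tac.
- rewrite (_ : step_a 1 1 0 x = 1 + 1 * x); last by rewrite /step_a; ring.
  by apply: nr_neq0; apply: nr_affine => //; rewrite ?oner_neq0 //; real_tac.
- rewrite hS; apply: (modrel (k := 2 * x - 2 + 3 * x^-1) _ r0); rewrite /step_c /step_sum; field.
  by [].
- by apply: (nr_affine (nrV xn)); rewrite ?pnatr_eq0 //; real_tac.
- by rewrite x2 addrC; apply: nr_affine; rewrite ?oppr_eq0 ?oner_neq0 //; real_tac.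
Qed.

Lemma node5 : has_node 0 1 1 1.
Proof.
have [u [v [y [[ur vr yn y2] [[y4 uv u0 puv] [f1 f2 f3 f4]]]]]] := quartic_root.
have y0 := nr_neq0 yn; pose x := y^-1.
have r0 : x ^+ 4 + x ^+ 3 - 1 = 0.
  have -> : x ^+ 4 + x ^+ 3 - 1 = (1 + y - y ^+ 4) / y ^+ 4 by rewrite /x; field.
  by rewrite y4 [1 + y]addrC subrr mul0r.
have y3 : y ^+ 3 = u * v + (u ^+ 2 - v) * y.
  by rewrite exprS y2 mulrBr mulrCA -expr2 y2; ring.
have x0 : x != 0 by rewrite invr_eq0.
have hS : x ^+ 2 * step_a 1 1 1 x = step_c 0 1 x by apply: (modrel (k := 1) _ r0); rewrite /step_a /step_c; ring.
have Sa0 : step_a 1 1 1 x != 0.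
  rewrite (_ : step_a 1 1 1 x = (1 + y + y ^+ 2) / y ^+ 2); last by rewrite /step_a /x; field.
  rewrite mulf_neq0 ?invr_eq0 ?expf_neq0 //.
  rewrite (_ : 1 + y + y ^+ 2 = (1 - v) + (1 - u) * y); last by rewrite y2; ring.
  by apply: nr_neq0; apply: nr_affine => //; real_tac.
have Sc0 : step_c 0 1 x != 0 by rewrite -hS mulf_neq0 ?expf_neq0.
exists x; apply: (@mk_node _ _ _ _ _ _ ((- 2 + 2 * x ^+ 2 + x ^+ 3) / step_c 0 1 x)) => //.
- rewrite (_ : step_sum 0 1 1 1 x x = 2 + 2 * x ^+ 2 + x ^+ 3); last by apply: (modrel (k := 1) _ r0); rewrite /step_sum; ring.
  rewrite (_ : 2 + 2 * x ^+ 2 + x ^+ 3 = (1 + 2 * y + 2 * y ^+ 3) / y ^+ 3); last by rewrite /x; field.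
  rewrite mulf_neq0 ?invr_eq0 ?expf_neq0 //; apply/negP => /eqP.
  rewrite y3 (_ : 1 + 2 * y + _ = (1 + 2 * (u * v)) + (2 + 2 * (u ^+ 2 - v)) * y); last by ring.
  move=> E; have [||h1 h2] := nonreal_lin yn _ _ E; [real_tac|real_tac|].
  case/eqP: f1.
  have h3 : 2 * v = 2 + 2 * u ^+ 2 by apply/eqP; rewrite eq_sym -subr_eq0 -h2; apply/eqP; ring.
  have h4 : u ^+ 3 = - 2.
    by apply/eqP; rewrite -subr_eq0 -[X in _ == X]h1 mulrA uv; apply/eqP; ring.
  have h5 : 2 * (u * v) = 2 * u + 2 * u ^+ 3.
    by rewrite mulrCA h3; ring.
  rewrite -[RHS]oppr0 -h1 h5 h4; ring.
- rewrite hS divfK //; apply: (modrel (k := 3) _ r0); rewrite /step_sum; ring.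
- apply/negP => H.
  pose r := (- 2 + 2 * x ^+ 2 + x ^+ 3) / step_c 0 1 x.
  have E : (1 - 2 * (u * v) - r * (u * v)) + (2 - 2 * (u ^+ 2 - v) - r * (u ^+ 2 - v + 1)) * y = 0.
    transitivity (y ^+ 3 * ((- 2 + 2 * x ^+ 2 + x ^+ 3) - r * step_c 0 1 x)).
      transitivity (- 2 * y ^+ 3 + 2 * y + 1 - r * (y ^+ 3 + y)).
        by rewrite y3; ring.
      by rewrite /step_c /x; field.
    by rewrite /r divfK // subrr mulr0.
  have [||h1 h2] := nonreal_lin yn _ _ E; [real_tac|real_tac|].
  case/eqP: f4.
  have : (2 - 2 * (u ^+ 2 - v)) * (u * v) - (1 - 2 * (u * v)) * (u ^+ 2 - v + 1) = 0.
    transitivity ((2 - 2 * (u ^+ 2 - v) - r * (u ^+ 2 - v + 1)) * (u * v)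
      - (1 - 2 * (u * v) - r * (u * v)) * (u ^+ 2 - v + 1)); first by ring.
    by rewrite h1 h2 !mul0r subrr.
  rewrite (_ : _ - _ = 2 * (2 * u * v) - (u ^+ 2 - v + 1)); last by ring.
  rewrite uv => h; rewrite -[LHS]opprK -[RHS]oppr0 -h; ring.
- rewrite /x exprVn; apply: nrV; rewrite y2 addrC.
  by apply: nr_affine; rewrite ?oppr_eq0 //; real_tac.
Qed.

Lemma node6 : has_node 1 1 0 1.
Proof.
have [u [v [x [[ur vr xn x2] [[x4 uv u0 puv] [f1 f2 f3 f4]]]]]] := quartic_root.
have x0 := nr_neq0 xn.
have r0 : x ^+ 4 - x - 1 = 0 by rewrite x4; ring.
have hS : x ^+ 2 * step_a 1 0 1 x = step_c 1 1 x by apply: (modrel (k := 1) _ r0); rewrite /step_a /step_c; ring.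
have Sa0 : step_a 1 0 1 x != 0.
  rewrite (_ : step_a 1 0 1 x = (1 - v) + (- u) * x); last by rewrite /step_a x2; ring.
  by apply: nr_neq0; apply: nr_affine; rewrite ?oppr_eq0 //; real_tac.
have Sc0 : step_c 1 1 x != 0 by rewrite -hS mulf_neq0 ?expf_neq0.
exists x; apply: (@mk_node _ _ _ _ _ _ ((- 2 - x + 2 * x ^+ 2) / step_c 1 1 x)) => //.
- rewrite (_ : step_sum 1 1 0 1 x x = (2 - 2 * v) + (3 - 2 * u) * x); last first.
    rewrite (_ : step_sum 1 1 0 1 x x = 2 + 3 * x + 2 * x ^+ 2); last by apply: (modrel (k := 1) _ r0); rewrite /step_sum; ring.
    by rewrite x2; ring.
  by apply: nr_neq0; apply: nr_affine => //; real_tac.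
- rewrite hS divfK //; apply: (modrel (k := 3) _ r0); rewrite /step_sum; ring.
- apply/negP => H.
  pose r := (- 2 - x + 2 * x ^+ 2) / step_c 1 1 x.
  have E : (- 2 - 2 * v - r * (1 - v)) + (- (1 + 2 * u) - r * (1 - u)) * x = 0.
    transitivity ((- 2 - x + 2 * x ^+ 2) - r * step_c 1 1 x).
      by rewrite /step_c x2; ring.
    by rewrite /r divfK // subrr.
  have [||h1 h2] := nonreal_lin xn _ _ E; [real_tac|real_tac|].
  case/eqP: f3.
  have : (- (1 + 2 * u) - r * (1 - u)) * (1 - v) - (- 2 - 2 * v - r * (1 - v)) * (1 - u) = 0.
    by rewrite h1 h2 !mul0r subrr.
  by move=> h; rewrite -[RHS]h; ring.
- by rewrite x2 addrC; apply: nr_affine; rewrite ?oppr_eq0 //; real_tac.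
Qed.

Lemma node7 : has_node 1 1 1 0.
Proof.
have [th [x [[tr xn x2] [x3 t0 t2 tt]]]] := cubic_nonreal_root.
have x0 := nr_neq0 xn.
have r0 : x ^+ 3 - x - 1 = 0 by rewrite x3; ring.
have hS : x ^+ 2 * step_a 1 1 0 x = step_c 1 1 x by apply: (modrel (k := 1) _ r0); rewrite /step_a /step_c; ring.
have Sa0 : step_a 1 1 0 x != 0.
  rewrite (_ : step_a 1 1 0 x = 1 + 1 * x); last by rewrite /step_a; ring.
  by apply: nr_neq0; apply: nr_affine; rewrite ?oner_neq0 //; real_tac.
have Sc0 : step_c 1 1 x != 0 by rewrite -hS mulf_neq0 ?expf_neq0.
exists x; apply: (@mk_node _ _ _ _ _ _ ((- 1 + 2 * x ^+ 2) / step_c 1 1 x)) => //.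
- rewrite (_ : step_sum 1 1 1 0 x x = (5 - 2 * th ^+ 2) + 2 * (2 - th) * x); last first.
    rewrite (_ : step_sum 1 1 1 0 x x = 3 + 4 * x + 2 * x ^+ 2); last by apply: (modrel (k := 2) _ r0); rewrite /step_sum; ring.
    by rewrite x2; ring.
  apply: nr_neq0; apply: nr_affine => //; last by rewrite mulf_neq0 ?pnatr_eq0.
    by real_tac.
  by real_tac.
- rewrite hS divfK //; apply: (modrel (k := 2) _ r0); rewrite /step_sum; ring.
- apply/negP => H.
  pose r := (- 1 + 2 * x ^+ 2) / step_c 1 1 x.
  have E : (1 - 2 * th ^+ 2 - r * (2 - th ^+ 2)) + (- (2 * th) - r * (1 - th)) * x = 0.
    transitivity ((- 1 + 2 * x ^+ 2) - r * step_c 1 1 x).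
      by rewrite /step_c x2; ring.
    by rewrite /r divfK // subrr.
  have [||h1 h2] := nonreal_lin xn _ _ E; [real_tac|real_tac|].
  case/eqP: tt.
  have h : (1 - 2 * th ^+ 2 - r * (2 - th ^+ 2)) * (1 - th) - (- (2 * th) - r * (1 - th)) * (2 - th ^+ 2) = 0.
    by rewrite h1 h2 !mul0r subrr.
  rewrite -[RHS]oppr0 -h; ring.
- by rewrite x2 addrC; apply: nr_affine; rewrite ?oppr_eq0 //; real_tac.
Qed.

End SevenNodes.

(** * The holomorphic solution of the walk equation *)

(** The intervals of radius [2 * b / 2 ^+ d] around the partial sums are nested; the sum is the
    supremum of their lower ends. *)
Lemma real_geometric_sum (R : realType) (u : nat -> R) (b : R) :
  (forall i, `|u i| <= b / 2 ^+ i) ->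
  exists l, forall d, `|l - \sum_(i < d) u i| <= 2 * b / 2 ^+ d.
Proof.
move=> ub; pose S d := \sum_(i < d) u i; pose e d := 2 * b / 2 ^+ d.
have eS d : e d = b / 2 ^+ d + e d.+1.
  by rewrite /e exprS; field; rewrite expf_neq0 ?pnatr_eq0.
have step d : `|S d.+1 - S d| <= e d - e d.+1.
  have -> : S d.+1 - S d = u d by rewrite /S big_ord_recr /= addrAC subrr add0r.
  by rewrite eS addrK; apply: ub.
have inc d : S d - e d <= S d.+1 - e d.+1.
  by have := step d; rewrite ler_norml => /andP[]; lra.
have dec d : S d.+1 + e d.+1 <= S d + e d.
  by have := step d; rewrite ler_norml => /andP[]; lra.
have incn d k : S d - e d <= S (d + k)%N - e (d + k)%N.
  by elim: k => [|k IH]; rewrite ?addn0 // addnS (le_trans IH).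
have decn d k : S (d + k)%N + e (d + k)%N <= S d + e d.
  by elim: k => [|k IH]; rewrite ?addn0 // addnS (le_trans (dec _)).
have e0 d : 0 <= e d.
  have b0 : 0 <= b by have := ub 0%N; rewrite expr0 divr1; apply: le_trans.
  by rewrite /e !mulr_ge0 ?invr_ge0 ?exprn_ge0.
have key m n : S m - e m <= S n + e n.
  apply: (le_trans (incn m n)); rewrite addnC; apply: le_trans (decn n m).
  by have := e0 (n + m)%N; lra.
pose A : set R := [set x | exists m, x = S m - e m]%classic.
have A0 : (A !=set0)%classic by exists (S 0%N - e 0%N), 0%N.
have Aub n : ubound A (S n + e n) by move=> x [m ->]; apply: key.
have supA : has_sup A by split => //; exists (S 0%N + e 0%N); apply: Aub.
exists (sup A) => d; rewrite -/(S d) -/(e d) ler_norml.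
have h1 : sup A <= S d + e d by apply: ge_sup.
have h2 : S d - e d <= sup A by apply: sup_upper_bound => //; exists d.
by apply/andP; split; lra.
Qed.

Section Sums.
Variable R : realType.
Local Notation C := (CC R).
Implicit Types (u v : nat -> C) (B c l : C).

Definition dominated B u : Prop := forall i, `|u i| <= B / 2 ^+ i.
Definition gconv u l : Prop :=
  exists B, forall d, `|l - \sum_(i < d) u i| <= B / 2 ^+ d.

Lemma dominated_ge0 B u : dominated B u -> 0 <= B.
Proof. by move=> /(_ 0%N); rewrite expr0 divr1; apply: le_trans. Qed.

Lemma geC0_real B : 0 <= B -> B = ((complex.Re B)%:C)%C :> C.
Proof. by move=> /ger0_real /RRe_real ->. Qed.

Lemma geometric_le (B e : C) : 0 <= B -> 0 < e ->
  exists N : nat, forall d, (N <= d)%N -> B / 2 ^+ d <= e.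
Proof.
move=> B0 e0; pose a := complex.Re e; pose b := complex.Re B.
have eE : e = (a%:C)%C by apply/geC0_real/ltW.
have BE : B = (b%:C)%C by apply: geC0_real.
have a0 : 0 < a by move: e0; rewrite eE ltcR.
have h : b / a < 2 ^+ Num.bound (b / a) by apply: upper_nthrootP.
exists (Num.bound (b / a)) => d Nd.
have hd : b / a < 2 ^+ d by apply: lt_le_trans h _; apply: ler_weXn2l Nd; rewrite ler1n.
have E : 2 ^+ d = ((2 ^+ d)%:C)%C :> C by rewrite rmorphXn /= rmorph_nat.
rewrite ler_pdivrMr ?exprn_gt0 // eE BE E -rmorphM /= lecR.
by rewrite mulrC -ler_pdivrMr // ltW.
Qed.

Lemma geometric_small (x B : C) : (forall d, `|x| <= B / 2 ^+ d) -> x = 0.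
Proof.
move=> H; apply/eqP; rewrite -normr_eq0; apply/negPn/negP => n0.
have B0 : 0 <= B by have := H 0%N; rewrite expr0 divr1; apply: le_trans.
have x0 : 0 < `|x| / 2 by rewrite divr_gt0 // lt_def n0 normr_ge0.
have [N /(_ N (leqnn N)) h] := geometric_le B0 x0.
have := le_trans (H N) h; rewrite ler_pdivlMr // -subr_le0.
have -> : `|x| * 2 - `|x| = `|x| by ring.
by rewrite normr_le0 -normr_eq0 (negPf n0).
Qed.

Lemma gconv_uniq u l l' : gconv u l -> gconv u l' -> l = l'.
Proof.
move=> [B HB] [B' HB']; apply/eqP; rewrite -subr_eq0; apply/eqP.
apply: (@geometric_small _ (B + B')) => d.
have -> : l - l' = (l - \sum_(i < d) u i) - (l' - \sum_(i < d) u i) by ring.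
apply: le_trans (ler_normB _ _) _.
by rewrite mulrDl lerD.
Qed.

Lemma gconv_exists B u : dominated B u ->
  exists l, forall d, `|l - \sum_(i < d) u i| <= 4 * B / 2 ^+ d.
Proof.
move=> ub; have B0 := dominated_ge0 ub; pose b := complex.Re B.
have BE : B = (b%:C)%C by apply: geC0_real.
have pE d : B / 2 ^+ d = ((b / 2 ^+ d)%:C)%C.
  by rewrite BE rmorphM fmorphV rmorphXn /= rmorph_nat.
have [|lr Hr] := @real_geometric_sum R (fun i => complex.Re (u i)) b.
  by move=> i; rewrite -lecR -pE; apply: le_trans (ub i); apply: normc_ge_Re.
have [|li Hi] := @real_geometric_sum R (fun i => complex.Im (u i)) b.
  move=> i; rewrite -lecR -pE; apply: le_trans (ub i).
  have := normc_ge_Re ('i%C * u i); rewrite normrM.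
  have -> : `|'i%C| = 1 :> C.
    by rewrite normc_def /= expr0n expr1n /= add0r sqrtr1.
  rewrite mul1r; case: (u i) => a c /=.
  by rewrite mul0r mul1r sub0r normrN.
exists (lr +i* li)%C => d.
have -> : (lr +i* li)%C - \sum_(i < d) u i =
   ((lr - \sum_(i < d) complex.Re (u i)) +i* (li - \sum_(i < d) complex.Im (u i)))%C :> C.
  by apply/eqP; rewrite eq_complex !raddfB !raddf_sum /= !eqxx.
set a := lr - _; set c := li - _.
have -> : (a +i* c)%C = (a%:C)%C + 'i%C * (c%:C)%C :> C.
  by apply/eqP; rewrite eq_complex /=; apply/andP; split; apply/eqP; ring.
apply: le_trans (ler_normD _ _) _; rewrite normrM.
have -> : `|'i%C| = 1 :> C.
  by rewrite normc_def /= expr0n expr1n /= add0r sqrtr1.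
have nE (x : R) : `|(x%:C)%C| = (`|x|%:C)%C :> C.
  by rewrite normc_def /= expr0n addr0 sqrtr_sqr.
have -> : 4 * B / 2 ^+ d = ((2 * b / 2 ^+ d)%:C)%C + ((2 * b / 2 ^+ d)%:C)%C.
  rewrite -rmorphD /= BE; have -> : 2 * b / 2 ^+ d + 2 * b / 2 ^+ d = 4 * b / 2 ^+ d by ring.
  by rewrite !rmorphM fmorphV rmorphXn /= !rmorph_nat.
by rewrite mul1r !nE lerD // lecR; [apply: Hr|apply: Hi].
Qed.

(** Makes summation a total function, with value 0 on sequences that do not converge
    geometrically. *)
Lemma tsum_subproof : {F : (nat -> C) -> C | forall u l, gconv u l -> F u = l}.
Proof.
exists (fun u => if pselect (exists l, gconv u l) is left h then projT1 (cid h) else 0).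
move=> u l Hl; case: pselect => [h|[]]; last by exists l.
by apply: gconv_uniq Hl; apply: (projT2 (cid h)).
Qed.

Definition tsum u : C := sval tsum_subproof u.

Lemma tsumE u l : gconv u l -> tsum u = l.
Proof. exact: (svalP tsum_subproof). Qed.

Lemma tsum_gconv B u : dominated B u ->
  forall d, `|tsum u - \sum_(i < d) u i| <= 4 * B / 2 ^+ d.
Proof.
by move=> /gconv_exists[l Hl]; rewrite (tsumE (l := l)) //; exists (4 * B).
Qed.

Lemma tsum_conv B u : dominated B u -> gconv u (tsum u).
Proof. by move=> h; exists (4 * B); apply: tsum_gconv. Qed.

Lemma tsum_le B u : dominated B u -> `|tsum u| <= 4 * B.
Proof. by move=> /tsum_gconv /(_ 0%N); rewrite big_ord0 subr0 expr0 divr1. Qed.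

Lemma eq_tsum u v : u =1 v -> tsum u = tsum v.
Proof. by move=> /funext ->. Qed.

Lemma tsumD B B' u v : dominated B u -> dominated B' v ->
  tsum (fun i => u i + v i) = tsum u + tsum v.
Proof.
move=> /tsum_conv[b Hu] /tsum_conv[b' Hv]; apply: tsumE; exists (b + b') => d.
rewrite big_split /=.
have -> : tsum u + tsum v - (\sum_(i < d) u i + \sum_(i < d) v i) =
  (tsum u - \sum_(i < d) u i) + (tsum v - \sum_(i < d) v i) by ring.
by apply: le_trans (ler_normD _ _) _; rewrite mulrDl lerD.
Qed.

Lemma tsumZ B c u : dominated B u -> tsum (fun i => c * u i) = c * tsum u.
Proof.
move=> /tsum_conv[b Hu]; apply: tsumE; exists (`|c| * b) => d.
by rewrite -mulr_sumr -mulrBr normrM -mulrA ler_wpM2l.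
Qed.

Lemma tsumS B u : dominated B u -> tsum u = u 0%N + tsum (fun i => u i.+1).
Proof.
move=> Hu; have [b Hb] := tsum_conv Hu.
rewrite (@tsumE (fun i => u i.+1) (tsum u - u 0%N)) ?subrKC //.
exists (b / 2) => d; have := Hb d.+1; rewrite big_ord_recl /= opprD addrA => h.
by apply: le_trans h _; rewrite exprS invfM mulrA.
Qed.

Lemma tsum0 u : (forall i, u i = 0) -> tsum u = 0.
Proof.
move=> u0; apply: tsumE; exists 0 => d.
by rewrite big1 ?subrr ?normr0 ?mul0r // => i _; rewrite u0.
Qed.

Lemma tsum_conj B u : dominated B u -> (tsum u)^* = tsum (fun i => (u i)^*).
Proof.
move=> /tsum_conv[b Hu]; apply/esym/tsumE; exists b => d.
by rewrite -rmorph_sum -rmorphB norm_conjC.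
Qed.

End Sums.

(** * Double series with geometric bounds *)

Section Arrays.
Variable R : realType.
Local Notation C := (CC R).
Local Notation arr := (nat -> nat -> C).
Implicit Types (a b : arr) (K x y rho : C).

Definition geo rho K a : Prop := forall i j, `|a i j| <= K * rho ^+ (i + j).
(** Terms then decay like [4^-i], faster than the [2^-i] of [dominated]; [triangle_sum] uses this
    margin. *)
Definition small rho x : Prop := `|x| * rho <= 4^-1.

Definition inner a (i : nat) y : C := tsum (fun j => a i j * y ^+ j).
Definition E2 a x y : C := tsum (fun i => x ^+ i * inner a i y).

Lemma geo_ge0 rho K a : geo rho K a -> 0 <= K.
Proof. by move=> /(_ 0%N 0%N); rewrite mulr1; apply: le_trans. Qed.

Lemma geoD rho K K' a b : geo rho K a -> geo rho K' b ->
  geo rho (K + K') (fun i j => a i j + b i j).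
Proof.
by move=> Ha Hb i j; apply: le_trans (ler_normD _ _) _; rewrite mulrDl lerD.
Qed.

Lemma geoZ rho K c a : geo rho K a -> geo rho (`|c| * K) (fun i j => c * a i j).
Proof. by move=> Ha i j; rewrite normrM -mulrA ler_wpM2l. Qed.

Lemma geo_le rho K K' a : 0 <= rho -> K <= K' -> geo rho K a -> geo rho K' a.
Proof.
by move=> r0 KK Ha i j; apply: le_trans (Ha i j) _; rewrite ler_wpM2r ?exprn_ge0.
Qed.

Definition sx a : arr := fun i j => if i is i'.+1 then a i' j else 0.
Definition sy a : arr := fun i j => if j is j'.+1 then a i j' else 0.

Lemma geo_sx rho K a : 1 <= rho -> geo rho K a -> geo rho K (sx a).
Proof.
move=> r1 Ha [|i] j; have K0 := geo_ge0 Ha; have r0 : 0 <= rho := le_trans ler01 r1.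
  by rewrite normr0 mulr_ge0 ?exprn_ge0.
apply: le_trans (Ha i j) _; rewrite ler_wpM2l // addSn exprS ler_peMl ?exprn_ge0 //.
Qed.

Lemma geo_sy rho K a : 1 <= rho -> geo rho K a -> geo rho K (sy a).
Proof.
move=> r1 Ha i [|j]; have K0 := geo_ge0 Ha; have r0 : 0 <= rho := le_trans ler01 r1.
  by rewrite normr0 mulr_ge0 ?exprn_ge0.
apply: le_trans (Ha i j) _; rewrite ler_wpM2l // addnS exprS ler_peMl ?exprn_ge0 //.
Qed.

Section Evaluation.
Variables (rho x y : C).
Hypothesis rho0 : 0 <= rho.
Hypothesis xs : small rho x.
Hypothesis ys : small rho y.

Lemma small_exp z n : small rho z -> `|z| ^+ n * rho ^+ n <= 1 / 2 ^+ n.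
Proof.
move=> zs; rewrite -exprMn div1r -exprVn.
apply: le_trans (_ : (4^-1) ^+ n <= _).
  by apply: lerXn2r => //; rewrite nnegrE ?mulr_ge0 ?invr_ge0.
apply: lerXn2r; rewrite ?nnegrE ?invr_ge0 //.
by rewrite lef_pV2 ?posrE // ler_nat.
Qed.

Lemma dom_term K (u : nat -> C) z : 0 <= K -> small rho z ->
  (forall i, `|u i| <= K * rho ^+ i) -> dominated K (fun i => u i * z ^+ i).
Proof.
move=> K0 zs Hu i; rewrite normrM normrX.
apply: (@le_trans _ _ (K * rho ^+ i * `|z| ^+ i)); first by rewrite ler_wpM2r ?exprn_ge0.
by rewrite -mulrA [rho ^+ i * _]mulrC ler_wpM2l //; have := small_exp i zs; rewrite div1r.
Qed.

Lemma inner_dom K a i : geo rho K a -> dominated (K * rho ^+ i) (fun j => a i j * y ^+ j).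
Proof.
move=> Ha; apply: dom_term => //.
  by rewrite mulr_ge0 ?exprn_ge0 // (geo_ge0 Ha).
by move=> j; rewrite -mulrA -exprD.
Qed.

Lemma outer_dom K a : geo rho K a -> dominated (4 * K) (fun i => x ^+ i * inner a i y).
Proof.
move=> Ha; suff h : dominated (4 * K) (fun i => inner a i y * x ^+ i).
  by move=> i; rewrite mulrC; apply: h.
apply: dom_term => //; first by rewrite mulr_ge0 // (geo_ge0 Ha).
by move=> j; rewrite -mulrA; exact: (tsum_le (inner_dom j Ha)).
Qed.

Lemma E2_le K a : geo rho K a -> `|E2 a x y| <= 16 * K.
Proof.
move=> Ha; apply: le_trans (tsum_le (outer_dom Ha)) _.
by rewrite mulrA -natrM.
Qed.

Lemma eq_E2 a b : (forall i j, a i j = b i j) -> E2 a x y = E2 b x y.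
Proof.
by move=> ab; have -> : a = b by apply/funext => i; apply/funext => j.
Qed.

Lemma E2D K K' a b : geo rho K a -> geo rho K' b ->
  E2 (fun i j => a i j + b i j) x y = E2 a x y + E2 b x y.
Proof.
move=> Ha Hb; rewrite /E2 -(tsumD (outer_dom Ha) (outer_dom Hb)).
apply: eq_tsum => i; rewrite -mulrDr /inner -(tsumD (inner_dom i Ha) (inner_dom i Hb)).
by congr (_ * _); apply: eq_tsum => j; rewrite mulrDl.
Qed.

Lemma E2Z K c a : geo rho K a -> E2 (fun i j => c * a i j) x y = c * E2 a x y.
Proof.
move=> Ha; rewrite /E2 -(tsumZ c (outer_dom Ha)); apply: eq_tsum => i.
rewrite mulrCA /inner -(tsumZ c (inner_dom i Ha)); congr (_ * _).
by apply: eq_tsum => j; rewrite mulrA.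
Qed.

Hypothesis rho1 : 1 <= rho.

Lemma E2_sx K a : geo rho K a -> E2 (sx a) x y = x * E2 a x y.
Proof.
move=> Ha; rewrite /E2 (tsumS (outer_dom (geo_sx rho1 Ha))) mul1r.
rewrite (_ : inner (sx a) 0 y = 0) ?add0r; last by apply: tsum0 => j; rewrite /= mul0r.
rewrite -(tsumZ x (outer_dom Ha)); apply: eq_tsum => i.
by rewrite exprS mulrA.
Qed.

Lemma E2_sy K a : geo rho K a -> E2 (sy a) x y = y * E2 a x y.
Proof.
move=> Ha; rewrite /E2 -(tsumZ y (outer_dom Ha)); apply: eq_tsum => i.
rewrite mulrCA; congr (_ * _).
rewrite /inner (tsumS (inner_dom i (geo_sy rho1 Ha))) mul0r add0r.
rewrite -(tsumZ y (inner_dom i Ha)); apply: eq_tsum => j.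
by rewrite exprS /=; ring.
Qed.

Definition shift a : arr := fun i j => a i.+1 j.+1.

Lemma geo_shift K a : geo rho K a -> geo rho (K * rho ^+ 2) (shift a).
Proof.
by move=> Ha i j; have := Ha i.+1 j.+1; rewrite addSn addnS -mulrA -exprD.
Qed.

Lemma E2_split K a : geo rho K a -> E2 a x y =
  tsum (fun i => a i 0%N * x ^+ i) + tsum (fun j => a 0%N j * y ^+ j) - a 0%N 0%N
  + x * y * E2 (shift a) x y.
Proof.
move=> Ha; have K0 := geo_ge0 Ha.
pose b : arr := fun i j => a i.+1 j.
have Hb : geo rho (K * rho) b by move=> i j; have := Ha i.+1 j; rewrite addSn exprS mulrA.
have in_b i : inner b i y = b i 0%N + y * inner (shift a) i y.
  rewrite /inner (tsumS (inner_dom i Hb)) mulr1; congr (_ + _).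
  rewrite -(tsumZ y (inner_dom i (geo_shift Ha))); apply: eq_tsum => j.
  by rewrite exprS /b /shift; ring.
have col : dominated K (fun i => a i 0%N * x ^+ i).
  by apply: dom_term => // i; have := Ha i 0%N; rewrite addn0.
have colb : dominated (K * rho) (fun i => b i 0%N * x ^+ i).
  by apply: dom_term => //; [rewrite mulr_ge0|move=> i; have := Hb i 0%N; rewrite addn0].
rewrite {1}/E2 (tsumS (outer_dom Ha)) mul1r -/(inner a 0 y) (tsumS col) mulr1.
have -> : tsum (fun i => x ^+ i.+1 * inner a i.+1 y) = x * (tsum (fun i => b i 0%N * x ^+ i)
    + y * E2 (shift a) x y).
  rewrite /E2 -(tsumZ y (outer_dom (geo_shift Ha))).
  have d1 := outer_dom (geo_shift Ha).
  have d2 : dominated (`|y| * (4 * (K * rho ^+ 2))) (fun i => y * (x ^+ i * inner (shift a) i y)).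
    by move=> i; rewrite normrM -mulrA ler_wpM2l.
  rewrite -(tsumD colb d2).
  have d3 : dominated (4 * (K * rho)) (fun i => x ^+ i * inner b i y) := outer_dom Hb.
  rewrite (@eq_tsum _ _ (fun i => x * (x ^+ i * inner b i y))); last first.
    by move=> i; rewrite exprS mulrA.
  rewrite (tsumZ x d3); congr (_ * _); apply: eq_tsum => i.
  by rewrite in_b; ring.
have -> : tsum (fun i => a i.+1 0%N * x ^+ i.+1) = x * tsum (fun i => b i 0%N * x ^+ i).
  rewrite -(tsumZ x colb); apply: eq_tsum => i; rewrite exprS /b; ring.
rewrite /inner; ring.
Qed.

Variables k01 k02 k12 k22 : nat.

Definition step_conv a : arr := fun i j => a i j + (k01%:R * (sx a i j + sy a i j)
  + (k02%:R * (sx (sx a) i j + sy (sy a) i j)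
  + (k12%:R * (sx (sx (sy a)) i j + sx (sy (sy a)) i j)
  + k22%:R * sx (sx (sy (sy a))) i j))).

Definition step_mass : C := 1 + (k01%:R * 2 + (k02%:R * 2 + (k12%:R * 2 + k22%:R))).

Lemma step_mass_ge1 : 1 <= step_mass.
Proof. by rewrite lerDl !addr_ge0 ?mulr_ge0. Qed.

Lemma geo_Sconv K a : geo rho K a -> geo rho (step_mass * K) (step_conv a).
Proof.
move=> Ha; have hx b : geo rho K b -> geo rho K (sx b) by apply: geo_sx.
have hy b : geo rho K b -> geo rho K (sy b) by apply: geo_sy.
have h2 (n : nat) b b' : geo rho K b -> geo rho K b' ->
   geo rho (`|n%:R : C| * (K + K)) (fun i j => n%:R * (b i j + b' i j)).
  by move=> H H'; apply: geoZ; apply: geoD.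
rewrite (_ : step_mass * K = K + (`|k01%:R : C| * (K + K) + (`|k02%:R : C| * (K + K) +
  (`|k12%:R : C| * (K + K) + `|k22%:R : C| * K)))); last by rewrite !normr_nat /step_mass; ring.
apply: geoD => //; apply: geoD; first by apply: h2; [apply: hx|apply: hy].
apply: geoD; first by apply: h2; [apply/hx/hx|apply/hy/hy].
apply: geoD; first by apply: h2; [apply/hx/hx/hy|apply/hx/hy/hy].
by apply: geoZ; apply/hx/hx/hy/hy.
Qed.

Lemma E2_Sconv K a : geo rho K a -> E2 (step_conv a) x y = step_sum k01 k02 k12 k22 x y * E2 a x y.
Proof.
move=> Ha; have hx b : geo rho K b -> geo rho K (sx b) by apply: geo_sx.
have hy b : geo rho K b -> geo rho K (sy b) by apply: geo_sy.
have h2 (n : nat) b b' : geo rho K b -> geo rho K b' ->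
   geo rho (`|n%:R : C| * (K + K)) (fun i j => n%:R * (b i j + b' i j)).
  by move=> H H'; apply: geoZ; apply: geoD.
have g1 := h2 k01 _ _ (hx _ Ha) (hy _ Ha).
have g2 := h2 k02 _ _ (hx _ (hx _ Ha)) (hy _ (hy _ Ha)).
have g3 := h2 k12 _ _ (hx _ (hx _ (hy _ Ha))) (hx _ (hy _ (hy _ Ha))).
have g4 := geoZ k22%:R (hx _ (hx _ (hy _ (hy _ Ha)))).
rewrite (E2D Ha (geoD g1 (geoD g2 (geoD g3 g4)))) (E2D g1 (geoD g2 (geoD g3 g4))).
rewrite (E2D g2 (geoD g3 g4)) (E2D g3 g4).
rewrite !(E2Z _ (geoD (hx _ Ha) (hy _ Ha)), E2Z _ (geoD (hx _ (hx _ Ha)) (hy _ (hy _ Ha))),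
  E2Z _ (geoD (hx _ (hx _ (hy _ Ha))) (hx _ (hy _ (hy _ Ha)))), E2Z _ (hx _ (hx _ (hy _ (hy _ Ha))))).
rewrite (E2D (hx _ Ha) (hy _ Ha)) (E2D (hx _ (hx _ Ha)) (hy _ (hy _ Ha))).
rewrite (E2D (hx _ (hx _ (hy _ Ha))) (hx _ (hy _ (hy _ Ha)))).
rewrite (E2_sx (hx _ (hy _ (hy _ Ha)))) (E2_sx (hx _ (hy _ Ha))) (E2_sx (hy _ (hy _ Ha))).
rewrite (E2_sx (hx _ Ha)) (E2_sx (hy _ Ha)) (E2_sx Ha) (E2_sy (hy _ Ha)) (E2_sy Ha).
by rewrite /step_sum; ring.
Qed.

End Evaluation.

End Arrays.

(** * Walks in the quarter plane *)

Section Walks.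
Variable R : realType.
Local Notation C := (CC R).
Local Notation arr := (nat -> nat -> C).
Variables k01 k02 k12 k22 : nat.
Local Notation Sconv := (@step_conv R k01 k02 k12 k22).
Local Notation c0 := (step_mass R k01 k02 k12 k22).
Local Notation St := (@step_sum C k01 k02 k12 k22).
Implicit Types (a : arr).

Lemma Sconv_sym a : (forall i j, a i j = a j i) -> forall i j, Sconv a i j = Sconv a j i.
Proof.
move=> sa [|[|i]] [|[|j]]; rewrite /step_conv /= ?(sa 0%N _) ?(sa 1%N _) ?(sa i.+2 _) ?(sa i.+1 _) ?(sa i _); ring.
Qed.

Lemma Sconv_conj a : (forall i j, (a i j)^* = a i j) -> forall i j, (Sconv a i j)^* = Sconv a i j.
Proof.
move=> ca i j; rewrite /step_conv !rmorphD !rmorphM !rmorphD !rmorph_nat /=.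
have cx (b : arr) : (forall i j, (b i j)^* = b i j) -> forall i j, (sx b i j)^* = sx b i j.
  by move=> cb [|i'] j' /=; rewrite ?conjC0 ?cb.
have cy (b : arr) : (forall i j, (b i j)^* = b i j) -> forall i j, (sy b i j)^* = sy b i j.
  by move=> cb i' [|j'] /=; rewrite ?conjC0 ?cb.
by rewrite ca !(cx _ ca) !(cy _ ca) !(cx _ (cx _ ca)) !(cy _ (cy _ ca)) !(cx _ (cx _ (cy _ ca)))
  !(cx _ (cy _ (cy _ ca))) !(cx _ (cx _ (cy _ (cy _ ca)))).
Qed.

Variable be : C.

Definition diag (b : C) : arr := fun i j => if i == j then b ^+ i.+1 else 0.
Definition pd : arr := fun i j => diag be i j + diag be^* i j.

(* [q n i j] counts the weighted walks of [n] steps in the quadrant ending at  *)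
(* [(i, j)], and [fa] the steps leaving it through the axis [j = 0].           *)
Fixpoint q n : arr := if n is n'.+1 then shift (Sconv (q n')) else shift pd.

Definition fa : arr := fun n i =>
  if n is n'.+1 then (if i == 0%N then Sconv (q n') 0%N 0%N / 2 else Sconv (q n') i 0%N)
  else (if i == 0%N then (be + be^*) / 2 else 0).

(** [r0] governs the growth in the endpoint. A step multiplies bounds by the total weight and the
    shift by [r0 ^+ 2], whence the ratio [r1] in the length. *)
Let r0 : C := 1 + `|be|.
Let r1 : C := c0 * r0 ^+ 2.
Let K : C := 2 * r0 * r0 ^+ 2.

Let r0_ge1 : 1 <= r0. Proof. by rewrite lerDl. Qed.
Let r0_ge0 : 0 <= r0. Proof. exact: le_trans r0_ge1. Qed.
Let c1 : 1 <= c0. Proof. exact: step_mass_ge1. Qed.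
Let c00 : 0 <= c0. Proof. exact: le_trans c1. Qed.
Let r01 : r0 <= r1.
Proof.
rewrite /r1 expr2 mulrA ler_peMl //.
by apply: le_trans r0_ge1 _; rewrite ler_peMl.
Qed.
Let r1_ge1 : 1 <= r1. Proof. exact: le_trans r01. Qed.
Let r1_ge0 : 0 <= r1. Proof. exact: le_trans r1_ge1. Qed.

Let K_ge0 : 0 <= K. Proof. by rewrite !mulr_ge0 ?exprn_ge0. Qed.

Lemma geo_diag b : `|b| <= r0 -> geo r0 r0 (diag b).
Proof.
move=> br i j; rewrite /diag; case: eqP => [<-|_]; last by rewrite normr0 mulr_ge0 ?exprn_ge0.
rewrite normrX -exprS; apply: (@le_trans _ _ (r0 ^+ i.+1)); first by apply: lerXn2r; rewrite ?nnegrE.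
by apply: ler_weXn2l => //; rewrite ltnS leq_addr.
Qed.

Let be_le : `|be| <= r0. Proof. by rewrite lerDr. Qed.
Let bec_le : `|be^*| <= r0. Proof. by rewrite norm_conjC. Qed.

Lemma geo_pd : geo r0 (2 * r0) pd.
Proof. by rewrite mulr_natl; apply: (geoD (geo_diag be_le) (geo_diag bec_le)). Qed.

Lemma geo_q n : geo r0 (K * r1 ^+ n) (q n).
Proof.
elim: n => [|n IH] /=; first by rewrite mulr1; apply: geo_shift geo_pd.
have -> : K * r1 ^+ n.+1 = c0 * (K * r1 ^+ n) * r0 ^+ 2 by rewrite exprS /r1; ring.
by apply/geo_shift/geo_Sconv.
Qed.

Lemma geo_fa : geo r1 K fa.
Proof.
have H n i : `|Sconv (q n) i 0%N| <= K * r1 ^+ (n.+1 + i).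
  have h := geo_Sconv r0_ge1 k01 k02 k12 k22 (geo_q n) i 0%N.
  apply: (le_trans h); rewrite addn0 exprD exprS.
  have -> : c0 * (K * r1 ^+ n) * r0 ^+ i = K * r1 ^+ n * (c0 * r0 ^+ i) by ring.
  have -> : K * (r1 * r1 ^+ n * r1 ^+ i) = K * r1 ^+ n * (r1 * r1 ^+ i) by ring.
  apply: ler_wpM2l; first by rewrite mulr_ge0 ?exprn_ge0.
  apply: ler_pM; rewrite ?exprn_ge0 //; last by apply: lerXn2r; rewrite ?nnegrE.
  by rewrite /r1 ler_peMr // exprn_ege1.
have half (z : C) : `|z / 2| <= `|z|.
  by rewrite normrM ler_piMr // normfV normr_nat invf_le1 ?ler1n.
move=> [|n] i /=; case: eqP => [->|_].
- apply: le_trans (half _) _; rewrite addn0 mulr1; apply: le_trans (ler_normD _ _) _.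
  rewrite norm_conjC -mulr2n -mulr_natl /K -mulrA ler_wpM2l //.
  by apply: le_trans be_le _; rewrite ler_peMr // exprn_ege1.
- by rewrite normr0 mulr_ge0 ?exprn_ge0.
- by apply: le_trans (half _) _; apply: H.
- exact: H.
Qed.

Lemma pd_conj i j : (pd i j)^* = pd i j.
Proof.
rewrite /pd /diag; case: eqP => _; last by rewrite !addr0 conjC0.
by rewrite rmorphD !rmorphXn /= conjCK addrC.
Qed.

Lemma q_conj n i j : (q n i j)^* = q n i j.
Proof.
elim: n i j => [|n IH] i j /=; first exact: pd_conj.
exact: Sconv_conj.
Qed.

Lemma q_sym n i j : q n i j = q n j i.
Proof.
elim: n i j => [|n IH] i j /=; last exact: Sconv_sym.
by rewrite /shift /pd /diag eq_sym; case: eqP => // /eqP; rewrite eqSS => /eqP ->.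
Qed.

Lemma fa_conj i j : (fa i j)^* = fa i j.
Proof.
case: i => [|n] /=; case: eqP => _.
- by rewrite rmorphM rmorphD /= conjCK addrC fmorphV rmorph_nat.
- exact: conjC0.
- by rewrite rmorphM /= fmorphV rmorph_nat (Sconv_conj (q_conj n)).
- exact: (Sconv_conj (q_conj n)).
Qed.

Section Evaluation.
Variables t x y : C.
Hypothesis ts : small r1 t.
Hypothesis xs : small r1 x.
Hypothesis ys : small r1 y.

Let small01 z : small r1 z -> small r0 z.
Proof. by apply: le_trans; rewrite ler_wpM2l. Qed.
Let xs0 := small01 xs.
Let ys0 := small01 ys.

Lemma tsum_head (u : nat -> C) c : u 0%N = c -> (forall i, u i.+1 = 0) -> tsum u = c.
Proof.
move=> u0 uS; rewrite (@tsumS _ `|c|); first by rewrite u0 tsum0 ?addr0.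
by move=> [|i]; rewrite ?u0 ?uS ?normr0 ?divr1 ?mulr_ge0 ?invr_ge0 ?exprn_ge0.
Qed.

Lemma E2_diag b : `|b| <= r0 -> E2 (diag b) x y * (1 - b * (x * y)) = b.
Proof.
move=> br; have := E2_split r0_ge0 xs0 ys0 (geo_diag br).
rewrite !(tsum_head (c := b)) ?mulr1 //; try by move=> i; rewrite mul0r.
have -> : E2 (shift (diag b)) x y = b * E2 (diag b) x y.
  rewrite -(E2Z r0_ge0 xs0 ys0 b (geo_diag br)); apply: eq_E2 => i j.
  by rewrite /shift /diag eqSS; case: eqP => _; rewrite ?mulr0 // exprS.
rewrite (_ : diag b 0%N 0%N = b) ?addrK => [E|]; last by rewrite /diag eqxx expr1.
by rewrite mulrBr mulr1 {1}E; ring.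
Qed.

Let U n := Sconv (q n).
Let gU n := geo_Sconv r0_ge1 k01 k02 k12 k22 (geo_q n).

(** [fa] contains half of the corner coefficient, so that each axis receives an equal share of
    it. *)
Lemma col_sum n z : small r0 z ->
  tsum (fun i => U n i 0%N * z ^+ i) = inner fa n.+1 z + U n 0%N 0%N / 2.
Proof.
move=> zs.
have K0 := geo_ge0 (gU n).
have d1 : dominated (c0 * (K * r1 ^+ n)) (fun i => U n i 0%N * z ^+ i).
  by apply: (dom_term r0_ge0) => // i; have := gU n i 0%N; rewrite addn0.
have d2 : dominated (c0 * (K * r1 ^+ n)) (fun i => fa n.+1 i * z ^+ i).
  apply: (dom_term r0_ge0) => // i; have := gU n i 0%N; rewrite addn0.
  rewrite /fa; case: eqP => [->|//]; apply: le_trans.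
  by rewrite normrM ler_piMr // normfV normr_nat invf_le1 ?ler1n.
by rewrite /inner (tsumS d1) (tsumS d2) !mulr1 /= -/(U n); field.
Qed.

Lemma St_q n : St x y * E2 (q n) x y =
  inner fa n.+1 x + inner fa n.+1 y + x * y * E2 (q n.+1) x y.
Proof.
rewrite -(E2_Sconv r0_ge0 xs0 ys0 r0_ge1 k01 k02 k12 k22 (geo_q n)).
rewrite (E2_split r0_ge0 xs0 ys0 (gU n)) (col_sum _ xs0).
rewrite (_ : tsum _ = inner fa n.+1 y + U n 0%N 0%N / 2); last first.
  rewrite -(col_sum _ ys0); apply: eq_tsum => j.
  by rewrite /U (Sconv_sym (q_sym n)).
by rewrite -/(U n) /=; field.
Qed.

Lemma E2_pd : E2 pd x y = be + be^* + x * y * E2 (q 0) x y.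
Proof.
rewrite (E2_split r0_ge0 xs0 ys0 geo_pd) !(tsum_head (c := be + be^*)) ?mulr1 //;
  try by move=> i; rewrite /pd /diag /= addr0 mul0r.
by rewrite (_ : pd 0%N 0%N = be + be^*) ?addrK // /pd /diag eqxx !expr1.
Qed.

(** The kernel method. Let [Q] be the generating series of the [q n] in [t]; summing [St_q] over [n]
    gives [t S Q] as the two boundary series, minus their constants, plus [x y (Q - q_0)]. When
    [x y = t S] the unknown [Q] drops out. *)
Theorem walk_equation : x * y = t * St x y ->
  E2 fa t x + E2 fa t y = E2 (diag be) x y + E2 (diag be^*) x y.
Proof.
move=> E.
transitivity (E2 pd x y); last first.
  exact: (E2D r0_ge0 xs0 ys0 (geo_diag be_le) (geo_diag bec_le)).
rewrite [RHS]E2_pd.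
have r1r := r1_ge0.
have dq : dominated (16 * K) (fun n => t ^+ n * E2 (q n) x y).
  suff h : dominated (16 * K) (fun n => E2 (q n) x y * t ^+ n).
    by move=> n; rewrite mulrC; apply: h.
  apply: (dom_term r1r) => // [|n]; first by rewrite mulr_ge0.
  by rewrite -mulrA; apply: E2_le (geo_q n).
pose Q := tsum (fun n => t ^+ n * E2 (q n) x y).
have fx := outer_dom r1r ts xs geo_fa; have fy := outer_dom r1r ts ys geo_fa.
have sh (u : nat -> C) B : dominated B u -> dominated B (fun n => u n.+1).
  move=> Hu n; apply: le_trans (Hu n.+1) _.
  rewrite ler_wpM2l ?(dominated_ge0 Hu) // lef_pV2 ?posrE ?exprn_gt0 //.
  by apply: ler_weXn2l => //; rewrite ler1n.
have i0 z : inner fa 0 z = (be + be^*) / 2.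
  by apply: tsum_head => [|i]; rewrite ?mulr1 //= mul0r.
have E1 : t * St x y * Q = (E2 fa t x - (be + be^*) / 2) + (E2 fa t y - (be + be^*) / 2)
    + x * y * (Q - E2 (q 0) x y).
  rewrite /E2 (tsumS fx) (tsumS fy) !mul1r !i0.
  rewrite -/(E2 (q 0) x y) {2}/Q (tsumS dq) mul1r.
  have -> (a b : C) : a + b - a = b by rewrite addrC addKr.
  have -> (a b : C) : a + b - a = b by rewrite addrC addKr.
  have -> (a b : C) : a + b - a = b by rewrite addrC addKr.
  have d3 : dominated (`|x * y| * (16 * K)) (fun n => x * y * (t ^+ n.+1 * E2 (q n.+1) x y)).
    by move=> n; rewrite normrM -mulrA ler_wpM2l //; apply: (sh _ _ dq).
  rewrite -(tsumZ (x * y) (sh _ _ dq)) -(tsumD (sh _ _ fx) (sh _ _ fy)).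
  have d4 : dominated (4 * K + 4 * K) (fun n => t ^+ n.+1 * inner fa n.+1 x + t ^+ n.+1 * inner fa n.+1 y).
    move=> n; apply: le_trans (ler_normD _ _) _.
    by rewrite mulrDl lerD //; [apply: (sh _ _ fx)|apply: (sh _ _ fy)].
  rewrite -(tsumD d4 d3) -(tsumZ _ dq); apply: eq_tsum => n.
  have -> : t * St x y * (t ^+ n * E2 (q n) x y) = t ^+ n.+1 * (St x y * E2 (q n) x y).
    by rewrite exprS; ring.
  by rewrite St_q; ring.
rewrite -E in E1.
apply/eqP; rewrite -subr_eq0; apply/eqP.
transitivity ((E2 fa t x - (be + be^*) / 2) + (E2 fa t y - (be + be^*) / 2)
    + x * y * (Q - E2 (q 0) x y) - x * y * Q); first by field.
by rewrite -E1 subrr.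
Qed.

End Evaluation.

Theorem walk_solution (al : C) : al * be = 1 ->
  exists rho K (a : arr), [/\ 1 <= rho, geo rho K a, forall i j, (a i j)^* = a i j &
   forall t x y, small rho t -> small rho x -> small rho y -> x * y = t * St x y ->
    (al - x * y) * (al^* - x * y) * (E2 a t x + E2 a t y) = al + al^* - 2 * (x * y)].
Proof.
move=> ab; exists r1, K, fa; split; [exact: r1_ge1|exact: geo_fa|exact: fa_conj|].
move=> t x y ts xs ys E; rewrite (walk_equation ts xs ys E).
have H1 := E2_diag xs ys be_le; have H2 := E2_diag xs ys bec_le.
have abc : al^* * be^* = 1 by rewrite -rmorphM ab rmorph1.
have h b c : c * b = 1 -> E2 (diag b) x y * (1 - b * (x * y)) = b ->
    (c - x * y) * E2 (diag b) x y = 1.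
  move=> cb H; have -> : (c - x * y) * E2 (diag b) x y =
      c * (E2 (diag b) x y * (1 - b * (x * y))) + (c * b - 1) * (x * y * E2 (diag b) x y).
    by ring.
  by rewrite H cb subrr mul0r addr0.
have e1 := h _ _ ab H1; have e2 := h _ _ abc H2.
transitivity ((al^* - x * y) * ((al - x * y) * E2 (diag be) x y)
  + (al - x * y) * ((al^* - x * y) * E2 (diag be^*) x y)); first by ring.
by rewrite e1 e2; ring.
Qed.

End Walks.

(** * Expansion of the graph of the surface *)

Section Inverse.
Variable R : realType.
Local Notation C := (CC R).
Local Notation arr := (nat -> nat -> C).
Variables k01 k02 k12 k22 : nat.
Local Notation Sconv := (@step_conv R k01 k02 k12 k22).
Local Notation c0 := (step_mass R k01 k02 k12 k22).
Local Notation St := (@step_sum C k01 k02 k12 k22).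
Implicit Types (a b : arr).

Definition agree (n : nat) a b : Prop := forall i j, (i + j < n)%N -> a i j = b i j.

Lemma agree_le (m n : nat) a b : (m <= n)%N -> agree n a b -> agree m a b.
Proof. by move=> mn H i j lt; apply: H; apply: leq_trans lt mn. Qed.

Lemma agree_sx n a b : agree n a b -> agree n.+1 (sx a) (sx b).
Proof. by move=> H [|i] j //= lt; apply: H. Qed.

Lemma agree_sy n a b : agree n a b -> agree n.+1 (sy a) (sy b).
Proof. by move=> H i [|j] //= lt; apply: H; rewrite addnS in lt. Qed.

(* [Sconv] minus the identity strictly raises degrees. *)
Definition Dconv a : arr := fun i j => k01%:R * (sx a i j + sy a i j)
  + (k02%:R * (sx (sx a) i j + sy (sy a) i j)
  + (k12%:R * (sx (sx (sy a)) i j + sx (sy (sy a)) i j)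
  + k22%:R * sx (sx (sy (sy a))) i j)).

Lemma SconvE a i j : Sconv a i j = a i j + Dconv a i j.
Proof. by []. Qed.

Lemma agree_Dconv n a b : agree n a b -> agree n.+1 (Dconv a) (Dconv b).
Proof.
move=> H; have hx := agree_sx H; have hy := agree_sy H.
have w c d : agree n.+2 c d -> agree n.+1 c d by apply: agree_le.
have hxx := w _ _ (agree_sx hx); have hyy := w _ _ (agree_sy hy).
have hxy := w _ _ (agree_sx hy).
have hxxy := w _ _ (agree_sx (w _ _ (agree_sx hy))).
have hxyy := w _ _ (agree_sx hyy).
have hxxyy := w _ _ (agree_sx hxyy).
by move=> i j lt; rewrite /Dconv hx // hy // hxx // hyy // hxxy // hxyy // hxxyy.
Qed.

Lemma Dconv0 i j : Dconv (fun _ _ => 0) i j = 0.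
Proof.
have e : sx (fun _ _ => 0) = (fun _ _ => 0) :> arr by apply/funext => -[|?]; apply/funext.
have e' : sy (fun _ _ => 0) = (fun _ _ => 0) :> arr.
  by apply/funext => ?; apply/funext => -[|?].
by rewrite /Dconv !(e, e') !addr0 !mulr0 !addr0.
Qed.

Let rho : C := 2 * c0.
Let c1 : 1 <= c0. Proof. exact: step_mass_ge1. Qed.
Let c0p : 0 < c0. Proof. exact: lt_le_trans ltr01 c1. Qed.
Let rho1 : 1 <= rho. Proof. by rewrite /rho mulr_ege1 // ler1n. Qed.
Let rhop : 0 < rho. Proof. exact: lt_le_trans ltr01 rho1. Qed.

Lemma geo_sx_gain K a : geo rho K a -> geo rho (K / rho) (sx a).
Proof.
move=> Ha [|i] j /=; first by rewrite normr0 !mulr_ge0 ?(geo_ge0 Ha) ?invr_ge0 ?exprn_ge0 // ltW.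
by apply: le_trans (Ha i j) _; rewrite addSn exprS mulrA divfK // gt_eqF.
Qed.

Lemma geo_sy_gain K a : geo rho K a -> geo rho (K / rho) (sy a).
Proof.
move=> Ha i [|j] /=; first by rewrite normr0 !mulr_ge0 ?(geo_ge0 Ha) ?invr_ge0 ?exprn_ge0 // ltW.
by apply: le_trans (Ha i j) _; rewrite addnS exprS mulrA divfK // gt_eqF.
Qed.

(** Every term of [Dconv] contains a shift, which gains [1 / rho], and [rho] is twice the total
    weight. *)
Lemma geo_Dconv K a : geo rho K a -> geo rho (K / 2) (Dconv a).
Proof.
move=> Ha; pose L := K / rho.
have L0 : 0 <= L by rewrite mulr_ge0 ?invr_ge0 ?(geo_ge0 Ha) // ltW.
have hx b : geo rho L b -> geo rho L (sx b) by apply: geo_sx.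
have hy b : geo rho L b -> geo rho L (sy b) by apply: geo_sy.
have gx := geo_sx_gain Ha; have gy := geo_sy_gain Ha; rewrite -/L in gx gy.
have h2 (n : nat) b b' : geo rho L b -> geo rho L b' ->
   geo rho (`|n%:R : C| * (L + L)) (fun i j => n%:R * (b i j + b' i j)).
  by move=> H H'; apply: geoZ; apply: geoD.
apply: (@geo_le _ _ ((`|k01%:R : C| * (L + L) + (`|k02%:R : C| * (L + L) +
  (`|k12%:R : C| * (L + L) + `|k22%:R : C| * L))))); first exact: ltW.
  rewrite (_ : K / 2 = c0 * L); last by rewrite /L /rho; field; rewrite gt_eqF.
  rewrite !normr_nat /step_mass (_ : (1 + _) * L = (k01%:R * (L + L) + (k02%:R * (L + L) +
    (k12%:R * (L + L) + k22%:R * L))) + L); last by ring.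
  by rewrite lerDl.
apply: geoD; first by apply: h2.
apply: geoD; first by apply: h2; [apply/hx|apply/hy].
apply: geoD; first by apply: h2; [apply/hx/hx|apply/hx/hy].
by apply: geoZ; apply/hx/hx/hy.
Qed.

Definition one_arr : arr := fun i j => if (i == 0%N) && (j == 0%N) then 1 else 0.
Definition xy_arr : arr := sx (sy one_arr).

(** The series [U = x y / S - x y] solves [U = - D(x y) - D(U)], with [D] the multiplication by
    [S - 1]. As [D] raises degrees, the Picard iterates stabilise degree by degree, and [T_arr]
    reads off the stable coefficients. *)
Fixpoint iter_inv n : arr := if n is n'.+1 then
  fun i j => - Dconv xy_arr i j - Dconv (iter_inv n') i j else fun _ _ => 0.

Definition T_arr : arr := fun i j => iter_inv (i + j).+1 i j.

Lemma iter_inv_stable n k : agree n (iter_inv n) (iter_inv (n + k)).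
Proof.
elim: n k => [|n IH] k; first by [].
by move=> i j lt; rewrite addSn /= (agree_Dconv (IH k)).
Qed.

Lemma T_arr_agree n : agree n (iter_inv n) T_arr.
Proof.
move=> i j lt; have := @iter_inv_stable (i + j).+1 (n - (i + j).+1) i j (ltnSn _).
by rewrite subnKC.
Qed.

Lemma Sconv_T_arr i j : Sconv T_arr i j = xy_arr i j - Sconv xy_arr i j.
Proof.
rewrite !SconvE {1}/T_arr /= (agree_Dconv (@T_arr_agree (i + j))) //; ring.
Qed.

Lemma T_arr_low : agree 3 T_arr (fun _ _ => 0).
Proof.
have xy0 : agree 2 xy_arr (fun _ _ => 0).
  by move=> [|[|i]] [|[|j]] //=; rewrite /xy_arr /sx /sy /one_arr /= ?andbF.
have H n : agree 3 (iter_inv n) (fun _ _ => 0).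
  elim: n => [|n IH] //= i j lt.
  rewrite (agree_Dconv xy0) // Dconv0 (agree_Dconv IH) ?Dconv0 ?subr0 ?oppr0 //.
  by apply: leq_trans lt _.
by move=> i j lt; apply: H.
Qed.

Lemma geo_xy_arr : geo rho 1 xy_arr.
Proof.
apply: geo_sx => //; apply: geo_sy => //.
move=> i j; rewrite /one_arr mul1r; case: ifP => _; last by rewrite normr0 exprn_ge0 // ltW.
by rewrite normr1 exprn_ege1.
Qed.

Lemma geo_T_arr : geo rho 1 T_arr.
Proof.
have H n : geo rho 1 (iter_inv n).
  elim: n => [|n IH] /=.
    by move=> i j; rewrite normr0 mul1r exprn_ge0 // ltW.
  move=> i j; apply: le_trans (ler_normB _ _) _; rewrite normrN.
  rewrite (_ : 1 * rho ^+ (i + j) = 1 / 2 * rho ^+ (i + j) + 1 / 2 * rho ^+ (i + j)).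
    by rewrite lerD //; [apply: (geo_Dconv geo_xy_arr)|apply: (geo_Dconv IH)].
  by field.
by move=> i j; apply: H.
Qed.

Theorem T_arr_sum : exists2 r, 0 <= r & exists2 K, geo r K T_arr &
  forall x y, small r x -> small r y -> St x y != 0 ->
   E2 T_arr x y = x * y / St x y - x * y.
Proof.
exists rho; first exact: ltW.
exists 1; first exact: geo_T_arr.
move=> x y xs ys S0; have r0 := ltW rhop.
have g1 : geo rho 1 one_arr.
  move=> i j; rewrite /one_arr mul1r; case: ifP => _; last by rewrite normr0 exprn_ge0.
  by rewrite normr1 exprn_ege1.
have E1 : E2 one_arr x y = 1.
  rewrite /E2 (tsumS (outer_dom r0 xs ys g1)) mul1r tsum0 ?addr0; last first.
    by move=> i; rewrite /inner tsum0 ?mulr0 // => j; rewrite /one_arr mul0r.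
  rewrite /inner (tsumS (inner_dom r0 ys 0 g1)) tsum0 ?addr0 ?mulr1 //.
  by move=> j; rewrite /one_arr mul0r.
have Exy : E2 xy_arr x y = x * y.
  rewrite (E2_sx r0 xs ys rho1 (geo_sy rho1 g1)) (E2_sy r0 xs ys rho1 g1) E1.
  by rewrite mulr1.
have H : St x y * E2 T_arr x y = x * y - St x y * (x * y).
  rewrite -(E2_Sconv r0 xs ys rho1 _ _ _ _ geo_T_arr).
  rewrite -[in RHS]Exy -(E2_Sconv r0 xs ys rho1 _ _ _ _ geo_xy_arr) -mulN1r.
  have gS := geo_Sconv rho1 k01 k02 k12 k22 geo_xy_arr.
  rewrite -(E2Z r0 xs ys (-1) gS) -(E2D r0 xs ys geo_xy_arr (geoZ (-1) gS)).
  by apply: eq_E2 => i j; rewrite Sconv_T_arr mulN1r.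
by apply: (mulfI S0); rewrite H; field.
Qed.

End Inverse.

(** * Convergent power series *)

Section TaylorSeries.
Variable R : realType.
Local Notation C := (CC R).
Local Notation arr := (nat -> nat -> C).
Implicit Types (a : arr) (P : 'rV[C]_2 -> Prop).

Lemma triangle_sum (rho K x y : C) a : 0 <= rho -> small rho x -> small rho y -> geo rho K a ->
  forall d, `|E2 a x y - \sum_(i < d) \sum_(j < d - i) a i j * (x ^+ i * y ^+ j)|
    <= 24 * K / 2 ^+ d.
Proof.
move=> r0 xs ys Ha d; have K0 := geo_ge0 Ha.
have -> : E2 a x y - \sum_(i < d) \sum_(j < d - i) a i j * (x ^+ i * y ^+ j) =
  (E2 a x y - \sum_(i < d) x ^+ i * inner a i y) +
  \sum_(i < d) x ^+ i * (inner a i y - \sum_(j < d - i) a i j * y ^+ j).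
  rewrite [X in _ = _ + X](_ : _ = \sum_(i < d) x ^+ i * inner a i y -
      \sum_(i < d) \sum_(j < d - i) a i j * (x ^+ i * y ^+ j)); first by ring.
  rewrite -sumrB; apply: eq_bigr => i _; rewrite mulrBr; congr (_ - _).
  by rewrite mulr_sumr; apply: eq_bigr => j _; rewrite mulrCA.
apply: le_trans (ler_normD _ _) _.
(* The first part bounds the tail of the outer sum, the second the tails of the inner sums. *)
rewrite (_ : 24 * K / 2 ^+ d = 4 * (4 * K) / 2 ^+ d + 8 * K / 2 ^+ d); last first.
  by field; rewrite expf_neq0 ?pnatr_eq0.
apply: lerD; first exact: (tsum_gconv (outer_dom r0 xs ys Ha)).
apply: le_trans (ler_norm_sum _ _ _) _.
apply: (@le_trans _ _ (\sum_(i < d) 4 * K / 2 ^+ d * (1 / 2) ^+ i)).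
  apply: ler_sum => i _; rewrite normrM normrX.
  apply: (@le_trans _ _ (`|x| ^+ i * (4 * (K * rho ^+ i) / 2 ^+ (d - i)))).
    by rewrite ler_wpM2l ?exprn_ge0 //; apply: (tsum_gconv (inner_dom r0 ys i Ha)).
  have -> : `|x| ^+ i * (4 * (K * rho ^+ i) / 2 ^+ (d - i)) = 4 * K / 2 ^+ (d - i) * (`|x| * rho) ^+ i.
    by rewrite exprMn; move: (`|x|) (2 ^+ (d - i))^-1 => u v; ring.
  apply: (@le_trans _ _ (4 * K / 2 ^+ (d - i) * (4^-1) ^+ i)).
    rewrite ler_wpM2l ?mulr_ge0 ?invr_ge0 ?exprn_ge0 //.
    by apply: lerXn2r; rewrite ?nnegrE ?mulr_ge0 ?invr_ge0.
  have -> : 2 ^+ d = 2 ^+ (d - i) * 2 ^+ i :> C by rewrite -exprD subnK // ltnW.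
  have -> : (4^-1 : C) ^+ i = (2 ^+ i * 2 ^+ i)^-1.
    by rewrite -exprMn -natrM exprVn.
  rewrite expr_div_n expr1n [X in X <= _](_ : _ = 4 * K / (2 ^+ (d - i) * 2 ^+ i) * (1 / 2 ^+ i)) //.
  by field; rewrite !expf_neq0 ?pnatr_eq0.
rewrite -mulr_sumr [X in _ <= X](_ : _ = 4 * K / 2 ^+ d * 2); last by ring.
rewrite ler_wpM2l ?mulr_ge0 ?invr_ge0 ?exprn_ge0 //.
have -> : \sum_(i < d) (1 / 2) ^+ i = 2 * (1 - (1 / 2) ^+ d) :> C.
  elim: (d) => [|n IH]; first by rewrite big_ord0 expr0 subrr mulr0.
  by rewrite big_ord_recr /= IH exprS; field.
by rewrite mulrBr mulr1 gerBl mulr_ge0 // exprn_ge0 // divr_ge0.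
Qed.

Lemma ord2_cases (i : 'I_2) : i = ord0 \/ i = ord_max.
Proof. by case: i => [[|[|]] //] h; [left|right]; apply/val_inj. Qed.

Lemma multinom2_sum (V : nmodType) (d : nat) (F : nat -> nat -> V) :
  \sum_(m : 'X_{1..2 < d}) F (m ord0) (m ord_max) = \sum_(i < d) \sum_(j < d - i) F i j.
Proof.
have mdeg2 (m : 'X_{1..2}) : mdeg m = (m ord0 + m ord_max)%N.
  rewrite mdegE big_ord_recl big_ord1; congr (_ + m _)%N; exact/val_inj.
transitivity (\sum_(p : 'I_d * 'I_d | (p.1 + p.2 < d)%N) F p.1 p.2); last first.
  rewrite -(pair_big_dep xpredT (fun (i j : 'I_d) => (i + j < d)%N) (fun i j => F i j)) /=.
  apply: eq_bigr => i _.
  rewrite (big_ord_widen d (fun j => F i j)) ?leq_subr //.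
  by apply: eq_bigl => j; rewrite ltn_subRL.
have bnd (m : 'X_{1..2 < d}) : (m ord0 < d)%N /\ (m ord_max < d)%N.
  by have := bmdeg m; rewrite mdeg2; split; lia.
pose h (m : 'X_{1..2 < d}) : 'I_d * 'I_d := (Ordinal (bnd m).1, Ordinal (bnd m).2).
have hi : injective h.
  move=> m m' [e0 e1]; apply/val_inj/mnmP => i.
  case: (ord2_cases i) => ->; first exact: e0.
  exact: e1.
rewrite -[LHS]/(\sum_(m : 'X_{1..2 < d}) (fun p => F (fst p : 'I_d) (snd p : 'I_d)) (h m)).
rewrite -(big_imset (fun p : 'I_d * 'I_d => F p.1 p.2) (A := [pred m : 'X_{1..2 < d} | true])) /=; last by move=> m m' _ _; apply: hi.
apply: eq_bigl => p; apply/imsetP/idP => [[m _ ->]|lt] /=.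
  by rewrite -mdeg2 bmdeg.
pose mk : 'X_{1..2} := [multinom if i == ord0 then p.1 : nat else p.2 : nat | i < 2].
have mkd : (mdeg mk < d)%N by rewrite mdeg2 !mnmE.
exists (BMultinom mkd) => //; case: p @mk lt mkd => p q mk lt mkd.
by congr (_, _); apply/val_inj; rewrite /= mnmE.
Qed.

Lemma near0_row2 P : (\forall z \near (0 : 'rV[C]_2), P z) <->
  (exists2 r : C, 0 < r & forall z : 'rV[C]_2, `|z 0 0| <= r -> `|z 0 1| <= r -> P z).
Proof.
split=> [/nbhs_ballP[r /= r0 H]|[r r0 H]].
  exists (r / 2); first by rewrite divr_gt0.
  move=> z h0 h1; apply: H; split=> // i j; rewrite (ord1 i) mxE.
  have h2 (c : C) : `|c| <= r / 2 -> ball (0 : C) r c.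
    move=> h; rewrite -ball_normE /= sub0r normrN; apply: le_lt_trans h _.
    by rewrite ltr_pdivrMr // ltr_pMr // ltr1n.
  case: (ord2_cases j) => ->; apply: h2 => //.
  by move: h1; rewrite (_ : 1 = ord_max) //; apply/val_inj.
apply/nbhs_ballP; exists r => // z /= Hz.
have h j : `|z 0 j| <= r.
  by case: (Hz) => _ /(_ 0 j); rewrite mxE -ball_normE /= sub0r normrN => /ltW.
exact: H.
Qed.

Lemma monomial2 (z : 'rV[C]_2) (m : 'X_{1..2}) :
  monomial_at z m = z 0 0 ^+ m ord0 * z 0 1 ^+ m ord_max.
Proof.
rewrite /monomial_at big_ord_recl big_ord1 (_ : lift ord0 ord0 = ord_max); last exact/val_inj.
by rewrite (_ : 1 = ord_max) //; apply/val_inj.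
Qed.

Lemma small_radius (rho x : C) : 0 <= rho -> `|x| <= 4^-1 / (rho + 1) -> small rho x.
Proof.
move=> r0 h; rewrite /small.
apply: le_trans (_ : 4^-1 / (rho + 1) * rho <= _); first by rewrite ler_wpM2r.
by rewrite -mulrA ler_piMr ?invr_ge0 // ler_pdivrMl ?ltr_wpDl // mulr1 lerDl.
Qed.

Theorem taylor_series_E2 (rho K : C) a : 0 <= rho -> geo rho K a ->
  taylor_series (fun z : 'rV[C]_2 => E2 a (z 0 0) (z 0 1))
    (fun m : 'X_{1..2} => a (m ord0) (m ord_max)).
Proof.
move=> r0 Ha; have K0 := geo_ge0 Ha.
have r1 : 0 < 4^-1 / (rho + 1) :> C by rewrite divr_gt0 ?invr_gt0 // ltr_wpDl.
have rs (x : C) : `|x| <= 4^-1 / (rho + 1) -> small rho x := @small_radius rho x r0.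
split.
  exists (4^-1 / (rho + 1)), (4 * K); split=> // d.
  pose r := 4^-1 / (rho + 1) : C.
  have sr : small rho r by apply: rs; rewrite ger0_norm // ltW.
  pose F i j : C := `|a i j| * r ^+ (i + j).
  rewrite (eq_bigr (fun m : 'X_{1..2 < d} => F (m ord0) (m ord_max))); last first.
    move=> m _; rewrite /F; congr (_ * _ ^+ _).
    rewrite mdegE big_ord_recl big_ord1; congr (_ + _ _)%N; exact/val_inj.
  rewrite (multinom2_sum d F).
  have Fb i j : F i j <= K / 2 ^+ i / 2 ^+ j.
    rewrite /F; apply: le_trans (_ : K * rho ^+ (i + j) * r ^+ (i + j) <= _).
      by rewrite ler_wpM2r ?exprn_ge0 // ltW.
    rewrite -!mulrA ler_wpM2l // -invfM -exprD -exprMn -exprVn.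
    have h : rho * r <= 2^-1.
      move: sr; rewrite /small ger0_norm ?(ltW r1) // mulrC => h.
      by apply: le_trans h _; rewrite lef_pV2 ?posrE // ler_nat.
    have rr : 0 <= r by apply: ltW.
    apply: lerXn2r; rewrite ?nnegrE.
    - by rewrite mulr_ge0.
    - by rewrite invr_ge0.
    exact: h.
  have G n : \sum_(i < n) (2 ^+ i)^-1 <= 2 :> C.
    suff -> : \sum_(i < n) (2 ^+ i)^-1 = 2 - 2 / 2 ^+ n :> C.
      by rewrite gerBl divr_ge0 ?exprn_ge0.
    elim: n => [|n IH]; first by rewrite big_ord0 expr0 divr1 subrr.
    by rewrite big_ord_recr /= IH exprS; field; rewrite expf_neq0 ?pnatr_eq0.
  apply: le_trans (_ : \sum_(i < d) K / 2 ^+ i * 2 <= _).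
    apply: ler_sum => i _; apply: le_trans (_ : \sum_(j < d - i) K / 2 ^+ i / 2 ^+ j <= _).
      by apply: ler_sum => j _; apply: Fb.
    by rewrite -mulr_sumr ler_wpM2l // divr_ge0 ?exprn_ge0.
  rewrite -mulr_suml -mulr_sumr.
  have -> : 4 * K = K * 2 * 2 by ring.
  by rewrite ler_wpM2r // ler_wpM2l.
apply/near0_row2; exists (4^-1 / (rho + 1)) => // z /rs z0 /rs z1.
apply/cvgrPdist_le => /= e e0.
have [N HN] := geometric_le (mulr_ge0 (ler0n _ 24) K0) e0.
exists N => // d /= Nd; apply: le_trans (HN d Nd).
apply: le_trans (triangle_sum r0 z0 z1 Ha d).
rewrite /partial_sum -(multinom2_sum d (fun i j => a i j * (z 0 0 ^+ i * z 0 1 ^+ j))).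
by under eq_bigr do rewrite monomial2.
Qed.

End TaylorSeries.

(** * Taylor remainders of holomorphic germs *)

Section HolomorphicGerms.
Variable R : realType.
Local Notation C := (CC R).
Local Notation B2 := {poly {poly C}}.
Implicit Types (g : 'rV[C]_2 -> C) (P : 'rV[C]_2 -> Prop).

Definition pair_mnm (i j : nat) : 'X_{1..2} := [multinom if k == ord0 then i else j | k < 2].

Lemma pair_mnmK (m : 'X_{1..2}) : pair_mnm (m ord0) (m ord_max) = m.
Proof. by apply/mnmP => k; rewrite mnmE; case: (ord2_cases k) => ->. Qed.

Lemma pair_row0 (u v : C) : pair_row u v 0 0 = u.
Proof. by rewrite mxE. Qed.

Lemma pair_row1 (u v : C) : pair_row u v 0 1 = v.
Proof. by rewrite mxE. Qed.

Lemma partial_sum_diff (a : 'X_{1..2} -> C) (r B q : C) (n d : nat) (z : 'rV[C]_2) :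
  0 < r -> 0 <= q -> q <= 1 -> (n <= d)%N ->
  \sum_(m : 'X_{1..2 < d}) `|a m| * r ^+ mdeg m <= B ->
  `|z 0 0| <= r * q -> `|z 0 1| <= r * q ->
  `|partial_sum a z d - partial_sum a z n| <= B * q ^+ n.
Proof.
move=> r0 q0 q1 nd HB z0 z1; rewrite /partial_sum.
rewrite (big_sub_widen 'X_{1..2 < n} 'X_{1..2 < d} xpredT (fun m => a m * monomial_at z m)) /=; last first.
  by move=> x h; apply: leq_trans h nd.
rewrite (bigID (fun m : 'X_{1..2 < d} => (mdeg m < n)%N)) /=.
have -> (x y : C) : x + y - x = y by rewrite addrC addKr.
apply: le_trans (ler_norm_sum _ _ _) _.
apply: le_trans (_ : \sum_(m : 'X_{1..2 < d}) `|a m| * r ^+ mdeg m * q ^+ n <= _); last first.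
  by rewrite -mulr_suml ler_wpM2r ?exprn_ge0.
rewrite big_mkcond; apply: ler_sum => m _.
case: ifP => [|_]; last by rewrite !mulr_ge0 ?exprn_ge0 // ltW.
rewrite -leqNgt => nm; rewrite normrM -mulrA ler_wpM2l //.
apply: le_trans (_ : r ^+ mdeg m * q ^+ mdeg m <= _); last first.
  by rewrite ler_wpM2l ?exprn_ge0 ?(ltW r0) //; apply: ler_wiXn2l.
rewrite -exprMn mdegE big_ord_recl big_ord1 monomial2 normrM !normrX exprD.
rewrite (_ : lift ord0 ord0 = ord_max); last exact/val_inj.
by apply: ler_pM; rewrite ?exprn_ge0 //; apply: lerXn2r; rewrite ?nnegrE ?mulr_ge0 // ltW.
Qed.

(** Shrinking the polydisc by [q] gains [q ^+ n] on terms of degree at least [n]; the distance from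
    [g] to a far partial sum is absorbed by one more [q ^+ n]. *)
Lemma taylor_remainder g a : taylor_series g a -> exists de B : C, 0 < de /\
  forall n (q : C) (z : 'rV[C]_2), 0 < q -> q <= 1 -> `|z 0 0| <= de * q -> `|z 0 1| <= de * q ->
   `|g z - partial_sum a z n| <= B * q ^+ n.
Proof.
move=> [[r [B [r0 HB]]] /near0_row2[r' r'0 Hc]].
have [de de0 [le1 le2]] := pos_min r0 r'0.
exists de, (1 + B); split=> // n q z q0 q1 z0 z1.
have le r1 : 0 < r1 -> de <= r1 -> de * q <= r1.
  by move=> r10 h; apply: le_trans h; rewrite ler_piMr // ltW.
have cz : (partial_sum a z @ \oo --> g z)%classic.
  by apply: Hc; [apply: le_trans z0 _|apply: le_trans z1 _]; apply: le.
have qn0 : 0 < q ^+ n by rewrite exprn_gt0.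
move/cvgrPdist_le : cz => /(_ _ qn0) [N _ HN].
pose d := maxn n N.
have -> : g z - partial_sum a z n = (g z - partial_sum a z d) + (partial_sum a z d - partial_sum a z n).
  by rewrite addrA subrK.
apply: le_trans (ler_normD _ _) _; rewrite mulrDl mul1r lerD //.
  by apply: HN; rewrite /= leq_maxr.
apply: (partial_sum_diff r0 (ltW q0) q1 _ (HB d)); first exact: leq_maxl.
  by apply: le_trans z0 _; rewrite ler_wpM2r // ltW.
by apply: le_trans z1 _; rewrite ler_wpM2r // ltW.
Qed.

Lemma O1_small (u : C -> C) r : 0 < r -> O1 1 u -> nearp (fun s => `|u s| <= r).
Proof.
move=> r0 [B [r1 r10 HB]].
have B1 : 0 < `|B| + 1 by rewrite ltr_wpDl.
have [r2 r20 [le1 le2]] := pos_min r10 (divr_gt0 r0 B1).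
exists r2 => // s s0 sr; have := HB s s0 (le_trans sr le1).
rewrite expr1 normrM normfV (gtr0_norm s0) ler_pdivrMr // => h.
have B0 : 0 <= B by rewrite -(pmulr_lge0 _ s0) (le_trans _ h).
apply: le_trans h _; rewrite -[B](ger0_norm B0).
apply: le_trans (_ : (`|B| + 1) * (r / (`|B| + 1)) <= _).
  by apply: ler_pM => //; rewrite ?(ltW s0) ?lerDl ?(le_trans sr).
by rewrite mulrC divfK // gt_eqF.
Qed.

(** The coordinates are exchanged: [w] comes first and [z] second, in accordance with the weights 1
    and 2 that they have on the surface. *)
Lemma holomorphic_Exp2 g : holomorphic_germ g ->
  Exp2 (fun x t : C => g (pair_row t x)).
Proof.
move=> [a Ha]; have [de [B [de0 HB]]] := taylor_remainder Ha => n.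
have [p pE] : polyfun2 (fun x t : C => partial_sum a (pair_row t x) n).
  apply: (@polyfun2_ext _ (fun x t => \sum_(m : 'X_{1..2 < n}) a m * (t ^+ m ord0 * x ^+ m ord_max))).
    by move=> x t; apply: eq_bigr => m _; rewrite monomial2 pair_row0 pair_row1.
  by apply: polyfun2_sum => m; polyfun2_tac.
exists p => X Y HX HY.
have [BX [rX rX0 HX']] := HX; have [BY [rY rY0 HY']] := HY.
pose L := `|BX| + `|BY| + 1.
have L0 : 0 < L by rewrite ltr_wpDl // addr_ge0.
exists (B * (L / de) ^+ n).
have [r0 r00 [le1 le2]] := pos_min rX0 rY0.
have [r1 r10 [le3 le4]] := pos_min r00 (divr_gt0 de0 L0).
exists r1 => // s s0 sr.
rewrite -pE normrM normfV normrX (gtr0_norm s0) ler_pdivrMr ?exprn_gt0 //.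
rewrite -mulrA -exprMn.
have bd (u : C) b : `|u / s ^+ 1| <= b -> `|b| <= L -> `|u| <= de * (L / de * s).
  rewrite expr1 normrM normfV (gtr0_norm s0) ler_pdivrMr // => h bL.
  have -> : de * (L / de * s) = L * s by field; rewrite gt_eqF.
  have b0 : 0 <= b by rewrite -(pmulr_lge0 _ s0) (le_trans _ h).
  by apply: le_trans h _; rewrite ler_wpM2r ?(ltW s0) // -(ger0_norm b0).
apply: HB.
- by rewrite mulr_gt0 ?divr_gt0.
- apply: le_trans (_ : L / de * (de / L) <= _).
    by rewrite ler_wpM2l ?(ltW (divr_gt0 L0 de0)) // (le_trans sr).
  by rewrite mulrA divfK ?gt_eqF // divff // gt_eqF.
- rewrite pair_row0; apply: (bd _ BY); first by apply: HY' => //; rewrite (le_trans sr) ?(le_trans le3).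
  by rewrite /L -addrA addrCA lerDl addr_ge0.
- rewrite pair_row1; apply: (bd _ BX); first by apply: HX' => //; rewrite (le_trans sr) ?(le_trans le3).
  by rewrite /L -addrA lerDl addr_ge0.
Qed.

End HolomorphicGerms.

(** * The approximation property and the Bishop normal form *)

Section AlgebraicGerms.
Variable R : realType.
Local Notation C := (CC R).
Local Notation B2 := {poly {poly C}}.

Lemma mpoly2_poly (p : {mpoly C[2]}) : exists q : B2,
  (forall z : 'rV[C]_2, ev q (z 0 1) (z 0 0) = p.@[fun i => z 0 i]) /\ (p != 0 -> q != 0).
Proof.
pose d := msize p.
pose q : B2 := \poly_(i < d) \poly_(j < d - i) p@_(pair_mnm i j).
exists q; split=> [z|].
  rewrite [p in RHS](mpolywE (leqnn d)) rmorph_sum /=.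
  pose F i j : C := p@_(pair_mnm i j) * (z 0 0 ^+ i * z 0 1 ^+ j).
  rewrite (eq_bigr (fun m : 'X_{1..2 < d} => F (m ord0) (m ord_max))); last first.
    by move=> m _; rewrite /F pair_mnmK mevalZ mevalX -monomial2.
  rewrite (multinom2_sum d F) /ev /q horner_poly horner_sum.
  apply: eq_bigr => i _; rewrite -polyC_exp hornerM hornerC horner_poly mulr_suml.
  by apply: eq_bigr => j _; rewrite /F mulrAC mulrA.
apply: contra_neq => q0; apply/mpolyP => m; rewrite mcoeff0.
case: (ltnP (mdeg m) d) => md; last by apply: memN_msupp_eq0; apply/negP => /msize_mdeg_lt; rewrite ltnNge md.
have h : (m ord0 + m ord_max < d)%N.
  move: md; rewrite mdegE big_ord_recl big_ord1 (_ : lift ord0 ord0 = ord_max) //; exact/val_inj.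
have := congr1 (fun u : B2 => u`_(m ord0)`_(m ord_max)) q0.
rewrite /q !coef0 coef_poly (leq_ltn_trans (leq_addr _ _) h) coef_poly.
by rewrite ltn_subRL h pair_mnmK.
Qed.

Lemma algebraic_kills (g : 'rV[C]_2 -> C) : algebraic_germ g ->
  exists2 m : {poly B2}, m != 0 & kills (fun x t : C => g (pair_row t x)) m.
Proof.
move=> [_ [P P0 /near0_row2[r r0 HP]]].
have [q Hq] := choice (fun i : nat => mpoly2_poly P`_i).
pose m : {poly B2} := \poly_(i < size P) q i.
exists m.
  have s0 : (0 < size P)%N by rewrite size_poly_gt0.
  apply: contraNneq ((Hq (size P).-1).2 _) => [m0|]; last by rewrite -lead_coefE lead_coef_eq0.
  by have := congr1 (fun u : {poly B2} => u`_(size P).-1) m0; rewrite coef0 coef_poly prednK // leqnn => ->.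
move=> n X Y HX HY; apply: O1_ext (O10 C n).
have := nearp_and (O1_small r0 HX) (O1_small r0 HY).
apply: nearp_imp => s _ [hX hY].
have := HP (pair_row (Y s) (X s)); rewrite pair_row0 pair_row1 => /(_ hY hX).
rewrite /eval_poly_at => E; rewrite -{}E.
rewrite (ev3_wide _ _ _ (size_poly _ _)) /map_poly horner_poly.
apply: eq_bigr => i _; rewrite coef_poly ltn_ord; congr (_ * _).
by rewrite -(Hq i).1 pair_row0 pair_row1.
Qed.

End AlgebraicGerms.

(** * Failure of the approximation property *)

Section NotNashArtin.
Variable R : realType.
Local Notation C := (CC R).

Definition real_poly n (f : 'rV[C]_n -> C) :=
  exists p q : {mpoly R[n + n]}, forall x,
    f x = (p.@[real_coords x] +i* q.@[real_coords x])%C.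

Lemma real_poly_add n (f g : 'rV[C]_n -> C) : real_poly f -> real_poly g ->
  real_poly (fun x => f x + g x).
Proof. exact: real_polyD. Qed.

Lemma real_poly_mul n (f g : 'rV[C]_n -> C) : real_poly f -> real_poly g ->
  real_poly (fun x => f x * g x).
Proof. exact: real_polyM. Qed.

Lemma real_poly_conj n (f : 'rV[C]_n -> C) : real_poly f -> real_poly (fun x => (f x)^*).
Proof. exact: real_polyJ. Qed.

Lemma real_poly_cst n (c : C) : real_poly (fun _ : 'rV[C]_n => c).
Proof. exact: real_polyC. Qed.

Lemma real_poly_coord n (i : 'I_n) : real_poly (fun x : 'rV[C]_n => x 0 i).
Proof. exact: real_polyX. Qed.

Lemma real_algebraic_zero n (f : 'rV[C]_n -> C) : real_poly f ->
  real_algebraic_set [set x | f x = 0]%classic.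
Proof.
move=> [p [q fE]]; exists [:: p; q]; apply/seteqP; split=> x /=.
  by rewrite fE andbT => /eqP; rewrite eq_complex.
by rewrite andbT fE => pq; apply/eqP; rewrite eq_complex.
Qed.

Lemma E2_conj (rho K x y : C) a : 0 <= rho -> small rho x -> small rho y -> geo rho K a ->
  (forall i j, (a i j)^* = a i j) -> (E2 a x y)^* = E2 a x^* y^*.
Proof.
move=> r0 xs ys Ha ar; rewrite /E2 (tsum_conj (outer_dom r0 xs ys Ha)).
apply: eq_tsum => i; rewrite rmorphM rmorphXn /=; congr (_ * _).
rewrite /inner (tsum_conj (inner_dom r0 ys i Ha)).
by apply: eq_tsum => j; rewrite rmorphM rmorphXn /= ar.
Qed.

Variables k01 k02 k12 k22 : nat.
Local Notation St := (@step_sum C k01 k02 k12 k22).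
Local Notation Tf := (@height C k01 k02 k12 k22).
Local Notation Tw := (@slice_height C k01 k02 k12 k22).
Variable M : set 'rV[C]_2.
Hypothesis HM : forall p : 'rV[C]_2,
  M p <-> p 0 1 * (p 0 1)^* = p 0 0 * St (p 0 1) (p 0 1)^*.

Lemma St00 : St 0 0 = 1.
Proof. by rewrite /step_sum; ring. Qed.

Lemma M_St (p : 'rV[C]_2) : M p -> St (p 0 1) (p 0 1)^* != 0.
Proof.
move=> /HM E; apply/negP => /eqP S0; move: E; rewrite S0 mulr0 => /eqP.
rewrite mulf_eq0 conjC_eq0 orbb => /eqP w0.
by move: S0; rewrite w0 conjC0 St00 => /eqP; rewrite oner_eq0.
Qed.

Lemma M_slice (p : 'rV[C]_2) : St (p 0 1) (p 0 1)^* != 0 ->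
  M p <-> p 0 0 = Tw (p 0 1).
Proof.
move=> S0; rewrite HM /slice_height /height; split=> [->|->]; first by rewrite mulfK.
by rewrite divfK.
Qed.

Hypothesis Hodd : odd_curve C k01 k02 k12 k22.
Hypothesis Sa1 : step_a k02 k12 k22 (1 : C) != 0.

Theorem not_nash_artin (x0 sg : C) : is_node k01 k02 k12 k22 x0 sg -> ~ nash_artin_property M.
Proof.
move=> node; have [[x00 _ _ _] _] := node.
pose al := x0 ^+ 2.
have al0 : al != 0 by rewrite expf_neq0.
pose l x y : C := (al - x * y) * (al^* - x * y).
pose nm x y : C := al + al^* - 2 * (x * y).
have ab : al * al^-1 = 1 by rewrite divff.
have [rho [K [a [rho1 Ha areal walk]]]] := walk_solution k01 k02 k12 k22 ab.
have rho0 : 0 <= rho := le_trans ler01 rho1.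
pose h (p : 'rV[C]_2) : 'rV[C]_1 := \row_(j < 1) E2 a (p 0 0) (p 0 1).
pose w_ (u : 'rV[C]_(2 + 1)) : C := u 0 (lshift 1 (1 : 'I_2)).
pose ze_ (u : 'rV[C]_(2 + 1)) : C := u 0 (rshift 2 (0 : 'I_1)).
(* The condition that twice the real part of the third coordinate is [nm / l], that is [P], at the
   product of [w] and its conjugate; [z] does not occur in it. *)
pose G := [set u : 'rV[C]_(2 + 1) |
  l (w_ u) (w_ u)^* * (ze_ u + (ze_ u)^*) + -1 * nm (w_ u) (w_ u)^* = 0]%classic.
have Galg : real_algebraic_set G.
  apply: real_algebraic_zero.
  have Mw : real_poly (fun u => w_ u * (w_ u)^*) by apply: real_poly_mul; [exact: real_poly_coord|apply: real_poly_conj; exact: real_poly_coord].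
  have L c : real_poly (fun u => c - w_ u * (w_ u)^*).
    have [p [q E]] := real_poly_add (real_poly_cst _ c) (real_poly_mul (real_poly_cst _ (-1)) Mw).
    by exists p, q => u; rewrite -E mulN1r.
  have N : real_poly (fun u => nm (w_ u) (w_ u)^*).
    have [p [q E]] := real_poly_add (real_poly_cst _ (al + al^*)) (real_poly_mul (real_poly_cst _ (-2)) Mw).
    by exists p, q => u; rewrite -E mulNr.
  apply: real_poly_add; last by apply: real_poly_mul; [exact: real_poly_cst|exact: N].
  by apply: real_poly_mul; [apply: real_poly_mul; exact: L|apply: real_poly_add; [exact: real_poly_coord|apply: real_poly_conj; exact: real_poly_coord]].
have inG (p : 'rV[C]_2) (g : 'rV[C]_2 -> 'rV[C]_1) : G (row_mx p (g p)) <->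
    l (p 0 1) (p 0 1)^* * (g p 0 0 + (g p 0 0)^*) = nm (p 0 1) (p 0 1)^*.
  rewrite /G /= /w_ /ze_ row_mxEl row_mxEr mulN1r; split=> [/eqP|->]; last by rewrite subrr.
  by rewrite subr_eq0 => /eqP.
have hol j : holomorphic_germ (fun z => h z 0 j).
  exists (fun m : 'X_{1..2} => a (m ord0) (m ord_max)).
  have -> : (fun z => h z 0 j) = (fun z => E2 a (z 0 0) (z 0 1)).
    by apply/funext => z; rewrite mxE.
  exact: taylor_series_E2 rho0 Ha.
have gr : graph_over_sub M h G.
  apply/near0_row2; exists (4^-1 / (rho + 1)); first by rewrite divr_gt0 ?invr_gt0 // ltr_wpDl.
  have rs (x : C) : `|x| <= 4^-1 / (rho + 1) -> small rho x := @small_radius _ rho x rho0.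
  move=> z /rs z0 /rs z1 Mz; apply/inG; rewrite mxE.
  have zr : (z 0 0)^* = z 0 0 by rewrite ((M_slice (M_St Mz)).1 Mz) Tw_conj.
  have z1c : small rho (z 0 1)^* by rewrite /small norm_conjC.
  rewrite (E2_conj rho0 z0 z1 Ha areal) zr; apply: walk => //.
  exact/HM.
(* Order 0 already leads to a contradiction, since no algebraic germ satisfies the inclusion. *)
move=> /(_ _ _ _ Galg hol gr 0)[hc [alg grc _]].
pose f (x t : C) := hc (pair_row t x) 0 0.
have Ef : Exp2 f by apply: (holomorphic_Exp2 (alg 0).1).
have [m m0 Km] := algebraic_kills (alg 0).
have Pl : polyfun2 l by rewrite /l; polyfun2_tac.
have Pn : polyfun2 nm by rewrite /nm; polyfun2_tac.
have l0 : l 0 0 != 0 by rewrite /l mulr0 !subr0 mulf_neq0 // conjC_eq0.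
have rel : rnear (fun w => l w w^* * (f w (Tw w) + (f w (Tw w))^*) = nm w w^*).
  move=> z; move/near0_row2 : grc => [r r0 H].
  have hw := O1_small r0 (O1_ray z); have ht := O1_small r0 (O1_Tw_ray k01 k02 k12 k22 z).
  apply: nearp_imp (nearp_and (rnear_St k01 k02 k12 k22 z) (nearp_and hw ht)) => s _ [S0 [hs hts]].
  have := H (pair_row (Tw (s * z)) (s * z)); rewrite pair_row0 pair_row1 => /(_ hts hs).
  have Mp : M (pair_row (Tw (s * z)) (s * z)) by apply/M_slice; rewrite ?pair_row1 ?pair_row0.
  by move=> /(_ Mp) /inG; rewrite pair_row1.
have [n [a1 [a0 [b1 [b0 [n0 A0 B0 E]]]]]] := trace_decoupling Ef Hodd Sa1 Pl Pn l0 rel m0 Km.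
exact: (no_rational_decoupling node n0 A0 B0 E).
Qed.

End NotNashArtin.

(** * The Bishop normal form *)

Section Bishop.
Variable R : realType.
Local Notation C := (CC R).
Variables k01 k02 k12 k22 : nat.
Local Notation St := (@step_sum C k01 k02 k12 k22).

Lemma St_neq0 : exists2 r : C, 0 < r & forall x y, `|x| <= r -> `|y| <= r -> St x y != 0.
Proof.
pose N := (2 * k01 + 2 * k02 + 2 * k12 + k22)%N.
pose r : C := N.+1%:R^-1.
have r0 : 0 < r by rewrite invr_gt0.
have r1 : r <= 1 by rewrite invf_le1 // ler1n.
exists r => // x y xr yr.
have pr (u v : C) : `|u| <= r -> `|v| <= r -> `|u * v| <= r.
  move=> ur vr; rewrite normrM; apply: le_trans ur; rewrite ler_piMr //; exact: le_trans vr r1.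
have dbl (u v : C) : `|u| <= r -> `|v| <= r -> `|u + v| <= 2 * r.
  by move=> ur vr; apply: le_trans (ler_normD _ _) _; rewrite mulr2n mulrDl !mul1r lerD.
have xy := pr _ _ xr yr.
have sc (k : nat) (u b : C) : `|u| <= b -> `|k%:R * u| <= k%:R * b.
  by move=> ub; rewrite normrM normr_nat ler_wpM2l.
pose u := k01%:R * (x + y) + k02%:R * (x ^+ 2 + y ^+ 2)
  + k12%:R * (x * y * (x + y)) + k22%:R * (x * y) ^+ 2.
have ub : `|u| < 1.
  apply: (@le_lt_trans _ _ (N%:R * r)); last first.
    by rewrite ltr_pdivrMr // mul1r ltr_nat.
  have -> : N%:R * r = k01%:R * (2 * r) + k02%:R * (2 * r) + k12%:R * (2 * r) + k22%:R * r.
    by rewrite /N; ring.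
  apply: le_trans (ler_normD _ _) _; apply: lerD; last by apply: sc; rewrite expr2; apply: pr.
  apply: le_trans (ler_normD _ _) _; apply: lerD; last first.
    by apply: sc; rewrite mulrDr; apply: dbl; apply: pr.
  apply: le_trans (ler_normD _ _) _; apply: lerD; apply: sc; first exact: dbl.
  by rewrite !expr2; apply: dbl; apply: pr.
apply/negP => /eqP S0; move: ub.
have -> : u = -1 by rewrite -[LHS](addrK 1) -[X in _ = X]add0r -S0 /u /step_sum; ring.
by rewrite normrN normr1 ltxx.
Qed.

Variable M : set 'rV[C]_2.
Hypothesis HM : forall p : 'rV[C]_2,
  M p <-> p 0 1 * (p 0 1)^* = p 0 0 * St (p 0 1) (p 0 1)^*.

Theorem elliptic_bishop : elliptic_bishop_surface M.
Proof.
(* The only quadratic term of [w v / S(w, v)] is [w v]. *)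
exists 0; first by rewrite invr_gt0.
split=> //.
have [rho rho0 [K Ha HT]] := T_arr_sum R k01 k02 k12 k22.
pose a := T_arr R k01 k02 k12 k22.
exists (fun z => E2 a (z 0 0) (z 0 1)), (fun m : 'X_{1..2} => a (m ord0) (m ord_max)); split.
- exact: taylor_series_E2 rho0 Ha.
- move=> m; rewrite mdegE big_ord_recl big_ord1 (_ : lift ord0 ord0 = ord_max); last exact/val_inj.
  by move=> h; apply: T_arr_low.
have [r r0 HS] := St_neq0.
have r1 : 0 < 4^-1 / (rho + 1) :> C by rewrite divr_gt0 ?invr_gt0 // ltr_wpDl.
have [r2 r20 [le1 le2]] := pos_min r0 r1.
apply/near0_row2; exists r2 => // p _ p1 /=.
have p1c : `|(p 0 1)^*| <= r2 by rewrite norm_conjC.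
have S0 := HS _ _ (le_trans p1 le1) (le_trans p1c le1).
rewrite (M_slice HM S0) pair_row0 pair_row1 HT //.
- by rewrite mul0r addr0 addrC subrK.
- by apply: small_radius => //; apply: le_trans le2.
by apply: small_radius => //; apply: le_trans le2.
Qed.

End Bishop.

Lemma step_set_parameters (R : realType) S : S \in step_sets ->
  exists k01 k02 k12 k22 : nat,
  [/\ forall w v : CC R, \sum_(s <- S) w ^ (s.1 + 1) * v ^ (s.2 + 1) = step_sum k01 k02 k12 k22 w v,
   odd_curve (CC R) k01 k02 k12 k22, step_a k02 k12 k22 (1 : CC R) != 0
   & exists x0 sg : CC R, is_node k01 k02 k12 k22 x0 sg].
Proof.
have Z0 (w : CC R) : w ^ (-1 + 1) = 1 by rewrite addNr expr0z.
have Z1 (w : CC R) : w ^ (0 + 1) = w by [].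
have Z2 (w : CC R) : w ^ (1 + 1) = w ^+ 2 by [].
rewrite /step_sets !inE => /orP[/eqP->|/orP[/eqP->|/orP[/eqP->|/orP[/eqP->|/orP[/eqP->|/orP[/eqP->|/eqP->]]]]]].
- exists 0, 0, 1, 1; split; [|exact: odd_curve_1| |exact: node1].
    by move=> w v; rewrite !big_cons big_nil /= !(Z0, Z1, Z2) /step_sum; ring.
  by rewrite /step_a expr1n !mulr1 -!natrD pnatr_eq0.
- exists 1, 0, 0, 1; split; [|exact: odd_curve_2| |exact: node2].
    by move=> w v; rewrite !big_cons big_nil /= !(Z0, Z1, Z2) /step_sum; ring.
  by rewrite /step_a expr1n !mulr1 -!natrD pnatr_eq0.
- exists 1, 0, 1, 0; split; [|exact: odd_curve_3| |exact: node3].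
    by move=> w v; rewrite !big_cons big_nil /= !(Z0, Z1, Z2) /step_sum; ring.
  by rewrite /step_a expr1n !mulr1 -!natrD pnatr_eq0.
- exists 0, 1, 1, 0; split; [|exact: odd_curve_diag| |exact: node4].
    by move=> w v; rewrite !big_cons big_nil /= !(Z0, Z1, Z2) /step_sum; ring.
  by rewrite /step_a expr1n !mulr1 -!natrD pnatr_eq0.
- exists 0, 1, 1, 1; split; [|exact: odd_curve_diag| |exact: node5].
    by move=> w v; rewrite !big_cons big_nil /= !(Z0, Z1, Z2) /step_sum; ring.
  by rewrite /step_a expr1n !mulr1 -!natrD pnatr_eq0.
- exists 1, 1, 0, 1; split; [|exact: odd_curve_diag| |exact: node6].
    by move=> w v; rewrite !big_cons big_nil /= !(Z0, Z1, Z2) /step_sum; ring.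
  by rewrite /step_a expr1n !mulr1 -!natrD pnatr_eq0.
- exists 1, 1, 1, 0; split; [|exact: odd_curve_diag| |exact: node7].
    by move=> w v; rewrite !big_cons big_nil /= !(Z0, Z1, Z2) /step_sum; ring.
  by rewrite /step_a expr1n !mulr1 -!natrD pnatr_eq0.
Qed.

Theorem mainTheorem1 (R : realType) (S : seq (int * int))
    (hS : S \in step_sets) :
  elliptic_bishop_surface (@M_ R S) /\ ~ nash_artin_property (@M_ R S).
Proof.
have [k01 [k02 [k12 [k22 [SE odd Sa1 [x0 [sg node]]]]]]] := step_set_parameters R hS.
have HM (p : 'rV[CC R]_2) :
    M_ S p <-> p 0 1 * (p 0 1)^* = p 0 0 * step_sum k01 k02 k12 k22 (p 0 1) (p 0 1)^*.
  by rewrite /M_ /= SE; split=> [/eqP|->]; [rewrite subr_eq0 => /eqP|rewrite subrr].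
split; first exact: elliptic_bishop HM.
exact: not_nash_artin HM odd Sa1 _ _ node.
Qed.
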